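(* Each of the following sets of binary strings of length $n$ can be generated in $O(n)$-amortized time per string, with the exception of the $0$-prefix normal words and the $1$-prefix normal words, which can be generated in $O(n^{1.864})$-amortized time per string: (i) all strings; (ii) strings with weight $\le k$; strings with weight $\ge k$; (iii) strings $\le\gamma$; strings $\ge\gamma$ (where $\gamma$ is a binary string of length $n$); (iv) strings with $\le k$ inversions with respect to $0^*1^*$; the same with respect to $1^*0^*$; (v) strings with $\le k$ transpositions with respect to $0^*1^*$; the same with respect to $1^*0^*$; (vi) strings $<$ their reversal; strings $>$ their reversal; (vii) strings $\le$ their reversal; strings $\ge$ their reversal; (viii) strings $<$ their complemented reversal; strings $>$ their complemented reversal; (ix) strings $\le$ their complemented reversal; strings $\ge$ their complemented reversal; (x) strings that do not contain the substring $10^t$; strings that do not contain the substring $01^t$; (xi) strings that do not have the prefix $1\gamma$; strings that do not have the prefix $0\gamma$ (where $\gamma$ is a binary string); (xii) $0$-prefix normal words; $1$-prefix normal words; (xiii) necklaces (smallest rotation); necklaces (largest rotation); (xiv) Lyndon words; aperiodic necklaces (largest rotation); (xv) prenecklaces (smallest rotation); prenecklaces (largest rotation); (xvi) pseudo-necklaces with respect to $0^*1^*$; pseudo-necklaces with respect to $1^*0^*$; (xvii) left factors of $k$-ary Dyck words; (xviii) incidence vectors of the feasible solutions to a $0$-$1$ knapsack problem.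
   Context: A set $\mathbf S$ of strings of length $n$ can be generated in $O(g(n))$-amortized time per string if there is an algorithm that, given $n$ and the parameters ($k$, $t$, $\gamma$, or the knapsack instance) of the language, lists every string of the (nonempty) set $\mathbf S$ exactly once in total time $O(g(n)\cdot|\mathbf S|)$, in the usual unit-cost RAM model (arithmetic operations on the integers involved, including knapsack weights, take constant time). Strings are written $\alpha=b_1b_2\cdots b_n$ and compared lexicographically with $0<1$. The weight is the number of $1$s. The complemented reversal of $\alpha$ is $\overline{b_n}\cdots\overline{b_1}$. An inversion with respect to $0^*1^*$ is a pair $i<j$ with $b_i=1$, $b_j=0$; with respect to $1^*0^*$ it is a pair $i<j$ with $b_i=0$, $b_j=1$. The number of transpositions of $\alpha$ with respect to $0^*1^*$ (resp. $1^*0^*$) is the minimum number of operations ''swap $b_i$ and $b_j$'' (arbitrary $i,j$) required to change $\alpha$ into a string of the form $0^*1^*$ (resp. $1^*0^*$). A string is $0$-prefix normal (resp. $1$-prefix normal) if no substring of it has more $0$s (resp. $1$s) than its prefix of the same length. A necklace (smallest rotation; resp. largest rotation) is the lexicographically smallest (resp. largest) string in its equivalence class under rotation. It is aperiodic if it cannot be written as $\beta^j$ with $j\ge 2$. A Lyndon word is an aperiodic necklace (smallest rotation). A prenecklace is a prefix of some necklace (of any length), for the corresponding choice of smallest or largest rotation. A block with respect to $0^*1^*$ is a maximal substring of the form $0^*1^*$. Write $\alpha=B_bB_{b-1}\cdots B_1$ as the concatenation of its blocks, and represent $B_i$ by $(s_i,t_i)$, its numbers of $0$s and $1$s. Put $B_i<B_j$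 if $s_i>s_j$, or $s_i=s_j$ and $t_i<t_j$. The string $\alpha$ is a pseudo-necklace with respect to $0^*1^*$ if $B_b\le B_i$ for all $1\le i<b$. A pseudo-necklace with respect to $1^*0^*$ is a string whose bitwise complement is a pseudo-necklace with respect to $0^*1^*$. A $k$-ary Dyck word is a binary string of length $tk$ (for some $t$) with $t$ copies of $1$ and $t(k-1)$ copies of $0$ such that every prefix has at most $k-1$ copies of $0$ for every $1$ (i.e. the number of $0$s is at most $k-1$ times the number of $1$s). The left factors of $k$-ary Dyck words of length $n$ are the length $n$ prefixes of $k$-ary Dyck words. A $0$-$1$ knapsack problem has a capacity $W$ and $n$ items with weights $w_i\ge 0$ (and values $v_i$), indexed so that $w_i\ge w_{i+1}$ for $1\le i\le n-1$. A subset of items is feasible if its total weight is at most $W$; its incidence vector is the string $b_1\cdots b_n$ with $b_i=1$ iff item $i$ is in the subset. *)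

(* Defs.v *)
From mathcomp Require Import all_boot all_order all_algebra.
From mathcomp Require Import reals exp.

Set Implicit Arguments.
Unset Strict Implicit.
Unset Printing Implicit Defensive.

Import Order.TTheory GRing.Theory Num.Theory.

(** ** Unit-cost RAM

    This is the RAM of Cook and Reckhow under the uniform cost criterion: a
    finite program acts on registers [X_0, X_1, ...] holding integers, and every
    executed instruction costs one unit of time.  Addition and subtraction are
    the only arithmetic operations: a unit-cost multiplication of unbounded
    integers would make the model unreasonably powerful. *)

Inductive instr : Type :=
| IConst of nat & int            (* X_i <- c *)
| IAdd of nat & nat & nat        (* X_i <- X_j + X_k *)
| ISub of nat & nat & nat        (* X_i <- X_j - X_k *)
| ILoad of nat & nat             (* X_i <- X_(X_j) *)
| IStore of nat & nat            (* X_(X_i) <- X_j *)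
| IJump of nat & nat             (* go to line m if X_j > 0 *)
| IRead of nat                   (* X_i <- next input integer *)
| IPrint of nat.                 (* append X_i to the output *)

Definition program := seq instr.

Record config : Type := Config {
  pc : nat;
  reg : nat -> int;
  input : seq int;
  output : seq int
}.

Definition set_reg (c : config) (i : nat) (v : int) : config :=
  Config (pc c).+1 [eta reg c with i |-> v] (input c) (output c).

(* [None] means that no step is possible: the program counter is outside the
   program (regular halting, see [computes]), an indirect address is negative,
   or the input is exhausted. *)
Definition step (P : program) (c : config) : option config :=
  match onth P (pc c) with
  | None => None
  | Some (IConst i a) => Some (set_reg c i a)
  | Some (IAdd i j k) => Some (set_reg c i (reg c j + reg c k)%R)
  | Some (ISub i j k) => Some (set_reg c i (reg c j - reg c k)%R)
  | Some (ILoad i j) =>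
      if reg c j is Posz a then Some (set_reg c i (reg c a)) else None
  | Some (IStore i j) =>
      if reg c i is Posz a then Some (set_reg c a (reg c j)) else None
  | Some (IJump j m) =>
      Some (Config (if (0 < reg c j)%R then m else (pc c).+1)
                   (reg c) (input c) (output c))
  | Some (IRead i) =>
      if input c is a :: inp
      then Some (Config (pc c).+1 [eta reg c with i |-> a] inp (output c))
      else None
  | Some (IPrint i) =>
      Some (Config (pc c).+1 (reg c) (input c) (rcons (output c) (reg c i)))
  end.

Definition initial (inp : seq int) : config :=
  Config 0 (fun=> 0%R) inp [::].

(* On [inp], [P] halts after exactly [T] steps, having printed [outp]. *)
Definition computes (P : program) (inp : seq int) (T : nat) (outp : seq int) :
    Prop :=
  exists c : config,
    [/\ iter T (obind (step P)) (Some (initial inp)) = Some c,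
        (size P <= pc c)%N
      & output c = outp].

(** ** Generation in amortized time

    Strings are [seq bool], with [true] for 1 and [false] for 0. *)

Definition bits (s : seq bool) : seq int := [seq Posz (nat_of_bool b) | b <- s].

(* [S n p] is a language whose words of length [n] are to be listed; [p : Par n]
   are its parameters and [enc n p] their encoding on the input, after [n].  The
   words are printed bit by bit one after the other; as they all have length
   [n > 0], the output determines the list [L].  (For [n = 0] the bounds below
   would be 0.)  Neither the program nor the constant depends on [n] or [p]. *)
Definition generable (R : realType) (g : nat -> R) (Par : nat -> Type)
    (enc : forall n, Par n -> seq int)
    (S : forall n, Par n -> seq bool -> Prop) : Prop :=
  exists (P : program) (C : R), forall (n : nat) (p : Par n),
    (0 < n)%N -> (exists s, size s = n /\ S n p s) ->
    exists (L : seq (seq bool)) (T : nat),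
      [/\ uniq L,
          forall s, s \in L <-> (size s = n /\ S n p s),
          computes P (Posz n :: enc n p) T (bits (flatten L))
        & (T%:R <= C * g n * (size L)%:R)%R].

Definition linear_bound (R : realType) (n : nat) : R := (n%:R)%R.
Definition pow1864_bound (R : realType) (n : nat) : R :=
  (n%:R `^ (1864%:R / 1000%:R))%R.

Definition enc_none (n : nat) (_ : unit) : seq int := [::].
Definition enc_nat (n : nat) (k : nat) : seq int := [:: Posz k].
Definition enc_tuple (n : nat) (gamma : n.-tuple bool) : seq int := bits gamma.
Definition enc_string (n : nat) (gamma : seq bool) : seq int :=
  Posz (size gamma) :: bits gamma.

(** ** Languages *)

Definition lexle (s t : seq bool) : bool :=
  ((s : seqlexi bool) <= (t : seqlexi bool))%O.
Definition lexlt (s t : seq bool) : bool :=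
  ((s : seqlexi bool) < (t : seqlexi bool))%O.

Definition weight (s : seq bool) : nat := count_mem true s.
Definition compl (s : seq bool) : seq bool := map negb s.
Definition crev (s : seq bool) : seq bool := compl (rev s).

(* In the two notions below, [a = false] refers to 0*1* and [a = true] to
   1*0*. *)
Definition sorted_form (a : bool) (s : seq bool) : Prop :=
  exists x y : nat, s = nseq x a ++ nseq y (~~ a).

Definition inversions (a : bool) (s : seq bool) : nat :=
  #|[pred p : 'I_(size s) * 'I_(size s) |
      [&& (p.1 < p.2)%N, nth false s p.1 == ~~ a & nth false s p.2 == a]]|.

Definition swap (s : seq bool) (p : nat * nat) : seq bool :=
  mkseq (fun m => nth false s (if m == p.1 then p.2
                               else if m == p.2 then p.1 else m)) (size s).

Definition sortable_in (a : bool) (s : seq bool) (m : nat) : Prop :=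
  exists ps : seq (nat * nat),
    [/\ size ps = m,
        all (fun p => (p.1 < size s)%N && (p.2 < size s)%N) ps
      & sorted_form a (foldl swap s ps)].

Definition transpositions (a : bool) (s : seq bool) (m : nat) : Prop :=
  sortable_in a s m /\ forall m', sortable_in a s m' -> (m <= m')%N.

Definition prefix_normal (a : bool) (s : seq bool) : Prop :=
  forall u, infix u s ->
    (count_mem a u <= count_mem a (take (size u) s))%N.

Definition necklace_min (s : seq bool) : Prop := forall i, lexle s (rot i s).
Definition necklace_max (s : seq bool) : Prop := forall i, lexle (rot i s) s.

Definition aperiodic (s : seq bool) : Prop :=
  ~ exists (u : seq bool) (j : nat), (2 <= j)%N /\ s = flatten (nseq j u).

Definition lyndon (s : seq bool) : Prop := aperiodic s /\ necklace_min s.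

Definition prenecklace_min (s : seq bool) : Prop :=
  exists w, necklace_min w /\ prefix s w.
Definition prenecklace_max (s : seq bool) : Prop :=
  exists w, necklace_max w /\ prefix s w.

(* The occurrence of [B] in [u ++ B ++ v] is a block with respect to 0*1*. *)
Definition is_block (u B v : seq bool) : Prop :=
  sorted_form false B /\
  forall u' x y v', u = u' ++ x -> v = y ++ v' ->
    sorted_form false (x ++ B ++ y) -> x = [::] /\ y = [::].

Definition block_decomposition (s : seq bool) (Bs : seq (seq bool)) : Prop :=
  s = flatten Bs /\
  forall l B r, Bs = l ++ B :: r -> is_block (flatten l) B (flatten r).

Definition block_lt (B B' : seq bool) : bool :=
  let s := count_mem false B in let t := count_mem true B in
  let s' := count_mem false B' in let t' := count_mem true B' in
  (s' < s)%N || ((s == s') && (t < t')%N).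

Definition block_le (B B' : seq bool) : bool := (B == B') || block_lt B B'.

Definition pseudo_necklace (s : seq bool) : Prop :=
  exists (B : seq bool) (Bs : seq (seq bool)),
    block_decomposition s (B :: Bs) /\ forall B', B' \in Bs -> block_le B B'.

(* For [k = 0] only the empty word qualifies. *)
Definition dyck (k : nat) (w : seq bool) : Prop :=
  exists t : nat,
    [/\ size w = (t * k)%N, count_mem true w = t,
        count_mem false w = (t * (k - 1))%N
      & forall u, prefix u w ->
          (count_mem false u <= (k - 1) * count_mem true u)%N].

Definition dyck_left_factor (k : nat) (s : seq bool) : Prop :=
  exists w, dyck k w /\ prefix s w.

Record knapsack (n : nat) : Type := Knapsack {
  capacity : int;
  weights : n.-tuple int;
  values : n.-tuple int;
  weights_ge0 : all (fun w : int => (0 <= w)%R) weights;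
  weights_noninc : sorted (fun w w' : int => (w' <= w)%R) weights
}.

Definition enc_knapsack (n : nat) (K : knapsack n) : seq int :=
  capacity K :: weights K ++ values K.

Definition feasible (n : nat) (K : knapsack n) (s : seq bool) : Prop :=
  (\sum_(i < n | nth false s i) tnth (weights K) i <= capacity K)%R.

(* Main.v *)
(* Order the words of a language as a tree: the parent of a word containing a 1
   is the word with its leftmost 1 replaced by 0.  If the language is closed
   under 0^a 1 b v |-> 0^a 0 1 v, then the children of a member, listed by the
   position of the new 1 from right to left, are members up to some position and
   none beyond it.  A depth-first traversal stops at the first child that fails,
   so it makes at most one unsuccessful test per word of the language, and a
   membership test in O(n) suffices for O(n) amortized time.  Up to reversal and
   complement every language of the theorem except the prefix normal words is of
   this kind.  Weight, inversions and transpositions are counted, lexicographic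
   conditions are scanned, necklaces are recognized by Duval's algorithm.

   Read from right to left, the prefix normal words are closed under deleting the
   leftmost 1 and under moving it to the left, so the same traversal works with
   the children taken from left to right.  As the parent is known to be a member,
   only factors beginning at the new 1 can violate the condition, which again
   takes O(n) to test; this is better than the required n^1.864. *)

Require Import Defs.
From mathcomp Require Import all_boot all_order all_algebra.
From mathcomp Require Import reals exp.
From mathcomp Require Import zify.

Set Implicit Arguments.
Unset Strict Implicit.
Unset Printing Implicit Defensive.

Import Order.TTheory GRing.Theory Num.Theory.

(** * A structured language *)

(** One closure property serves two ends. Applied to a leftmost 1 followed by 0 it moves this 1 to
    the right, applied to 11 it deletes the first 1; so it gives both the order among the children
    and the membership of the parent. The exception is the root: 0^n need not be a member (it is no
    Lyndon word for [n > 1]), but it is visited in any case. The extra rounds are absorbed since the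
    language is nonempty and [n > 0]. The obstacle is the cost model: there is no multiplication,
    jumps are absolute, and one program with one constant must serve all [n] and all parameters.
    Tests are therefore written in a small language whose only loop runs [n] times. Their cost can
    be read off the syntax and is linear if loops are not nested. A generic driver turns a test into
    a generator, and each language is left with the correctness of its test and the combinatorics of
    a single shift. *)

(* Variable 0 holds [n].  [For i c] runs [c] for [i = 0, .., n - 1].  Reading
   an empty input only sets the flag [bad], writing an array at a negative index
   does nothing, and reading there gives 0. *)
Inductive exp : Type :=
| EC of int
| EV of nat
| EA of exp & exp
| ES of exp & exp
| EG of bool & exp.

Inductive cmd : Type :=
| Asn of nat & exp
| Put of bool & exp & exp
| Rd of nat
| Pr of exp
| Seq of cmd & cmd
| If of exp & cmd & cmd
| For of nat & cmd.

Record state : Type := State {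
  var : nat -> int;
  arr : bool -> nat -> int;
  inp : seq int;
  out : seq int;
  bad : bool
}.

Definition upd (f : nat -> int) (i : nat) (v : int) : nat -> int :=
  fun x => if eqn x i then v else f x.

Definition setv (s : state) (f : nat -> int) : state :=
  State f (arr s) (inp s) (out s) (bad s).

Definition geti (f : nat -> int) (z : int) : int :=
  if z is Posz k then f k else 0%R.

Definition puti (f : nat -> int) (z v : int) : nat -> int :=
  if z is Posz k then upd f k v else f.

Fixpoint eval (s : state) (e : exp) : int :=
  match e with
  | EC c => c
  | EV x => var s x
  | EA a b => (eval s a + eval s b)%R
  | ES a b => (eval s a - eval s b)%R
  | EG a e => geti (arr s a) (eval s e)
  end.

Definition bound (s : state) : nat := if var s 0 is Posz n then n else 0.

Fixpoint run (c : cmd) (s : state) : state :=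
  match c with
  | Asn x e => setv s (upd (var s) x (eval s e))
  | Put a e e' =>
      State (var s)
        (fun a' => if eqb a' a then puti (arr s a) (eval s e) (eval s e')
                   else arr s a')
        (inp s) (out s) (bad s)
  | Rd x =>
      if inp s is v :: r
      then State (upd (var s) x v) (arr s) r (out s) (bad s)
      else State (var s) (arr s) (inp s) (out s) true
  | Pr e => State (var s) (arr s) (inp s) (rcons (out s) (eval s e)) (bad s)
  | Seq c1 c2 => run c2 (run c1 s)
  | If e c1 c2 => if (0 < eval s e)%R then run c1 s else run c2 s
  | For i c =>
      iter (bound s)
        (fun st => let st' := run c st in
                   setv st' (upd (var st') i (var st' i + 1)%R))
        (setv s (upd (var s) i 0%R))
  end.

Fixpoint writes (c : cmd) : seq nat :=
  match c with
  | Asn x _ | Rd x => [:: x]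
  | Put _ _ _ | Pr _ => [::]
  | Seq c1 c2 | If _ c1 c2 => writes c1 ++ writes c2
  | For i c => i :: writes c
  end.

Fixpoint puts (c : cmd) : seq bool :=
  match c with
  | Put a _ _ => [:: a]
  | Seq c1 c2 | If _ c1 c2 => puts c1 ++ puts c2
  | For _ c => puts c
  | _ => [::]
  end.

Fixpoint reads (c : cmd) : bool :=
  match c with
  | Rd _ => true
  | Seq c1 c2 | If _ c1 c2 => reads c1 || reads c2
  | For _ c => reads c
  | _ => false
  end.

Fixpoint prints (c : cmd) : bool :=
  match c with
  | Pr _ => true
  | Seq c1 c2 | If _ c1 c2 => prints c1 || prints c2
  | For _ c => prints c
  | _ => false
  end.

Fixpoint loops (c : cmd) : nat :=
  match c with
  | Seq c1 c2 | If _ c1 c2 => maxn (loops c1) (loops c2)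
  | For _ c => (loops c).+1
  | _ => 0
  end.

(* The loop variable and the bound [n], kept in variable 0, are read only in a
   loop body. *)
Fixpoint wf (c : cmd) : bool :=
  match c with
  | Seq c1 c2 | If _ c1 c2 => wf c1 && wf c2
  | For i c => [&& wf c, i != 0, i \notin writes c & 0 \notin writes c]
  | _ => true
  end.

Lemma updE f i v x : upd f i v x = if x == i then v else f x.
Proof. by rewrite /upd eqnE. Qed.

Lemma iter_inv (T : Type) (Q : T -> Prop) (f : T -> T) n s :
  (forall t, Q t -> Q (f t)) -> Q s -> Q (iter n f s).
Proof. by move=> H; elim: n => //= n IH /IH /H. Qed.

Lemma run_var c s x : x \notin writes c -> var (run c s) x = var s x.
Proof.
elim: c s => [y e|a e e'|y|e|c1 IH1 c2 IH2|e c1 IH1 c2 IH2|i c IH] s /=.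
- by rewrite inE updE => /negbTE ->.
- by [].
- by rewrite inE => /negbTE xy; case: (inp s) => [|v r] //=; rewrite updE xy.
- by [].
- by rewrite mem_cat negb_or => /andP [h1 h2]; rewrite IH2 ?IH1.
- by rewrite mem_cat negb_or => /andP [h1 h2]; case: ifP => _; rewrite ?IH1 ?IH2.
rewrite inE negb_or => /andP [/negbTE xi h].
apply: (iter_inv (Q := fun t => var t x = var s x)) => [t|] /=; last by rewrite updE xi.
by rewrite updE xi IH.
Qed.

Lemma run_arr c s a : a \notin puts c -> arr (run c s) a = arr s a.
Proof.
elim: c s => [y e|a' e e'|y|e|c1 IH1 c2 IH2|e c1 IH1 c2 IH2|i c IH] s //=.
- by rewrite inE eqbE => /negbTE ->.
- by case: (inp s).
- by rewrite mem_cat negb_or => /andP [h1 h2]; rewrite IH2 ?IH1.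
- by rewrite mem_cat negb_or => /andP [h1 h2]; case: ifP => _; rewrite ?IH1 ?IH2.
move=> h; apply: (iter_inv (Q := fun t => arr t a = arr s a)) => [t|] //=.
by rewrite IH.
Qed.

Lemma run_inp c s : ~~ reads c -> inp (run c s) = inp s /\ bad (run c s) = bad s.
Proof.
elim: c s => [y e|a' e e'|y|e|c1 IH1 c2 IH2|e c1 IH1 c2 IH2|i c IH] s //=.
- rewrite negb_or => /andP [h1 h2].
  by case: (IH2 (run c1 s) h2) => -> ->; apply: IH1.
- by rewrite negb_or => /andP [h1 h2]; case: ifP => _; auto.
move=> h; apply: (iter_inv (Q := fun t => inp t = inp s /\ bad t = bad s)) => [t|] //=.
by case: (IH t h) => -> ->.
Qed.

Lemma run_out c s : ~~ prints c -> out (run c s) = out s.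
Proof.
elim: c s => [y e|a' e e'|y|e|c1 IH1 c2 IH2|e c1 IH1 c2 IH2|i c IH] s //=.
- by case: (inp s).
- by rewrite negb_or => /andP [h1 h2]; rewrite IH2 ?IH1.
- by rewrite negb_or => /andP [h1 h2]; case: ifP => _; auto.
move=> h; apply: (iter_inv (Q := fun t => out t = out s)) => [t|] //=.
by rewrite IH.
Qed.

(** A clear flag at the end therefore certifies that no read failed on the way; the RAM would block
    at such a read. *)
Lemma run_bad c s : bad s -> bad (run c s).
Proof.
elim: c s => [y e|a' e e'|y|e|c1 IH1 c2 IH2|e c1 IH1 c2 IH2|i c IH] s //= h.
- by case: (inp s).
- by auto.
- by case: ifP => _; auto.
by apply: (iter_inv (Q := fun t => bad t)) => [t /IH|].
Qed.

(** * Compilation *)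

(* Registers are shared out modulo 4 among the variables, the evaluation stack
   and the two arrays. *)
Definition V (x : nat) : nat := 4 * x.
Definition Tm (t : nat) : nat := 4 * t + 1.
Definition A (a : bool) (i : nat) : nat := 4 * i + 2 + a.

(** Jump targets are absolute, hence the offset [off]. The value is left in [Tm t], and only stack
    cells from [t] on are used. As jumps test for a positive value, an array access tests its index
    plus 1; the address is formed by doubling the index twice. *)
Fixpoint compile_exp (off t : nat) (e : exp) : seq instr :=
  match e with
  | EC c => [:: IConst (Tm t) c]
  | EV x => [:: IConst (Tm t) 0; IAdd (Tm t) (V x) (Tm t)]
  | EA a b =>
      let ca := compile_exp off t a in
      let cb := compile_exp (off + size ca) t.+1 b in
      ca ++ cb ++ [:: IAdd (Tm t) (Tm t) (Tm t.+1)]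
  | ES a b =>
      let ca := compile_exp off t a in
      let cb := compile_exp (off + size ca) t.+1 b in
      ca ++ cb ++ [:: ISub (Tm t) (Tm t) (Tm t.+1)]
  | EG a e =>
      let ce := compile_exp off t e in
      let o := off + size ce in
      ce ++ [:: IConst (Tm t.+1) 1;
                IAdd (Tm t.+1) (Tm t) (Tm t.+1);
                IJump (Tm t.+1) (o + 6);
                IConst (Tm t) 0;
                IConst (Tm t.+1) 1;
                IJump (Tm t.+1) (o + 11);
                IAdd (Tm t) (Tm t) (Tm t);
                IAdd (Tm t) (Tm t) (Tm t);
                IConst (Tm t.+1) (Posz (2 + a));
                IAdd (Tm t) (Tm t) (Tm t.+1);
                ILoad (Tm t) (Tm t)]
  end.

(** An unconditional jump is a jump on a register just set to 1. A loop is entered at its test,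
    which stands behind the body, so no round is run when variable 0 is not positive. *)
Fixpoint compile (off : nat) (c : cmd) : seq instr :=
  match c with
  | Asn x e =>
      compile_exp off 0 e ++ [:: IConst (Tm 1) 0; IAdd (V x) (Tm 0) (Tm 1)]
  | Put a e e' =>
      let ce := compile_exp off 0 e in
      let ce' := compile_exp (off + size ce) 1 e' in
      let o := off + size ce + size ce' in
      ce ++ ce' ++
      [:: IConst (Tm 2) 1;
          IAdd (Tm 2) (Tm 0) (Tm 2);
          IJump (Tm 2) (o + 5);
          IConst (Tm 2) 1;
          IJump (Tm 2) (o + 10);
          IAdd (Tm 0) (Tm 0) (Tm 0);
          IAdd (Tm 0) (Tm 0) (Tm 0);
          IConst (Tm 2) (Posz (2 + a));
          IAdd (Tm 0) (Tm 0) (Tm 2);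
          IStore (Tm 0) (Tm 1)]
  | Rd x => [:: IRead (V x)]
  | Pr e => compile_exp off 0 e ++ [:: IPrint (Tm 0)]
  | Seq c1 c2 =>
      let p1 := compile off c1 in p1 ++ compile (off + size p1) c2
  | If e c1 c2 =>
      let ce := compile_exp off 0 e in
      let o := off + size ce in
      let p2 := compile (o + 1) c2 in
      let o1 := o + 1 + size p2 + 2 in
      let p1 := compile o1 c1 in
      ce ++ [:: IJump (Tm 0) o1] ++ p2 ++
      [:: IConst (Tm 0) 1; IJump (Tm 0) (o1 + size p1)] ++ p1
  | For i c =>
      let p := compile (off + 3) c in
      [:: IConst (V i) 0; IConst (Tm 0) 1; IJump (Tm 0) (off + 3 + size p + 2)] ++
      p ++
      [:: IConst (Tm 0) 1; IAdd (V i) (V i) (Tm 0);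
          ISub (Tm 0) (V 0) (V i); IJump (Tm 0) (off + 3)]
  end.

Definition code_at (P : program) (off : nat) (l : seq instr) : Prop :=
  exists p r, P = p ++ l ++ r /\ size p = off.

Definition reach (P : program) (c : config) (t : nat) (c' : config) : Prop :=
  iter t (obind (step P)) (Some c) = Some c'.

(** The stack registers are left free, so that writing to them preserves the relation. *)
Definition sim (s : state) (r : nat -> int) : Prop :=
  (forall x, r (V x) = var s x) /\ (forall a i, r (A a i) = arr s a i).

Lemma code_at_cat P off l1 l2 :
  code_at P off (l1 ++ l2) ->
  code_at P off l1 /\ code_at P (off + size l1) l2.
Proof.
move=> [p [r [-> <-]]]; split.
  by exists p, (l2 ++ r); rewrite -!catA.
by exists (p ++ l1), r; rewrite size_cat -!catA.
Qed.

Lemma code_at_cons P off x l :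
  code_at P off (x :: l) -> onth P off = Some x /\ code_at P off.+1 l.
Proof.
rewrite -cat1s => /code_at_cat [[p [r [-> <-]]]]; rewrite addn1 => h; split=> //.
by rewrite onthE map_cat nth_cat size_map ltnn subnn.
Qed.

Lemma reach0 P c : reach P c 0 c. Proof. by []. Qed.

Lemma reach_trans P c1 t1 c2 t2 c3 :
  reach P c1 t1 c2 -> reach P c2 t2 c3 -> reach P c1 (t1 + t2) c3.
Proof. by rewrite /reach addnC iterD => -> . Qed.

Lemma reach_step P c1 c2 t c3 :
  step P c1 = Some c2 -> reach P c2 t c3 -> reach P c1 t.+1 c3.
Proof. by move=> h; rewrite /reach iterSr /= h. Qed.

Definition rset (r : nat -> int) (i : nat) (v : int) : nat -> int :=
  [eta r with i |-> v].

Lemma rsetE r i v x : rset r i v x = if x == i then v else r x.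
Proof. by []. Qed.

Local Arguments rset : simpl never.

Lemma eq_VT x t : (V x == Tm t) = false. Proof. by apply/eqP; rewrite /V /Tm; lia. Qed.
Lemma eq_TV x t : (Tm t == V x) = false. Proof. by apply/eqP; rewrite /V /Tm; lia. Qed.
Lemma eq_AT a i t : (A a i == Tm t) = false.
Proof. by apply/eqP; rewrite /A /Tm; case: a; lia. Qed.
Lemma eq_AV a i x : (A a i == V x) = false.
Proof. by apply/eqP; rewrite /A /V; case: a; lia. Qed.
Lemma eq_VA a i x : (V x == A a i) = false.
Proof. by rewrite eq_sym eq_AV. Qed.
Lemma eq_TA a i t : (Tm t == A a i) = false.
Proof. by rewrite eq_sym eq_AT. Qed.
Lemma eq_VV x y : (V x == V y) = (x == y).
Proof. by apply/eqP/eqP; rewrite /V; lia. Qed.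
Lemma eq_TT x y : (Tm x == Tm y) = (x == y).
Proof. by apply/eqP/eqP; rewrite /Tm; lia. Qed.
Lemma eq_AA a i b j : (A a i == A b j) = (a == b) && (i == j).
Proof.
by apply/eqP/andP => [|[/eqP -> /eqP ->] //]; rewrite /A; case: a; case: b => /= h;
   split; apply/eqP; lia.
Qed.

Definition eqE_ := (rsetE, eq_VT, eq_TV, eq_AT, eq_AV, eq_VA, eq_TA, eq_VV, eq_TT, eq_AA).

Lemma sim_tmp s r t v : sim s r -> sim s (rset r (Tm t) v).
Proof. by move=> [h1 h2]; split=> *; rewrite !eqE_. Qed.

Local Arguments onth : simpl never.

Ltac do_step :=
  apply: reach_step;
    [ rewrite /step /=;
      match goal with H : onth ?P ?x = _ |- context [onth ?P ?x] => rewrite H end;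
      reflexivity
    | rewrite /set_reg /= ?(addnS, addn0) ].

Ltac go c :=
  apply: (@reach_step _ _ c);
    [ rewrite /step; cbn [pc reg input output];
      match goal with H : onth ?P ?x = _ |- context [onth ?P ?x] => rewrite H end;
      cbn [pc reg input output]
    | ].

Ltac get_code := repeat (case/code_at_cons; let h := fresh "cd" in move=> h).

Lemma tmp_lt (r : nat -> int) t u v : u < t -> (rset r (Tm t) v) (Tm u) = r (Tm u).
Proof. by move=> ut; rewrite !eqE_ ltn_eqF. Qed.

(** Compiled expressions only jump forwards, so their length bounds the number of steps. The last
    clause keeps the left operand alive while the right one is evaluated. *)
Lemma compile_expP P off t e s r i o :
  code_at P off (compile_exp off t e) -> sim s r ->
  exists k r', [/\ k <= size (compile_exp off t e),
    reach P (Config off r i o) k (Config (off + size (compile_exp off t e)) r' i o),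
    sim s r', r' (Tm t) = eval s e & forall u, u < t -> r' (Tm u) = r (Tm u)].
Proof.
have neq u v : u < v -> (u == v) = false by move=> h; rewrite ltn_eqF.
elim: e off t r => [c|x|a IHa b IHb|a IHa b IHb|a e IH] off t r /=.
- get_code => _ hs; exists 1, (rset r (Tm t) c); split=> //=.
  + by rewrite addn1; do_step; apply: reach0.
  + exact: sim_tmp.
  + by rewrite rsetE eqxx.
  + by move=> u ut; rewrite !eqE_ neq.
- get_code => _ hs.
  exists 2, (rset (rset r (Tm t) 0%R) (Tm t) (var s x)); split=> //=.
  + rewrite addn2; do 2 do_step.
    by rewrite -!/(rset _ _ _) !eqE_ eqxx addr0 (proj1 hs); apply: reach0.
  + exact/sim_tmp/sim_tmp.
  + by rewrite rsetE eqxx.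
  + by move=> u ut; rewrite !eqE_ neq.
- move=> /code_at_cat [hca /code_at_cat [hcb]]; get_code => _ hs.
  have [k1 [r1 [k1le run1 sim1 e1 f1]]] := IHa off t r hca hs.
  have [k2 [r2 [k2le run2 sim2 e2 f2]]] := IHb _ t.+1 r1 hcb sim1.
  exists (k1 + (k2 + 1)), (rset r2 (Tm t) (eval s a + eval s b)%R); split=> //=.
  + by rewrite !size_cat /=; lia.
  + apply: reach_trans run1 (reach_trans run2 _).
    do_step; rewrite f2 // e1 e2 !size_cat /= !addnA addn1; exact: reach0.
  + exact: sim_tmp.
  + by rewrite rsetE eqxx.
  + by move=> u ut; rewrite !eqE_ neq // f2 ?f1 // ltnW.
- move=> /code_at_cat [hca /code_at_cat [hcb]]; get_code => _ hs.
  have [k1 [r1 [k1le run1 sim1 e1 f1]]] := IHa off t r hca hs.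
  have [k2 [r2 [k2le run2 sim2 e2 f2]]] := IHb _ t.+1 r1 hcb sim1.
  exists (k1 + (k2 + 1)), (rset r2 (Tm t) (eval s a - eval s b)%R); split=> //=.
  + by rewrite !size_cat /=; lia.
  + apply: reach_trans run1 (reach_trans run2 _).
    do_step; rewrite f2 // e1 e2 !size_cat /= !addnA addn1; exact: reach0.
  + exact: sim_tmp.
  + by rewrite rsetE eqxx.
  + by move=> u ut; rewrite !eqE_ neq // f2 ?f1 // ltnW.
rewrite size_cat /= addnA; set q := off + _.
move=> /code_at_cat [hce]; rewrite -/q; get_code => _ hs.
have [k1 [r1 [k1le run1 sim1 e1 f1]]] := IH off t r hce hs.
have nt : (t == t.+1) = false by rewrite neq.
have nt' : (t.+1 == t) = false by rewrite eq_sym.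
case ez : (eval s e) => [m|m].
  pose r2 := (rset r1 (Tm t.+1) 1%R).
  pose r3 := (rset r2 (Tm t.+1) (r2 (Tm t) + r2 (Tm t.+1))%R).
  pose r4 := (rset r3 (Tm t) (r3 (Tm t) + r3 (Tm t))%R).
  pose r5 := (rset r4 (Tm t) (r4 (Tm t) + r4 (Tm t))%R).
  pose r6 := (rset r5 (Tm t.+1) (Posz (2 + a))).
  pose r7 := (rset r6 (Tm t) (r6 (Tm t) + r6 (Tm t.+1))%R).
  have s7 : sim s r7 by do 6 apply: sim_tmp.
  have r3E : r3 (Tm t.+1) = Posz m.+1.
    by rewrite /r3 /r2 !eqE_ !eqxx nt e1 ez; lia.
  have r7E : r7 (Tm t) = Posz (A a m).
    rewrite /r7 !eqE_ eqxx /r6 !eqE_ eqxx nt /r5 !eqE_ eqxx /r4 !eqE_ eqxx /r3 !eqE_ nt /r2 !eqE_ nt.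
    by rewrite e1 ez /A; lia.
  exists (k1 + 8), (rset r7 (Tm t) (arr s a m)); split=> //.
  - by rewrite leq_add.
  - apply: reach_trans run1 _.
    go (Config q.+1 r2 i o); first by [].
    go (Config q.+2 r3 i o); first by [].
    go (Config (q + 6) r3 i o); first by rewrite r3E.
    rewrite !(addnS, addn0).
    go (Config q.+3.+4 r4 i o); first by [].
    go (Config q.+4.+4 r5 i o); first by [].
    go (Config q.+1.+4.+4 r6 i o); first by [].
    go (Config q.+2.+4.+4 r7 i o); first by [].
    apply: reach_step; last exact: reach0.
    by rewrite /step; cbn [pc reg input output]; rewrite cd9 r7E (proj2 s7).
  - exact: sim_tmp.
  - by rewrite rsetE eqxx.
  - move=> u ut; have ut1 : u < t.+1 by rewrite ltnW.
    by rewrite tmp_lt // /r7 tmp_lt // /r6 tmp_lt // /r5 tmp_lt // /r4 tmp_lt // /r3 tmp_lt // /r2 tmp_lt // f1.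
pose r2 := (rset r1 (Tm t.+1) 1%R).
pose r3 := (rset r2 (Tm t.+1) (r2 (Tm t) + r2 (Tm t.+1))%R).
pose r4 := (rset r3 (Tm t) 0%R).
pose r5 := (rset r4 (Tm t.+1) 1%R).
have r3E : (0 < r3 (Tm t.+1))%R = false.
  by rewrite /r3 /r2 !eqE_ !eqxx nt e1 ez; lia.
exists (k1 + 6), r5; split=> //.
- by rewrite leq_add.
- apply: reach_trans run1 _.
  go (Config q.+1 r2 i o); first by [].
  go (Config q.+2 r3 i o); first by [].
  go (Config q.+3 r3 i o); first by rewrite r3E.
  go (Config q.+4 r4 i o); first by [].
  go (Config q.+1.+4 r5 i o); first by [].
  apply: reach_step; last exact: reach0.
  by rewrite /step; cbn [pc reg input output]; rewrite cd4 /r5 rsetE eqxx.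
- by do 4 apply: sim_tmp.
- by rewrite /r5 !eqE_ nt /r4 !eqE_ eqxx.
- move=> u ut; have ut1 : u < t.+1 by rewrite ltnW.
  by rewrite /r5 tmp_lt // /r4 tmp_lt // /r3 tmp_lt // /r2 tmp_lt // f1.
Qed.

(** Both branches of [If] are charged, which makes the bound depend on [n] alone. In [For], 5 counts
    the initialization with the first test, and 4 the increment and test of each round. *)
Fixpoint cst (c : cmd) (n : nat) : nat :=
  match c with
  | Seq c1 c2 => cst c1 n + cst c2 n
  | If e c1 c2 => size (compile_exp 0 0 e) + 3 + cst c1 n + cst c2 n
  | For _ c => 5 + n * (cst c n + 4)
  | _ => size (compile 0 c)
  end.

Lemma size_compile_exp off t e : size (compile_exp off t e) = size (compile_exp 0 0 e).
Proof.
elim: e off t => [c|x|a IHa b IHb|a IHa b IHb|a e IH] off t //=; rewrite !size_cat /=.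
- by rewrite IHa IHb [X in _ = _ + (X + _)]IHb.
- by rewrite IHa IHb [X in _ = _ + (X + _)]IHb.
- by rewrite IH.
Qed.

Lemma run_bound c s : wf c -> 0 \notin writes c -> bound (run c s) = bound s.
Proof. by move=> _ h; rewrite /bound run_var. Qed.

(** The clear flag excludes the one case where source and RAM diverge, a read from an empty input.
    As variable 0 is never written, all loops inside [c] see the same [n]. *)
Lemma compileP P off c s r n :
  wf c -> 0 \notin writes c -> bound s = n ->
  code_at P off (compile off c) -> sim s r -> bad (run c s) = false ->
  exists k r', [/\ k <= cst c n,
    reach P (Config off r (inp s) (out s)) k
      (Config (off + size (compile off c)) r' (inp (run c s)) (out (run c s)))
    & sim (run c s) r'].
Proof.
elim: c off s r => [x e|a e e'|x|e|c1 IH1 c2 IH2|e c1 IH1 c2 IH2|x c IH] off s r.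
- move=> _ _ _ /= /code_at_cat [he]; get_code => _ hs _.
  have [k [r1 [k1 run1 s1 e1 _]]] := compile_expP (inp s) (out s) he hs.
  pose r2 := (rset r1 (Tm 1) 0%R).
  pose r3 := (rset r2 (V x) (eval s e)).
  exists (k + 2), r3; split.
  + by rewrite size_cat /= leq_add // (leq_trans k1) // size_compile_exp.
  + apply: reach_trans run1 _; rewrite size_cat /= !addnS addn0.
    go (Config (off + size (compile_exp off 0 e)).+1 r2 (inp s) (out s)); first by [].
    apply: reach_step; last exact: reach0.
    by rewrite /step; cbn [pc reg input output]; rewrite cd0 /set_reg; cbn [reg]; rewrite /r3 /r2 !eqE_ /= e1 addr0.
  + have [h1 h2] : sim s r2 by apply: sim_tmp.
    split=> [y|b i]; rewrite /r3 !eqE_ /=; last exact: (h2 b i).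
    by rewrite updE; case: eqP => // _; exact: (h1 y).
- move=> _ _ _ /= /code_at_cat [he /code_at_cat [he']]; get_code => _ hs _.
  have [k [r1 [k1 run1 s1 e1 _]]] := compile_expP (inp s) (out s) he hs.
  have [k' [r2 [k1' run2 s2 e2 f2]]] := compile_expP (inp s) (out s) he' s1.
  rewrite -f2 // in e1.
  have {k1'} k1' : k' <= size (compile_exp (0 + size (compile_exp 0 0 e)) 1 e').
    by rewrite size_compile_exp in k1'; rewrite size_compile_exp.
  have {k1} k1 : k <= size (compile_exp 0 0 e) by rewrite size_compile_exp in k1.
  pose r3 := (rset r2 (Tm 2) 1%R).
  pose r4 := (rset r3 (Tm 2) (r3 (Tm 0) + r3 (Tm 2))%R).
  set q := (off + _ + _) in cd cd0 cd1 cd2 cd3 cd4 cd5 cd6 cd7 cd8.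
  rewrite !size_cat /= !addnA -/q.
  have r4E : r4 (Tm 2) = (eval s e + 1)%R.
    by rewrite /r4 /r3 !eqE_ /= e1.
  case ez : (eval s e) => [m|m].
    pose r5 := (rset r4 (Tm 0) (r4 (Tm 0) + r4 (Tm 0))%R).
    pose r6 := (rset r5 (Tm 0) (r5 (Tm 0) + r5 (Tm 0))%R).
    pose r7 := (rset r6 (Tm 2) (Posz (2 + a))).
    pose r8 := (rset r7 (Tm 0) (r7 (Tm 0) + r7 (Tm 2))%R).
    have r8E : r8 (Tm 0) = Posz (A a m).
      rewrite /r8 !eqE_ /= /r7 !eqE_ /= /r6 !eqE_ /= /r5 !eqE_ /= /r4 !eqE_ /= /r3 !eqE_ /=.
      by rewrite e1 ez /A; lia.
    have r8E' : r8 (Tm 1) = eval s e'.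
      by rewrite /r8 !eqE_ /= /r7 !eqE_ /= /r6 !eqE_ /= /r5 !eqE_ /= /r4 !eqE_ /= /r3 !eqE_.
    have s8 : sim s r8 by do 6 apply: sim_tmp.
    exists (k + (k' + 8)), (rset r8 (A a m) (eval s e')); split.
    + by lia.
    + apply: reach_trans run1 (reach_trans run2 _); rewrite -/q.
      go (Config q.+1 r3 (inp s) (out s)); first by [].
      go (Config q.+2 r4 (inp s) (out s)); first by [].
      go (Config (q + 5) r4 (inp s) (out s)); first by rewrite r4E ez; case: ifP => //; lia.
      rewrite !(addnS, addn0).
      go (Config q.+2.+4 r5 (inp s) (out s)); first by [].
      go (Config q.+3.+4 r6 (inp s) (out s)); first by [].
      go (Config q.+4.+4 r7 (inp s) (out s)); first by [].
      go (Config q.+1.+4.+4 r8 (inp s) (out s)); first by [].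
      apply: reach_step; last exact: reach0.
      by rewrite /step; cbn [pc reg input output]; rewrite cd8 r8E r8E'.
    + split=> [y|b i]; rewrite !eqE_ /=; first exact: (proj1 s8 y).
      rewrite eqbE; case: (b =P a) => [->|_] /=; last exact: (proj2 s8 b i).
      by rewrite ?updE ?ez /=; case: eqP => // _; exact: (proj2 s8 a i).
  pose r5 := (rset r4 (Tm 2) 1%R).
  exists (k + (k' + 5)), r5; split.
  + by lia.
  + apply: reach_trans run1 (reach_trans run2 _); rewrite -/q.
    go (Config q.+1 r3 (inp s) (out s)); first by [].
    go (Config q.+2 r4 (inp s) (out s)); first by [].
    go (Config q.+3 r4 (inp s) (out s)); first by rewrite r4E ez; case: ifP => //; lia.
    go (Config q.+4 r5 (inp s) (out s)); first by [].
    apply: reach_step; last exact: reach0.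
    by rewrite /step; cbn [pc reg input output]; rewrite cd3.
  + have s5 : sim s r5 by do 3 apply: sim_tmp.
    split=> [y|b i]; first exact: (proj1 s5 y).
    by rewrite /= eqbE; case: (b =P a) => [->|_]; exact: (proj2 s5 _ i).
- move=> _ _ _; rewrite [compile _ _]/=; get_code => _ hs.
  case ei : (inp s) => [|v l]; rewrite /= ?ei //= => _.
  exists 1, (rset r (V x) v); split=> //.
  + rewrite addn1; apply: reach_step; last exact: reach0.
    by rewrite /step; cbn [pc reg input output]; rewrite cd.
  + split=> [y|b i]; rewrite !eqE_ /= ?updE; last exact: (proj2 hs).
    by case: eqP => // _; exact: (proj1 hs).
- move=> _ _ _ /= /code_at_cat [he]; get_code => _ hs _.
  have [k [r1 [k1 run1 s1 e1 _]]] := compile_expP (inp s) (out s) he hs.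
  exists (k + 1), r1; split.
  + by rewrite size_cat /= leq_add // (leq_trans k1) // size_compile_exp.
  + apply: reach_trans run1 _; rewrite size_cat /= !addnS addn0.
    apply: reach_step; last exact: reach0.
    by rewrite /step; cbn [pc reg input output]; rewrite cd e1.
  + by split=> [y|b i]; [apply: (proj1 s1)|apply: (proj2 s1)].
- move=> /= /andP [w1 w2]; rewrite mem_cat negb_or => /andP [z1 z2] bs.
  move=> /code_at_cat [h1 h2] hs hb.
  have hb1 : bad (run c1 s) = false.
    by apply/negbTE/negP => /(run_bad c2); rewrite hb.
  have [k1 [r1 [b1 run1 s1]]] := IH1 _ s r w1 z1 bs h1 hs hb1.
  have bs' : bound (run c1 s) = n by rewrite run_bound.
  have [k2 [r2 [b2 run2 s2]]] := IH2 _ _ r1 w2 z2 bs' h2 s1 hb.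
  exists (k1 + k2), r2; split=> //; first exact: leq_add.
  by rewrite size_cat addnA; apply: reach_trans run1 run2.
- move=> /= /andP [w1 w2]; rewrite mem_cat negb_or => /andP [z1 z2] bs.
  rewrite !size_cat /= !size_cat /=.
  move=> /code_at_cat [he]; get_code => /code_at_cat [h2]; get_code => h1 hs hb.
  have [k [r1 [k1 run1 s1 e1 _]]] := compile_expP (inp s) (out s) he hs.
  rewrite size_compile_exp in k1.
  set q := off + _ in cd run1 h1 h2 cd0 cd1 *.
  rewrite addn1 in h1 h2 cd cd0 cd1 *.
  set q' := q.+1 + _ in cd cd0 cd1 h1 *.
  have Eq : (q' + 2)%N = q'.+2 by rewrite addn2.
  rewrite !Eq in cd cd1 h1 *.
  have -> : (off + (size (compile_exp off 0 e) + (size (compile q.+1 c2) + (size (compile q'.+2 c1)).+2).+1) = q'.+2 + size (compile q'.+2 c1))%N.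
    by rewrite /q' /q; lia.
  case: ifP hb => he0 hb.
    have [k2 [r2 [b2 run2 s2]]] := IH1 _ _ r1 w1 z1 bs h1 s1 hb.
    exists (k + (1 + k2)), r2; split=> //; first by lia.
    apply: reach_trans run1 (reach_trans _ run2).
    apply: reach_step; last exact: reach0.
    by rewrite /step; cbn [pc reg input output]; rewrite cd e1 he0.
  have [k2 [r2 [b2 run2 s2]]] := IH2 _ _ r1 w2 z2 bs h2 s1 hb.
  pose r3 := (rset r2 (Tm 0) 1%R).
  exists (k + (1 + (k2 + 2))), r3; split; first by lia.
    apply: reach_trans run1 (reach_trans _ (reach_trans run2 _)).
      apply: reach_step; last exact: reach0.
      by rewrite /step; cbn [pc reg input output]; rewrite cd e1 he0.
    rewrite -/q'; go (Config q'.+1 r3 (inp (run c2 s)) (out (run c2 s))); first by [].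
    apply: reach_step; last exact: reach0.
    by rewrite /step; cbn [pc reg input output]; rewrite cd1.
  exact: sim_tmp.
move=> /= /and4P [wc x0 xc zc]; rewrite inE negb_or => /andP [_ _] bs.
rewrite size_cat /=; get_code => /code_at_cat [hc]; get_code => _ hs.
rewrite bs.
have -> : (off + (size (compile (off + 3) c) + 4).+3 = off + 3 + size (compile (off + 3) c) + 4)%N by lia.
have e3 : off.+3 = off + 3 by rewrite addn3.
rewrite !e3 in hc cd2 cd3 cd4 cd5 *.
set l := off + 3 in hc cd1 cd2 cd3 cd4 cd5 *.
set q := l + _ in cd1 cd2 cd3 cd4 cd5 *.
set F := fun st => _; set s0 := setv _ _ => hb.
rewrite !(addnS, addn0) in cd1 *.
have F0 m : var (iter m F s0) 0 = var s 0.
  elim: m => [|m IHm] /=; rewrite updE eq_sym (negbTE x0) //.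
  by rewrite run_var.
have Fx m : var (iter m F s0) x = Posz m.
  elim: m => [|m IHm] /=; rewrite updE eqxx //.
  by rewrite run_var // IHm; lia.
(* A negative variable 0 counts as bound 0; the RAM test [n - i > 0] then fails at once as well. *)
have nE : var s 0 = Posz n \/ n = 0 /\ (var s 0 < 0)%R.
  by rewrite -bs /bound; case: (var s 0) => m; [left|right].
have lt_n m t : var t x = Posz m -> var t 0 = var s 0 -> m <= n ->
    (0 < var t 0 - var t x)%R = (m < n).
  by move=> -> ->; case: nE => [-> h|[-> h] h']; apply/idP/idP; lia.
have Fb m : m <= n -> bad (iter m F s0) = false.
  move=> mn; rewrite -(subnK mn) iterD in hb.
  apply/negbTE/negP => h; move/negP: hb; apply.
  apply: (iter_inv (Q := fun t => bad t)) h => t /(run_bad c).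
  by rewrite /F.
pose r1 := (rset (rset r (V x) 0%R) (Tm 0) 1%R).
have s1 : sim s0 r1.
  apply: sim_tmp; split=> [y|b i]; rewrite !eqE_ /= ?updE; last exact: (proj2 hs).
  by case: eqP => // _; exact: (proj1 hs).
have back t r2 m : sim t r2 -> var t x = Posz m -> var t 0 = var s 0 -> m <= n ->
    exists2 r3, reach P (Config q.+2 r2 (inp t) (out t)) 2
         (Config (if m < n then l else q.+4) r3 (inp t) (out t)) & sim t r3.
  move=> st tx t0 mn; pose r3 := (rset r2 (Tm 0) (var t 0 - var t x)%R).
  exists r3; last exact: sim_tmp.
  go (Config q.+3 r3 (inp t) (out t)).
    by rewrite (proj1 st) (proj1 st).
  apply: reach_step; last exact: reach0.
  by rewrite /step; cbn [pc reg input output]; rewrite cd5 /= (lt_n m).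
have [r2 run2 s2] := back s0 r1 0 s1 (Fx 0) (F0 0) isT.
(* The run is observed right after each test: at the loop head while rounds remain, behind the loop
   at the end. *)
suff body m : m <= n -> exists k r', [/\ k <= 5 + m * (cst c n).+4,
    reach P (Config off r (inp s) (out s)) k
      (Config (if m < n then l else q.+4) r' (inp (iter m F s0)) (out (iter m F s0)))
    & sim (iter m F s0) r'].
  by have := body n (leqnn n); rewrite ltnn.
elim: m => [|m IHm] mn.
  exists 5, r2; split=> //.
  go (Config off.+1 (rset r (V x) 0%R) (inp s) (out s)); first by [].
  go (Config off.+2 r1 (inp s) (out s)); first by [].
  apply: reach_step; first by rewrite /step; cbn [pc reg input output]; rewrite cd1 /r1 rsetE eqxx.
  exact: run2.
have [k [r3 [k3 run3 s3]]] := IHm (ltnW mn).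
have bm : bound (iter m F s0) = n by rewrite /bound F0 -bs.
have := Fb m.+1 mn; rewrite [bad _]/= => hbm.
have [k4 [r4 [b4 run4 s4]]] := IH _ _ r3 wc zc bm hc s3 hbm.
pose r5 := (rset r4 (Tm 0) 1%R).
pose r6 := (rset r5 (V x) (Posz m.+1)).
have s6 : sim (iter m.+1 F s0) r6.
  split=> [y|b i]; rewrite /r6 !eqE_ /r5 !eqE_ /=; last exact: (proj2 s4 b i).
  rewrite updE run_var // Fx; case: eqP => _; first by lia.
  exact: (proj1 s4 y).
have [r7 run7 s7] := back _ r6 m.+1 s6 (Fx _) (F0 _) mn.
exists (k + (k4 + (2 + 2))), r7; split=> //; first by lia.
rewrite mn in run3.
apply: reach_trans run3 (reach_trans run4 (reach_trans _ run7)).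
rewrite -/q; go (Config q.+1 r5 (inp (run c (iter m F s0))) (out (run c (iter m F s0)))); first by [].
apply: reach_step; last exact: reach0.
have r5E : (r5 (V x) + r5 (Tm 0))%R = Posz m.+1.
  by rewrite /r5 !eqE_ /= (proj1 s4) run_var // Fx; lia.
by rewrite /step; cbn [pc reg input output]; rewrite cd3 /set_reg; cbn [pc reg input output]; rewrite r5E.
Qed.

(** * Running time read off the nesting of loops *)

Lemma cst_loops0 c : loops c = 0 -> exists K, forall n, cst c n <= K.
Proof.
elim: c => [x e|a e e'|x|e|c1 IH1 c2 IH2|e c1 IH1 c2 IH2|x c IH] //=.
- by exists (cst (Asn x e) 0).
- by exists (cst (Put a e e') 0).
- by exists (cst (Rd x) 0).
- by exists (cst (Pr e) 0).
- move/eqP; rewrite -leqn0 geq_max !leqn0 => /andP [/eqP /IH1 [K1 h1] /eqP /IH2 [K2 h2]].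
  by exists (K1 + K2) => n; rewrite leq_add.
- move/eqP; rewrite -leqn0 geq_max !leqn0 => /andP [/eqP /IH1 [K1 h1] /eqP /IH2 [K2 h2]].
  by exists (size (compile_exp 0 0 e) + 3 + K1 + K2) => n; rewrite -!addnA !leq_add.
Qed.

(** A loop around a body of constant cost is affine in [n]; positivity of [n] absorbs the constant
    term. *)
Lemma cst_loops1 c : loops c <= 1 -> exists K, forall n, 0 < n -> cst c n <= K * n.
Proof.
elim: c => [x e|a e e'|x|e|c1 IH1 c2 IH2|e c1 IH1 c2 IH2|x c IH] /=.
- by exists (cst (Asn x e) 0) => n; apply: leq_pmulr.
- by exists (cst (Put a e e') 0) => n; apply: leq_pmulr.
- by exists (cst (Rd x) 0) => n; apply: leq_pmulr.
- by exists (cst (Pr e) 0) => n; apply: leq_pmulr.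
- rewrite geq_max => /andP [/IH1 [K1 h1] /IH2 [K2 h2]].
  by exists (K1 + K2) => n n0; rewrite mulnDl leq_add ?h1 ?h2.
- rewrite geq_max => /andP [/IH1 [K1 h1] /IH2 [K2 h2]].
  exists (size (compile_exp 0 0 e) + 3 + K1 + K2) => n n0.
  by rewrite (mulnDl (_ + _)) (mulnDl (_ + _)) !leq_add ?h1 ?h2 // leq_pmulr.
rewrite ltnS leqn0 => /eqP /cst_loops0 [K h].
by exists (5 + (K + 4)) => n n0; have := h n; nia.
Qed.

Lemma run_no_put c s : puts c = [::] -> arr (run c s) = arr s.
Proof.
elim: c s => [y e|a' e e'|y|e|c1 IH1 c2 IH2|e c1 IH1 c2 IH2|i c IH] s //=.
- by case: (inp s).
- by case E : (puts c1) => //= h2; rewrite IH2 ?IH1.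
- by case E : (puts c1) => //= h2; case: ifP => _; rewrite ?IH1 ?IH2.
move=> h; apply: (iter_inv (Q := fun t => arr t = arr s)) => [t|] //=.
by rewrite IH.
Qed.

Lemma for_ind i c s n (Inv : nat -> state -> Prop) :
  wf (For i c) -> var s 0 = Posz n ->
  Inv 0 (setv s (upd (var s) i 0%R)) ->
  (forall k st, k < n -> var st i = Posz k -> var st 0 = Posz n ->
     (forall x, x \notin writes (For i c) -> var st x = var s x) ->
     Inv k st ->
     Inv k.+1 (setv (run c st) (upd (var (run c st)) i (Posz k.+1)))) ->
  Inv n (run (For i c) s).
Proof.
move=> /= /and4P [wc i0 ic zc] sn Inv0 InvS.
rewrite /bound sn; set F := fun st => _; set s0 := setv _ _ in Inv0 *.
have Fx m : var (iter m F s0) i = Posz m.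
  elim: m => [|m IHm] /=; rewrite updE eqxx //.
  by rewrite run_var // IHm; lia.
have Fw m x : x \notin i :: writes c -> var (iter m F s0) x = var s x.
  rewrite inE negb_or => /andP [/negbTE xi xc].
  by elim: m => [|m IHm] /=; rewrite updE xi // run_var.
suff H m : m <= n -> Inv m (iter m F s0) by exact: H.
elim: m => //= m IHm mn.
have -> : F (iter m F s0) = setv (run c (iter m F s0))
    (upd (var (run c (iter m F s0))) i (Posz m.+1)).
  by rewrite /F run_var // Fx; congr (setv _ (upd _ _ _)); lia.
apply: InvS => //.
- by rewrite Fw ?sn // inE negb_or eq_sym i0.
- by move=> x; apply: Fw.
- exact: IHm (ltnW mn).
Qed.

Lemma run_asn x e s : run (Asn x e) s = setv s (upd (var s) x (eval s e)).
Proof. by []. Qed.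
Lemma run_put a e e' s : run (Put a e e') s =
  State (var s)
    (fun a' => if eqb a' a then puti (arr s a) (eval s e) (eval s e')
               else arr s a')
    (inp s) (out s) (bad s).
Proof. by []. Qed.
Lemma run_pr e s : run (Pr e) s =
  State (var s) (arr s) (inp s) (rcons (out s) (eval s e)) (bad s).
Proof. by []. Qed.
Lemma run_rd x s v r : inp s = v :: r ->
  run (Rd x) s = State (upd (var s) x v) (arr s) r (out s) (bad s).
Proof. by rewrite /= => ->. Qed.
Lemma run_seq c1 c2 s : run (Seq c1 c2) s = run c2 (run c1 s).
Proof. by []. Qed.
Lemma run_if e c1 c2 s :
  run (If e c1 c2) s = if (0 < eval s e)%R then run c1 s else run c2 s.
Proof. by []. Qed.
Definition runE := (run_asn, run_put, run_pr, run_seq, run_if).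

Arguments run : simpl never.

(** * The tree of words *)

Section Enum.

Variable Sb : pred (seq bool).

(** Follows the traversal below [nseq j false ++ w]: the child with its new 1 next to [w], the
    subtree of this child, the remaining children. Shifting leads from every other word searched for
    here to this first child, so its failure ends the search. *)
Fixpoint enum_tree (j : nat) (w : seq bool) : seq (seq bool) :=
  if j is j'.+1 then
    if Sb (nseq j' false ++ true :: w) then
      (nseq j' false ++ true :: w) ::
      enum_tree j' (true :: w) ++ enum_tree j' (false :: w)
    else [::]
  else [::].

Lemma enum_tree_sound j w s :
  s \in enum_tree j w -> Sb s /\ exists u : seq bool, [/\ size u = j, true \in u & s = u ++ w].
Proof.
elim: j w => [|j IH] w //=; case: ifP => // hS.
rewrite inE mem_cat; case/or3P => [/eqP ->|/IH [h [u [su tu E]]]|/IH [h [u [su tu E]]]].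
- split=> //; exists (rcons (nseq j false) true).
  by rewrite size_rcons size_nseq mem_rcons inE eqxx cat_rcons.
- by rewrite E in h *; split=> //; exists (rcons u true); rewrite size_rcons su mem_rcons inE tu orbT cat_rcons.
- by rewrite E in h *; split=> //; exists (rcons u false); rewrite size_rcons su mem_rcons inE tu orbT cat_rcons.
Qed.

Lemma enum_tree_uniq j w : uniq (enum_tree j w).
Proof.
elim: j w => [|j IH] w //=; case: ifP => // hS.
rewrite /= cat_uniq !IH /= andbT mem_cat negb_or -andbA; apply/and3P; split.
- apply/negP => /enum_tree_sound [_ [u [su tu /eqP]]].
  rewrite eqseq_cat ?size_nseq // => /andP [/eqP E _].
  by move: tu; rewrite -E mem_nseq andbF.
- apply/negP => /enum_tree_sound [_ [u [su tu /eqP]]].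
  by rewrite eqseq_cat ?size_nseq // => /andP [_ /eqP].
- apply/hasP => -[s /enum_tree_sound [_ [u [su _ ->]]]].
  move=> /enum_tree_sound [_ [u' [su' _ /eqP]]].
  by rewrite eqseq_cat ?su ?su' // => /andP [_ /eqP].
Qed.

Variable n : nat.
Hypothesis Sb_shift : forall a b v, a + (size v).+2 = n ->
  Sb (nseq a false ++ true :: b :: v) -> Sb (nseq a false ++ false :: true :: v).

Lemma nseq_shift a (v : seq bool) : nseq a false ++ false :: v = nseq a.+1 false ++ v.
Proof. by elim: a => //= a ->. Qed.

(** Each shift moves the leading 1 over a 0 or merges it with the next 1, so it can be swept across
    all of [u]. *)
Lemma Sb_leftmost (u w : seq bool) a : a + (size u + size w).+1 = n ->
  Sb (nseq a false ++ true :: u ++ w) -> Sb (nseq (a + size u) false ++ true :: w).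
Proof.
elim: u a => [|b u IH] a /= sz; first by rewrite addn0.
move=> /Sb_shift; rewrite nseq_shift -[a + (size u).+1]addSnnS => h.
by apply: IH; [lia | apply: h; rewrite size_cat; lia].
Qed.

Lemma split_first_true (u : seq bool) : true \in u ->
  exists a (v : seq bool), u = nseq a false ++ true :: v.
Proof.
elim: u => // -[] u IHu; rewrite inE /= => tu; first by exists 0, u.
by have [a [v ->]] := IHu tu; exists a.+1, v.
Qed.

(** By [Sb_leftmost] a member [u ++ w] makes the test at the node succeed; the last letter of [u]
    then selects the branch. *)
Lemma enum_tree_complete j (w u : seq bool) : size u = j -> true \in u -> j + size w = n ->
  Sb (u ++ w) -> u ++ w \in enum_tree j w.
Proof.
elim: j w u => [|j IH] w u; first by move/size0nil ->.
move=> su tu sz hS.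
have [a [v uE]] := split_first_true tu.
have sv : a + size v = j by move: su; rewrite uE size_cat size_nseq /=; lia.
have hT : Sb (nseq j false ++ true :: w).
  rewrite -sv; apply: Sb_leftmost; first by lia.
  by rewrite uE -catA in hS.
rewrite /= hT inE mem_cat.
case/lastP: u su tu hS {uE} => // u b; rewrite size_rcons => -[su].
have sz' b' : j + size (b' :: w) = n by rewrite /=; lia.
rewrite mem_rcons inE cat_rcons; case: b => /= tu hS; last first.
  by rewrite (IH (false :: w) u) ?orbT.
case tu' : (true \in u); first by rewrite (IH (true :: w) u) ?orbT.
suff -> : u = nseq j false by rewrite eqxx.
by rewrite -su; apply/all_pred1P/allP => -[] // xu; rewrite xu in tu'.
Qed.

End Enum.

(** * The driver *)

Definition skip : cmd := Asn 5 (EV 5).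
Definition rev_idx (i : nat) : exp := ES (ES (EV 0) (EV i)) (EC 1%R).
Definition bit (rv : bool) (i : nat) : exp :=
  EG false (if rv then rev_idx i else EV i).

(** The array holds the image of a word under this involution, which is undone while printing. *)
Definition word_map (rv cp : bool) (w : seq bool) : seq bool :=
  let w' := if rv then rev w else w in if cp then compl w' else w'.

Definition print_word (rv cp : bool) : cmd :=
  For 6 (Pr (if cp then ES (EC 1%R) (bit rv 6) else bit rv 6)).

(** Loops only count upwards, so the scan goes from right to left and overwrites its result; [n]
    remains if there is no 1. *)
Definition find_first : cmd :=
  Seq (Asn 5 (EV 0)) (For 6 (If (bit true 6) (Asn 5 (rev_idx 6)) skip)).

(* Variables: 0 is [n], 1 and 2 are parameters, 3 is the mode (2: try to add a
   child, 1: undo the leftmost 1, 0: stop), 4 is the position to try, 7 is the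
   result of the membership test, from 7 on they are free for use by the test.
   Array [false] is the word.  The children of a word are tried from right to
   left, or from left to right if [up]. *)
Definition attempt (up rv cp : bool) (tst : cmd) : cmd :=
  Seq (Put false (EV 4) (EC 1%R))
  (Seq tst
  (If (EV 7)
    (Seq (print_word rv cp) (Asn 4 (if up then EC 0%R else EV 4)))
    (Seq (Put false (EV 4) (EC 0%R)) (Asn 3 (EC 1%R))))).

Definition undo (up : bool) : cmd :=
  Seq find_first
  (If (ES (EV 0) (EV 5))
     (Seq (Put false (EV 5) (EC 0%R))
     (Seq (Asn 4 (if up then EA (EV 5) (EC 1%R) else EV 5)) (Asn 3 (EC 2%R))))
     (Asn 3 (EC 0%R))).

(** Mode 2 is recognized by [EV 3 - 1 > 0]. The candidates end at position 0, or for [up] at the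
    leftmost 1 of the word, and at [n] if there is none. *)
Definition body (up rv cp : bool) (tst : cmd) : cmd :=
  If (ES (EV 3) (EC 1%R))
    (if up then
       If (ES (EC 1%R) (EG false (EV 4)))
         (If (ES (EV 0) (EV 4)) (attempt up rv cp tst) (Asn 3 (EC 1%R)))
         (Asn 3 (EC 1%R))
     else
       If (EV 4) (Seq (Asn 4 (ES (EV 4) (EC 1%R))) (attempt up rv cp tst))
         (Asn 3 (EC 1%R)))
    (undo up).

(** The all-zero word has no parent and is tested here. For [up] the only candidate below it is
    position [n - 1], because a nonzero member has a 1 there (last clause of [left_closed]). *)
Definition init (up rv cp : bool) (ini tst : cmd) : cmd :=
  Seq ini (Seq tst
    (Seq (If (EV 7) (print_word rv cp) skip)
    (Seq (Asn 3 (EC 2%R))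
      (Asn 4 (if up then ES (EV 0) (EC 1%R) else EV 0))))).

Definition test_ok (tst : cmd) : bool :=
  [&& wf tst, loops tst <= 1, all (leq 7) (writes tst), puts tst == [::],
      ~~ reads tst & ~~ prints tst].

Definition init_ok (ini : cmd) : bool :=
  [&& wf ini, loops ini <= 1,
      all [pred x | (x == 1) || (x == 2) || (7 <= x)] (writes ini),
      false \notin puts ini & ~~ prints ini].

(** Cells beyond the word are 0 too, in accordance with the default of [nth]. *)
Definition holds_word (f : nat -> int) (w : seq bool) : Prop :=
  forall i, f i = Posz (nth false w i).

Lemma rev_idxE n k : k < n -> (Posz n - Posz k - 1)%R = Posz (n - k.+1).
Proof. by lia. Qed.

Lemma bitE rv st w i k : holds_word (arr st false) w -> var st 0 = Posz (size w) ->
  var st i = Posz k -> k < size w ->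
  eval st (bit rv i) = Posz (nth false (if rv then rev w else w) k).
Proof.
move=> hw h0 hi kn; case: rv; rewrite /= hi ?h0 ?rev_idxE //= hw //.
by rewrite nth_rev.
Qed.

Lemma size_word_map rv cp w : size (word_map rv cp w) = size w.
Proof. by rewrite /word_map; case: rv; case: cp; rewrite ?size_map ?size_rev. Qed.

Lemma complK : involutive compl.
Proof. by move=> w; apply: mapK; apply: negbK. Qed.

Lemma word_mapK rv cp : involutive (word_map rv cp).
Proof.
move=> w; rewrite /word_map.
by case: rv; case: cp; rewrite ?complK ?revK // {1}/compl -map_rev revK -/(compl _) complK.
Qed.

Lemma print_wordP rv cp st w :
  holds_word (arr st false) w -> var st 0 = Posz (size w) ->
  out (run (print_word rv cp) st) = out st ++ bits (word_map rv cp w).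
Proof.
move=> hw h0; set u := word_map rv cp w.
have su : size u = size w by rewrite size_word_map.
pose Inv k st' := arr st' = arr st /\ out st' = out st ++ bits (take k u).
have [] : Inv (size w) (run (print_word rv cp) st); last first.
  by rewrite take_oversize ?su.
apply: for_ind => //; first by split=> //; rewrite take0 cats0.
move=> k st' kn hi h0' _ [ha ho]; split=> //.
rewrite /bits (take_nth false) ?su // map_rcons -rcons_cat -/(bits _) -ho.
congr rcons.
have hb := bitE rv (st := st') (w := w); rewrite ha in hb.
have {}hb := hb _ _ hw h0' hi kn.
rewrite /u /word_map; case: (cp); last by rewrite hb.
rewrite [eval _ _]/= in hb *; rewrite [LHS]/= hb.
rewrite /compl (nth_map false); first by case: nth.
by case: (rv); rewrite ?size_rev.
Qed.

Lemma find_firstP st w :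
  holds_word (arr st false) w -> var st 0 = Posz (size w) ->
  var (run find_first st) 5 = Posz (index true w).
Proof.
move=> hw h0; rewrite /find_first run_seq.
set s0 := run (Asn _ _) _; set c := If _ _ _.
pose Inv k st' := arr st' = arr st /\
  var st' 5 = Posz (size w - k + index true (drop (size w - k) w)).
have [] : Inv (size w) (run (For 6 c) s0); last first.
  by move=> _; rewrite subnn drop0 add0n.
apply: for_ind => //.
  by split=> //=; rewrite subn0 drop_size addn0 h0.
move=> k st' kn hi h0' _ [ha ho]; split; first by rewrite /c !runE; case: ifP.
have hb := bitE true (st := st') (w := w); rewrite ha in hb.
have {}hb := hb _ _ hw h0' hi kn.
have e : size w - k = (size w - k.+1).+1 by lia.
rewrite /c !runE hb nth_rev // (drop_nth false (n := size w - k.+1)); last by lia.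
rewrite -e; case: nth => /=; rewrite !updE /=.
  by rewrite hi h0' rev_idxE // addn0.
by rewrite ho e; lia.
Qed.

Lemma holds_put f j b b' (v : seq bool) : holds_word f (nseq j false ++ b :: v) ->
  holds_word (upd f j (Posz (nat_of_bool b'))) (nseq j false ++ b' :: v).
Proof.
move=> h i; rewrite updE; case: (i =P j) => [->|ij].
  by rewrite nth_cat size_nseq ltnn subnn.
rewrite h !nth_cat size_nseq; case: ltnP => // ji.
by have -> : i - j = (i - j).-1.+1 by lia.
Qed.

Lemma index_nseq j (v : seq bool) : index true (nseq j false ++ true :: v) = j.
Proof. by elim: j => //= j ->. Qed.

Section Run.

Variables (rv cp : bool) (tst : cmd) (n : nat) (Sb : pred (seq bool)).
Variable Pm : int -> int -> (nat -> int) -> Prop.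
Hypothesis tst_ok : test_ok tst.

(** The second case is the root, which is visited even if it is not a member. *)
Definition parent_ok (w : seq bool) : Prop := Sb w \/ w = nseq n false.

(** [Pm] tells how the parameters are stored in variables 1 and 2 and in the array [true]. The last
    premise lets a test rely on its parent, as the one for prefix normal words does. *)
Definition test_spec : Prop :=
  forall st w, size w = n -> var st 0 = Posz n ->
  Pm (var st 1) (var st 2) (arr st true) -> holds_word (arr st false) w ->
  (forall j v, w = nseq j false ++ true :: v ->
     parent_ok (nseq j false ++ false :: v)) ->
  (0 < var (run tst st) 7)%R = Sb w.

Hypothesis tstP : test_spec.

Record driver_state (w : seq bool) (m : nat) (o : seq int) (st : state) : Prop := {
  ds_size : size w = n;
  ds_n : var st 0 = Posz n;
  ds_par : Pm (var st 1) (var st 2) (arr st true);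
  ds_word : holds_word (arr st false) w;
  ds_mode : var st 3 = Posz m;
  ds_out : out st = o;
  ds_bad : bad st = false
}.

Lemma run_tst_frame st : [/\ arr (run tst st) = arr st, inp (run tst st) = inp st,
  out (run tst st) = out st, bad (run tst st) = bad st &
  forall x, x < 7 -> var (run tst st) x = var st x].
Proof.
have [_ _ /allP hw /eqP hp /andP [hr hpr]] := and5P tst_ok.
have [h1 h2] := run_inp st hr.
split=> //; first by rewrite run_no_put.
  by rewrite run_out.
by move=> x x7; rewrite run_var //; apply/negP => /hw /=; lia.
Qed.

Lemma attemptP up st o j w : driver_state (nseq j false ++ false :: w) 2 o st ->
  var st 4 = Posz j -> parent_ok (nseq j false ++ false :: w) ->
  let w' := nseq j false ++ true :: w in
  let st' := run (attempt up rv cp tst) st in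
  if Sb w' then driver_state w' 2 (o ++ bits (word_map rv cp w')) st' /\
    var st' 4 = Posz (if up then 0 else j)
  else driver_state (nseq j false ++ false :: w) 1 o st'.
Proof.
move=> [sz hn hp hw hm ho hb] h4 hpar w' st'.
pose s2 := State (var st)
  (fun a => if eqb a false then upd (arr st false) j 1%R else arr st a)
  (inp st) (out st) (bad st).
have E1 : st' = let s3 := run tst s2 in
    if (0 < var s3 7)%R then
      let s4 := run (print_word rv cp) s3 in
      setv s4 (upd (var s4) 4 (if up then 0%R else var s4 4)) else
    State (upd (var s3) 3 1%R)
      (fun a => if eqb a false then puti (arr s3 false) (var s3 4) 0%R else arr s3 a)
      (inp s3) (out s3) (bad s3).
  rewrite /st' /attempt !run_seq run_put [eval st (EV 4)]/= h4 [puti _ _ _]/=.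
  by rewrite -/s2 !runE /=; case: (up); reflexivity.
have := run_tst_frame s2; rewrite /= => -[ha hi hou hba hv].
have szw : size w' = n by rewrite -sz !size_cat !size_nseq.
have hw2 : holds_word (arr s2 false) w'.
  exact: (holds_put (b := false) true hw).
have hT : (0 < var (run tst s2) 7)%R = Sb w'.
  apply: tstP => // i v E.
  have [-> ->] : i = j /\ v = w.
    have ij : i = j by rewrite -(index_nseq i v) -E index_nseq.
    split=> //; move/eqP: E; rewrite ij /w' eqseq_cat // => /andP [_ /eqP []] //.
  exact: hpar.
rewrite E1 [X in if _ then X else _]/= [X in if _ then _ else X]/= hT.
case hS : (Sb w'); last first.
  split=> //=; rewrite ?updE ?ha ?hv //= ?h4 //.
  - exact: (holds_put (b := true) false hw2).
  - by rewrite hou.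
  - by rewrite hba.
set s3 := run tst s2 in hT ha hi hou hba hv E1 *.
have hpr : ~~ reads (print_word rv cp) by [].
have [h5 h6] := run_inp s3 hpr.
have pa : arr (run (print_word rv cp) s3) = arr s3 by apply: run_no_put.
have pv x : x != 6 -> var (run (print_word rv cp) s3) x = var s3 x.
  by move=> x6; apply: run_var; rewrite inE.
have po : out (run (print_word rv cp) s3) = o ++ bits (word_map rv cp w').
  rewrite (@print_wordP _ _ _ w') ?ha ?hv //; last by rewrite szw.
  by rewrite hou /= ho.
split; last by rewrite /= updE /= pv // hv // h4; case: (up).
split=> //=; rewrite ?updE ?pa ?pv ?ha ?hv //.
by rewrite h6 hba.
Qed.

Lemma find_first_frame st (s' := run find_first st) :
  [/\ arr s' = arr st, inp s' = inp st, out s' = out st, bad s' = bad st &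
  forall x, x \notin [:: 5; 6] -> var s' x = var st x].
Proof.
have [|h1 h2] := @run_inp find_first st; first by [].
split=> //; rewrite /s'; first by rewrite run_no_put.
  by rewrite run_out.
by move=> x; rewrite !inE => h; rewrite run_var //= !inE; move: h; case: eqP; case: eqP.
Qed.

Lemma body_undo up st o j v : driver_state (nseq j false ++ true :: v) 1 o st ->
  let st' := run (body up rv cp tst) st in
  driver_state (nseq j false ++ false :: v) 2 o st' /\
  var st' 4 = Posz (if up then j.+1 else j).
Proof.
move=> [sz hn hp hw hm ho hb].
have [ha hi hou hba hv] := find_first_frame st.
have h5 : var (run find_first st) 5 = Posz j.
  by rewrite (find_firstP hw) ?sz ?index_nseq.
have jn : j < n by rewrite -sz size_cat size_nseq /=; lia.
rewrite /body run_if /= hm /= /undo run_seq run_if [eval _ _]/= h5 hv // hn.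
have -> : (0 < Posz n - Posz j)%R by lia.
move: (run find_first st) h5 ha hi hou hba hv => s1 h5 ha hi hou hba hv.
rewrite !runE /= !updE /= h5 /=; split; last first.
  by case: up; rewrite /= h5 //; lia.
split=> //=; rewrite ?updE ?hv ?ha //=.
- by rewrite -sz !size_cat.
- exact: (holds_put (b := true) false hw).
- by rewrite hou.
- by rewrite hba.
Qed.

Lemma body_halt up st o : driver_state (nseq n false) 1 o st ->
  let st' := run (body up rv cp tst) st in
  [/\ var st' 3 = 0%R, out st' = o & bad st' = false].
Proof.
move=> [sz hn hp hw hm ho hb].
have [ha hi hou hba hv] := find_first_frame st.
have h5 : var (run find_first st) 5 = Posz n.
  by rewrite (find_firstP hw) ?size_nseq // memNindex ?size_nseq // mem_nseq andbF.
rewrite /body run_if /= hm /= /undo run_seq run_if /= h5 hv // hn.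
rewrite subrr ltxx.
move: (run find_first st) h5 ha hi hou hba hv => s1 h5 ha hi hou hba hv.
rewrite !runE /=.
by split; rewrite ?hou ?hba.
Qed.

Definition active (up : bool) (st : state) (k : nat) : Prop :=
  forall i, i < k -> (0 < var (iter i (run (body up rv cp tst)) st) 3)%R.

Lemma active_trans up st k k' : active up st k ->
  active up (iter k (run (body up rv cp tst)) st) k' -> active up st (k + k').
Proof.
move=> h h' i ik; case: (ltnP i k) => [/h //|ki].
by have := h' (i - k); rewrite -iterD subnK //; apply; rewrite ltn_subLR.
Qed.

Lemma active1 up st m : var st 3 = Posz m.+1 -> active up st 1.
Proof. by move=> h [] // _; rewrite /= h. Qed.

(* A full visit below a word, started in mode 2 with [var 4 = j]. *)
Definition visit (up : bool) (w : seq bool) (j : nat) (E : seq (seq bool)) : Prop :=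
  forall o st, driver_state w 2 o st -> var st 4 = Posz j -> parent_ok w ->
  exists2 k, k <= 3 * size E + 1 & active up st k /\
    driver_state w 1 (o ++ bits (flatten (map (word_map rv cp) E)))
      (iter k (run (body up rv cp tst)) st).

Lemma visit_none up w j :
  (forall o st, driver_state w 2 o st -> var st 4 = Posz j -> parent_ok w ->
     driver_state w 1 o (run (body up rv cp tst) st)) ->
  visit up w j [::].
Proof.
move=> h o st hD h4 hpar; exists 1 => //; split; first exact: active1 (ds_mode hD).
by rewrite /= cats0; apply: h.
Qed.

(** Origin of the 3 in [visit]: a listed word costs one round to add it, one in which the search
    among its children ends, and one to undo it. The remaining 1 is the end of the search at the
    word visited. *)
Lemma visit_node up j v i E1 E2 (w' := nseq j false ++ true :: v) :
  (forall o st, driver_state (nseq j false ++ false :: v) 2 o st ->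
     var st 4 = Posz i -> parent_ok (nseq j false ++ false :: v) ->
     driver_state w' 2 (o ++ bits (word_map rv cp w')) (run (body up rv cp tst) st) /\
     var (run (body up rv cp tst) st) 4 = Posz (if up then 0 else j)) ->
  Sb w' -> visit up w' (if up then 0 else j) E1 ->
  visit up (nseq j false ++ false :: v) (if up then j.+1 else j) E2 ->
  visit up (nseq j false ++ false :: v) i (w' :: E1 ++ E2).
Proof.
move=> htry hS v1 v2 o st hD h4 hpar.
have a0 := active1 up (ds_mode hD).
have [hD1 h41] := htry _ _ hD h4 hpar.
have [k1 k1le [a1 hD2]] := v1 _ _ hD1 h41 (or_introl hS).
have a2 := active1 up (ds_mode hD2).
have [hD3 h43] := body_undo up hD2.
have [k2 k2le [a3 hD4]] := v2 _ _ hD3 h43 hpar.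
exists (1 + (k1 + (1 + k2))); first by rewrite /= size_cat; lia.
split.
  apply: active_trans a0 _; apply: active_trans a1 _; exact: active_trans a2 _.
rewrite addnC iterD (addnC k1) iterD (addnC 1 k2) iterD.
move: hD4; congr driver_state.
by rewrite /= map_cat flatten_cat /bits !map_cat -!catA.
Qed.

Lemma visit_tree j w : visit false (nseq j false ++ w) j (enum_tree Sb j w).
Proof.
elim: j w => [|j IH] w.
  by apply: visit_none => o st [? ? ? ? hm ? ?] h4 _; rewrite /body !runE /= hm h4.
have bodyE st o : driver_state (nseq j.+1 false ++ w) 2 o st ->
    var st 4 = Posz j.+1 -> parent_ok (nseq j.+1 false ++ w) ->
  let w' := nseq j false ++ true :: w in
  let st' := run (body false rv cp tst) st in
  if Sb w' then driver_state w' 2 (o ++ bits (word_map rv cp w')) st' /\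
    var st' 4 = Posz j
  else driver_state (nseq j false ++ false :: w) 1 o st'.
  move=> [? ? ? hw hm ? ?] h4 hp; rewrite /body run_if [eval _ _]/= hm run_if /= h4 run_seq.
  apply: (@attemptP false); [|by rewrite run_asn /= updE /= h4; lia|by rewrite nseq_shift].
  by rewrite nseq_shift run_asn; split.
rewrite /= -[false :: _ ++ _]/(nseq j.+1 false ++ w).
case: ifP => hS; last first.
  by apply: visit_none => o st hD h4 hp; have := bodyE st o hD h4 hp; rewrite /= hS nseq_shift.
rewrite -nseq_shift; apply: visit_node => // o st hD h4 hp.
by rewrite nseq_shift in hD hp; have := bodyE st o hD h4 hp; rewrite /= hS.
Qed.

(* For [up], a word is visited if its last 1 in the first [K] positions is at
   [j] or later. *)
Definition left_closed : Prop :=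
  (forall a (y : seq bool), a + (size y).+1 = n -> Sb (nseq a false ++ true :: y) ->
     Sb (nseq a false ++ false :: y)) /\
  (forall a y, a + (size y).+2 = n -> 0 < size y ->
     Sb (nseq a false ++ false :: true :: y) ->
     Sb (nseq a false ++ true :: false :: y)) /\
  (forall s : seq bool, size s = n -> Sb s -> true \in s -> true \in drop n.-1 s).

Hypothesis closed : left_closed.

Lemma Sb_flips a p y : a + (size p + size y) = n -> Sb (nseq a false ++ p ++ y) ->
  Sb (nseq (a + size p) false ++ y).
Proof.
elim: p a => [|b p IH] a /= sz; first by rewrite addn0.
move=> h; rewrite -addSnnS; apply: IH; first by lia.
rewrite -nseq_shift; case: b h => // h; apply: (proj1 closed) h.
by rewrite size_cat; lia.
Qed.

Lemma Sb_left j d r v : j + d + (r + size v).+1 = n -> 0 < size v ->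
  Sb (nseq (j + d) false ++ true :: nseq r false ++ v) ->
  Sb (nseq j false ++ true :: nseq (d + r) false ++ v).
Proof.
have [_ [left _]] := closed.
elim: d r => [|d IH] r sz v0; first by rewrite addn0.
rewrite addnS -nseq_shift => /left h.
rewrite addSnnS; apply: IH => //; first by lia.
by apply: h; rewrite size_cat size_nseq; lia.
Qed.

Lemma split_last_true (u : seq bool) : true \in u ->
  exists (p : seq bool) r, u = p ++ true :: nseq r false.
Proof.
elim/last_ind: u => // u b IH; rewrite mem_rcons inE; case: b => /=.
  by move=> _; exists u, 0; rewrite cats1.
move=> /IH [p [r ->]]; exists p, r.+1.
by rewrite rcons_cat rcons_cons -cats1 -[[:: false]]/(nseq 1 false) -nseqD addn1.
Qed.

(** All 1s of [u] but the last are deleted, then this last one is moved left to [j]. Moving requires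
    a letter behind it, hence the condition on [v] and [m]. *)
Lemma Sb_last j m (u v : seq bool) : size u = j + m.+1 -> j + m.+1 + size v = n ->
  0 < size v \/ m = 0 ->
  true \in drop j u -> Sb (u ++ v) -> Sb (nseq j false ++ true :: nseq m false ++ v).
Proof.
move=> su sz hvm /split_last_true [p [r E]].
have := congr1 size E; rewrite size_drop size_cat /= size_nseq su => spr.
rewrite -(cat_take_drop j u) E => h.
have sj : size (take j u) = j by rewrite size_takel // su leq_addr.
have em : m = size p + r by lia.
suff : Sb (nseq (j + size p) false ++ true :: nseq r false ++ v).
  case: hvm => [v0|m0]; first by rewrite em; apply: Sb_left => //; lia.
  have [-> ->] : size p = 0 /\ r = 0 by lia.
  by rewrite addn0 m0.
have {h} : Sb (nseq 0 false ++ (take j u ++ p) ++ true :: nseq r false ++ v).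
  by move: h; rewrite -!catA.
by move/Sb_flips; rewrite add0n size_cat sj; apply; rewrite /= size_cat size_nseq; lia.
Qed.

(** The outer induction descends to the subtree of a child, whose zeros in front number [j < K]; the
    inner one passes to the next child. At the root [v] is empty and only the last position is
    tried; elsewhere [v] begins with the leftmost 1. *)
Lemma visit_up K m j v : j + m = K -> K + size v = n ->
  (v = [::] /\ m <= 1 \/ exists v', v = true :: v') ->
  exists E, [/\ visit true (nseq K false ++ v) j E, uniq E &
    forall s, s \in E <-> Sb s /\ exists u : seq bool,
      [/\ size u = K, true \in drop j u & s = u ++ v]].
Proof.
elim/ltn_ind: K m j v => K IHK; elim=> [|m IHm] j v.
  rewrite addn0 => jK sz hv; exists [::]; split=> //; last first.
    by move=> s; split=> // -[_ [u [su]]]; rewrite drop_oversize // su jK.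
  apply: visit_none => o st hD h4 _; have [? hn ? hw hm ? ?] := hD.
  have fail : driver_state (nseq K false ++ v) 1 o (run (Asn 3 (EC 1%R)) st) by split.
  rewrite /body run_if [eval _ _]/= hm run_if [eval _ _]/= h4 /= hw.
  rewrite jK nth_cat size_nseq ltnn subnn run_if [eval _ _]/= hn h4.
  case: hv fail sz => [[-> _]|[v' ->]] fail sz; last by [].
  by rewrite jK -sz /= addn0 subrr ltxx.
move=> jK sz hv; pose x := nseq j false ++ true :: nseq m false ++ v.
have wE : nseq K false ++ v = nseq j false ++ false :: nseq m false ++ v.
  by rewrite -jK nseqD -catA.
have bodyE st o : driver_state (nseq K false ++ v) 2 o st ->
    var st 4 = Posz j -> parent_ok (nseq K false ++ v) ->
    let st' := run (body true rv cp tst) st in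
    if Sb x then driver_state x 2 (o ++ bits (word_map rv cp x)) st' /\
      var st' 4 = 0%R
    else driver_state (nseq K false ++ v) 1 o st'.
  rewrite wE => hD h4 hp; have [? hn ? hw hm ? ?] := hD.
  rewrite /body run_if [eval _ _]/= hm run_if [eval _ _]/= h4 /= hw.
  rewrite nth_cat size_nseq ltnn subnn /= run_if [eval _ _]/= hn h4.
  have -> : (0 < Posz n - Posz j)%R by lia.
  exact: (@attemptP true).
have kn : j < K by lia.
(* If the first candidate fails, so do all: [Sb_last] leads from any word in question to [x]. *)
case hS : (Sb x); last first.
  exists [::]; split=> //.
    by apply: visit_none => o st hD h4 hp; have := bodyE st o hD h4 hp; rewrite /= hS.
  move=> s; split=> // -[h [u [su tu E]]].
  suff : Sb x by rewrite hS.
  apply: Sb_last tu _; rewrite -?E // ?jK //.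
  by case: hv => [[_]|[v' ->]]; [rewrite ltnS leqn0 => /eqP; right | left].
have [|||E1 [v1 u1 m1]] := IHK j kn j 0 (true :: nseq m false ++ v).
- by rewrite add0n.
- by rewrite /= size_cat size_nseq; lia.
- by right; eexists.
have jK' : j.+1 + m = K by rewrite addSnnS.
have hv' : v = [::] /\ m <= 1 \/ exists v', v = true :: v'.
  by case: hv => [[-> /ltnW]|]; [left|right].
have [E2 [v2 u2 m2]] := IHm j.+1 v jK' sz hv'.
exists (x :: E1 ++ E2).
have x1 : x \notin E1.
  apply/negP => /m1 [_ [u [su]]]; rewrite drop0 => tu /eqP.
  rewrite eqseq_cat ?size_nseq // => /andP [/eqP e _].
  by move: tu; rewrite -e mem_nseq andbF.
(* The last 1 in front of [v] is at [j] in [x] and in the words of [E1], and further right in those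
   of [E2]; this keeps the lists disjoint. *)
have no2 u y : u ++ v = y ++ true :: nseq m false ++ v -> size u = K -> size y = j ->
    true \notin drop j.+1 u.
  move=> e su sy.
  have : u ++ v == (y ++ true :: nseq m false) ++ v by rewrite -catA e.
  rewrite eqseq_cat; last by rewrite size_cat /= size_nseq su sy jK.
  case/andP => /eqP -> _; rewrite drop_cat sy ltnNge leqnSn /= subSnn /= drop0.
  by rewrite mem_nseq andbF.
split.
- rewrite wE; apply: visit_node => //.
    by move=> o st; rewrite -wE => hD h4 hp; have := bodyE st o hD h4 hp; rewrite /= hS.
  by rewrite -wE.
- rewrite /= cat_uniq u1 u2 mem_cat (negbTE x1) /= andbT; apply/andP; split.
    apply/negP => /m2 [_ [u [su tu /esym e]]].
    by have := no2 _ _ e su (size_nseq _ _); rewrite tu.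
  apply/hasPn => s /m2 [_ [u [su tu ->]]]; apply/negP => /m1 [_ [u' [su' _ e]]].
  by have := no2 _ _ e su su'; rewrite tu.
move=> s; rewrite inE mem_cat; split.
  case/or3P => [/eqP ->|/m1 [h [u [su tu E]]]|/m2 [h [u [su tu E]]]].
  - split=> //; exists (nseq j false ++ true :: nseq m false).
    rewrite size_cat /= !size_nseq drop_cat size_nseq ltnn subnn /= inE eqxx.
    by rewrite /x -catA; split.
  - rewrite E in h *; split=> //.
    exists (u ++ true :: nseq m false); rewrite size_cat /= size_nseq su -catA.
    by rewrite drop_cat su ltnn subnn /= inE eqxx.
  - split=> //; exists u; split=> //.
    by move: tu; rewrite -add1n -drop_drop => /mem_drop.
case=> h [u [su tu E]]; apply/or3P.
case t2 : (true \in drop j.+1 u).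
  by apply: Or33; apply/m2; split=> //; exists u.
have ju : j < size u by rewrite su.
have ut : nth false u j = true.
  by move: tu; rewrite (drop_nth false ju) inE t2 orbF => /eqP.
have dm : drop j.+1 u = nseq m false.
  have -> : m = size (drop j.+1 u) by rewrite size_drop su; lia.
  by apply/all_pred1P/allP => -[] // xu; rewrite xu in t2.
have uE : u = take j u ++ true :: nseq m false.
  by rewrite -dm -ut -drop_nth // cat_take_drop.
have st : size (take j u) = j by rewrite size_takel // ltnW.
have sE : s = take j u ++ true :: nseq m false ++ v.
  by rewrite E [in LHS]uE -catA.
case t1 : (true \in take j u).
  by apply: Or32; apply/m1; split=> //; exists (take j u); rewrite drop0.
apply: Or31; rewrite sE /x; apply/eqP; congr (_ ++ _).
by rewrite -{2}st; apply/all_pred1P/allP => -[] // xu; rewrite xu in t1.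
Qed.

End Run.

(** * Assembly of the RAM program and its amortized time *)

Definition tree_program (ini bdy : cmd) : program :=
  let c1 := compile 1 ini in
  let s := (size c1).+1 in
  let c2 := compile (s + 3) bdy in
  [:: IRead (V 0)] ++ c1 ++
  [:: IJump (V 3) (s + 3); IConst (Tm 0) 1; IJump (Tm 0) (s + 3 + size c2 + 2)] ++
  c2 ++ [:: IConst (Tm 0) 1; IJump (Tm 0) s].

(** Besides the body, a round costs 3 steps: the test of the mode and a jump back of two
    instructions. The final 3 are the failed test and the exit jump. *)
Lemma whileP (bdy ini : cmd) n k st r
  (P := tree_program ini bdy) (s := (size (compile 1 ini)).+1) (f := run bdy) :
  wf bdy -> 0 \notin writes bdy -> bound st = n -> sim st r ->
  (forall i, i < k -> (0 < var (iter i f st) 3)%R) ->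
  (0 < var (iter k f st) 3)%R = false -> bad (iter k f st) = false ->
  exists t r' i', t <= k * (cst bdy n + 3) + 3 /\
    reach P (Config s r (inp st) (out st)) t
      (Config (size P) r' i' (out (iter k f st))).
Proof.
move=> wb zb.
have : code_at P 0 P by exists [::], [::]; rewrite cats0.
rewrite {2}/P /tree_program; case/code_at_cat => _.
case/code_at_cat => _; rewrite [0 + _]/= add1n -/s.
case/code_at_cat; get_code => _.
case/code_at_cat => cb; get_code => _.
have szP : size P = s + 3 + size (compile (s + 3) bdy) + 2.
  rewrite /P /tree_program -/s size_cat size_cat size_cat size_cat.
  by rewrite [size [:: IRead _]]/= [size [:: IJump _ _; _; _]]/= [size [:: IConst _ _; _]]/= /s; lia.
rewrite -szP !(addnS, addn0) in cd cd0 cd1 cb cd2 cd3.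
elim: k st r => [|k IH] st r bs hs act mode hb.
  pose r1 := rset r (Tm 0) 1%R.
  exists 3, r1, (inp st); split=> //.
  go (Config s.+1 r (inp st) (out st)); first by rewrite (proj1 hs) mode.
  go (Config s.+2 r1 (inp st) (out st)); first by [].
  apply: reach_step; last exact: reach0.
  by rewrite /step; cbn [pc reg input output]; rewrite cd1 /r1 rsetE eqxx.
have hb1 : bad (run bdy st) = false.
  apply/negbTE/negP => h; move/negP: hb; apply; rewrite iterSr.
  by apply: (iter_inv (Q := fun t => bad t)) h => t /(run_bad bdy).
have a0 := act 0 isT.
have [t [r1 [t_le run1 s1]]] := compileP wb zb bs cb hs hb1.
pose r2 := rset r1 (Tm 0) 1%R.
have bs1 : bound (run bdy st) = n by rewrite run_bound.
have act1 i : i < k -> (0 < var (iter i f (run bdy st)) 3)%R.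
  by rewrite -iterSr => ik; apply: act.
rewrite iterSr in mode hb *.
have [t2 [r3 [i3 [t2_le run2]]]] := IH _ r2 bs1 (sim_tmp 0 1%R s1) act1 mode hb.
exists (1 + (t + (2 + t2))), r3, i3; split; first by lia.
apply: reach_trans (reach_trans run1 (reach_trans _ run2)).
  apply: reach_step; last exact: reach0.
  by rewrite /step; cbn [pc reg input output]; rewrite cd (proj1 hs) a0.
go (Config (s.+3 + size (compile s.+3 bdy)).+1 r2 (inp (run bdy st)) (out (run bdy st))); first by [].
apply: reach_step; last exact: reach0.
by rewrite /step; cbn [pc reg input output]; rewrite cd3 /r2 rsetE eqxx.
Qed.

Definition init_spec (ini : cmd) (n : nat) (l : seq int)
    (Pm : int -> int -> (nat -> int) -> Prop) : Prop :=
  forall st, var st = upd (fun=> 0%R) 0 (Posz n) -> arr st = (fun _ _ => 0%R) ->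
  inp st = l -> bad st = false ->
  bad (run ini st) = false /\
  Pm (var (run ini st) 1) (var (run ini st) 2) (arr (run ini st) true).

Definition shift_closed (n : nat) (Sb : pred (seq bool)) : Prop :=
  forall a b v, a + (size v).+2 = n ->
  Sb (nseq a false ++ true :: b :: v) -> Sb (nseq a false ++ false :: true :: v).

Lemma subz1 n : 0 < n -> (Posz n - 1)%R = Posz n.-1.
Proof. by case: n => // n _; rewrite /=; lia. Qed.

Lemma visit_all up rv cp tst n (Sb : pred (seq bool)) Pm :
  0 < n -> test_ok tst -> test_spec tst n Sb Pm ->
  (if up then left_closed n Sb else shift_closed n Sb) ->
  exists E, [/\ visit rv cp tst n Sb Pm up (nseq n false) (if up then n.-1 else n) E,
    uniq E & forall s, s \in E <-> [/\ size s = n, true \in s & Sb s]].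
Proof.
move=> n0 tok htst; case: up => hcl.
  have n1 : n.-1 + 1 = n by rewrite addn1 prednK.
  have [||E [hv hu hm]] := visit_up rv cp tok htst hcl n1 (v := [::]).
  - by rewrite addn0.
  - by left.
  rewrite cats0 in hv; exists E; split=> // s; rewrite hm; split.
    case=> hs [u [su tu]]; rewrite cats0 => E1; rewrite E1 in hs *; split=> //.
    exact: mem_drop tu.
  case=> sz ts hs; split=> //; exists s; rewrite cats0; split=> //.
  by have [_ [_ hl]] := hcl; apply: hl.
exists (enum_tree Sb n [::]); split.
- by have := @visit_tree rv cp tst n Sb Pm tok htst n [::]; rewrite cats0.
- exact: enum_tree_uniq.
move=> s; split.
  by case/enum_tree_sound => hs [u [su tu E1]]; rewrite E1 cats0 in hs *.
case=> sz ts hs; have := enum_tree_complete (w := [::]) hcl sz ts (addn0 n).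
by rewrite cats0; apply.
Qed.

Lemma time_bound K1 K2 n c1 c2 k l e t1 t2 : 0 < n -> 0 < l ->
  c1 <= K1 * n -> c2 <= K2 * n -> e <= l -> k <= 3 * e + 1 ->
  t1 <= c1 -> t2 <= k.+1 * (c2 + 3) + 3 ->
  1 + (t1 + t2) <= (K1 + 4 + 5 * (K2 + 3)) * n * l.
Proof.
move=> n0 l0 h1 h2 el kl t1l t2l.
(* [k + 1 <= 3 * l + 2 <= 5 * l], because the list is nonempty. *)
have k5 : k.+1 <= 5 * l by lia.
have e1 : t1 <= K1 * n * l.
  by apply: leq_trans t1l (leq_trans h1 _); rewrite leq_pmulr.
have e2 : t2 <= 5 * (K2 + 3) * n * l + 3.
  apply: (leq_trans t2l); rewrite leq_add2r.
  have h : c2 + 3 <= (K2 + 3) * n by nia.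
  apply: leq_trans (leq_mul k5 h) _.
  by rewrite -!mulnA leq_mul2l /= (mulnC l) -mulnA leqnn.
(* The 4 consists of the read of [n] and the 3 steps that leave the main loop. *)
have e3 : 4 <= 4 * n * l by rewrite -mulnA leq_pmulr // muln_gt0 n0.
rewrite !mulnDl in e2 *; lia.
Qed.

(** Nonemptiness is needed for the amortization and is also passed on to the language: for Dyck
    words it excludes [k = 0]. *)
Lemma tree_generable (R : realType) (g : nat -> R) (Par : nat -> Type)
    (enc : forall n, Par n -> seq int) (S : forall n, Par n -> seq bool -> Prop)
    (up rv cp : bool) (ini tst : cmd)
    (Pm : forall n, Par n -> int -> int -> (nat -> int) -> Prop)
    (Sb : forall n, Par n -> pred (seq bool)) :
  (forall n, 0 < n -> (n%:R <= g n)%R) -> init_ok ini -> test_ok tst ->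
  (forall n (p : Par n), 0 < n -> (exists s, size s = n /\ S n p s) ->
    [/\ init_spec ini n (enc n p) (Pm n p),
        forall w, size w = n -> S n p (word_map rv cp w) <-> Sb n p w,
        if up then left_closed n (Sb n p) else shift_closed n (Sb n p)
      & test_spec tst n (Sb n p) (Pm n p)]) ->
  generable g enc S.
Proof.
move=> hg iok tok H.
have [wi li /allP wri pui pri] := and5P iok.
have [wt lt /allP wrt /eqP put /andP [rdt prt]] := and5P tok.
pose c1 := init up rv cp ini tst; pose c2 := body up rv cp tst.
have [K1 hK1] : exists K, forall n, 0 < n -> cst c1 n <= K * n.
  by apply: cst_loops1; rewrite /= !geq_max li lt.
have [K2 hK2] : exists K, forall n, 0 < n -> cst c2 n <= K * n.
  by apply: cst_loops1; rewrite /c2; case: (up) => /=; rewrite !geq_max lt.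
have t0 x : x < 7 -> x \notin writes tst by move=> x7; apply/negP => /wrt /=; lia.
have i0 x : x \in [:: 0; 3; 4; 5; 6] -> x \notin writes ini.
  by move=> xi; apply/negP => /wri; move: xi; rewrite !inE /=; lia.
have wc2 : wf c2 by rewrite /c2; case: (up); rewrite /= wt.
have zc2 : 0 \notin writes c2.
  by rewrite /c2; case: (up); rewrite /= !(mem_cat, inE) (negbTE (t0 0 isT)).
have wc1 : wf c1 by rewrite /= wt wi.
have zc1 : 0 \notin writes c1.
  by rewrite /= !(mem_cat, inE) (negbTE (t0 0 isT)) (negbTE (i0 0 isT)).
exists (tree_program c1 c2), (K1 + 4 + 5 * (K2 + 3))%:R%R => n p n0 hex.
have [ispec hS hshift htst] := H n p n0 hex.
pose f := word_map rv cp; pose z := nseq n false.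
pose s0 := State (upd (fun=> 0%R) 0 (Posz n)) (fun _ _ => 0%R) (enc n p) [::] false.
pose s1 := run ini s0.
have [b1 p1] : bad s1 = false /\ Pm n p (var s1 1) (var s1 2) (arr s1 true).
  by apply: ispec.
have n1 : var s1 0 = Posz n by rewrite /s1 run_var // i0.
have w1 : holds_word (arr s1 false) z.
  by move=> i; rewrite /s1 run_arr // nth_nseq if_same.
have o1 : out s1 = [::] by rewrite /s1 run_out.
pose s2 := run tst s1.
have := run_tst_frame tok s1; rewrite -/s2 => -[a2 _ o2 b2 v2].
have sz : size z = n by rewrite size_nseq.
(* The premise on the parent is vacuous, as [z] contains no 1. *)
have T2 : (0 < var s2 7)%R = Sb n p z.
  apply: htst => // j v E; have := congr1 (fun u => true \in u) E.
  by rewrite mem_cat inE eqxx orbT mem_nseq andbF.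
pose W0 := if Sb n p z then [:: z] else [::].
pose s5 := run c1 s0.
have [hD h4] : driver_state n (Pm n p) z 2 (bits (flatten (map f W0))) s5 /\
    var s5 4 = Posz (if up then n.-1 else n).
  have -> : s5 = let s3 := if Sb n p z then run (print_word rv cp) s2 else run skip s2 in
      let s4 := setv s3 (upd (var s3) 3 2%R) in setv s4 (upd (var s4) 4 (if up then (var s4 0 - 1)%R else var s4 0)).
    by rewrite -T2 /s5 /c1; case: (up); reflexivity.
  clearbody s2 s1; set s3 := if _ then _ else _.
  have [a3 b3 o3 v3] : [/\ arr s3 = arr s2, bad s3 = bad s2,
      out s3 = bits (flatten (map f W0)) & forall x, x < 3 -> var s3 x = var s2 x].
    rewrite /s3 /W0; case: (Sb n p z); last first.
      split=> //; first by rewrite /= o2 o1.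
      by move=> x x3; rewrite run_var // inE neq_ltn (leq_trans x3).
    have hr : ~~ reads (print_word rv cp) by [].
    have [_ h] := run_inp s2 hr; split.
    - by apply: run_no_put.
    - exact: h.
    - rewrite (@print_wordP _ _ _ z) ?a2 ?v2 ?sz //.
      by rewrite o2 o1 /= cats0.
    - by move=> x x3; rewrite run_var // inE neq_ltn (leq_trans x3).
  split; last by rewrite /= !updE /= v3 // v2 // n1; case: (up) => //; apply: subz1.
  split=> //=; rewrite ?updE /= ?a3 ?v3 ?a2 ?v2 //.
  by rewrite b3 b2.
have [E [hvis uE mE]] := visit_all rv cp n0 tok htst hshift.
have [|k k_le [act hD']] := hvis _ _ hD h4; first by right.
have m1 := active1 rv cp tst up (ds_mode hD').
have [h3 ho hb] := body_halt rv cp tst up hD'.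
pose L := map f (W0 ++ E).
have fK := word_mapK rv cp; have fI := inv_inj fK.
have zE : z \notin E.
  by apply/negP => /mE []; rewrite mem_nseq andbF.
have LP s : s \in L <-> size s = n /\ S n p s.
  rewrite -[s]fK (mem_map fI) size_word_map mem_cat; set w := f s.
  split.
    have hE : w \in E -> size w = n /\ Sb n p w.
      by case/mE.
    rewrite /W0; case: ifP => hz; case/orP=> //.
    - by rewrite inE => /eqP ->; rewrite sz; split=> //; apply/hS.
    - by case/hE => sw hw; split=> //; apply/hS.
    - by case/hE => sw hw; split=> //; apply/hS.
  case=> sw /(hS _ sw) hw.
  case tw : (true \in w).
    by rewrite (_ : w \in E) ?orbT //; apply/mE.
  have wz : w = z.
    by rewrite /z -sw; apply/all_pred1P/allP => -[] // xw; rewrite xw in tw.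
  by rewrite /W0 -wz hw inE eqxx.
have UL : uniq L.
  rewrite (map_inj_uniq fI) cat_uniq uE andbT /W0.
  by case: ifP => _ //=; rewrite ?has_pred0 //; apply/hasP => -[x xE]; rewrite inE => /eqP xz;
    rewrite -xz xE in zE.
have L1 : 0 < size L.
  have [s [ss hs]] := hex; have /LP := conj ss hs; by case: (L).
have EL : size E <= size L by rewrite size_map size_cat leq_addl.
have z1 : 0 < n -> bound s0 = n by [].
pose P := tree_program c1 c2.
have cP : code_at P 0 P by exists [::], [::]; rewrite cats0.
move: cP; rewrite {2}/P /tree_program; case/code_at_cat; get_code => _.
case/code_at_cat; rewrite [0 + _]/= => cc1 _.
pose r0 : nat -> int := fun=> 0%R.
pose r1 := rset r0 (V 0) (Posz n).
have sim0 : sim s0 r1.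
  split=> [x|a i]; rewrite /r1 !eqE_ ?updE //=.
have b5 : bad s5 = false := ds_bad hD.
have [t1 [r2 [t1_le run1 s5r]]] := compileP wc1 zc1 (z1 n0) cc1 sim0 b5.
have bs5 : bound s5 = n by rewrite /bound (ds_n hD).
have act5 : active rv cp tst up s5 k.+1.
  by rewrite -addn1 => i; exact: (active_trans act m1).
have mode5 : (0 < var (iter k.+1 (run c2) s5) 3)%R = false by rewrite /= [X in (_ < X)%R]h3.
have [t2 [r3 [i3 [t2_le run2]]]] := whileP c1 wc2 zc2 bs5 s5r act5 mode5 hb.
exists L, (1 + (t1 + t2)); split=> //.
  eexists; split; first apply: reach_trans (reach_trans run1 run2).
  - apply: reach_step; last exact: reach0.
    by rewrite /step; cbn [pc reg input output]; rewrite cd.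
  - by [].
  - by rewrite [LHS]ho -/(bits _) /L map_cat flatten_cat /bits map_cat.
have tb : 1 + (t1 + t2) <= (K1 + 4 + 5 * (K2 + 3)) * n * size L.
  exact: time_bound n0 L1 (hK1 _ n0) (hK2 _ n0) EL k_le t1_le t2_le.
apply: (@le_trans _ _ ((K1 + 4 + 5 * (K2 + 3)) * n * size L)%:R%R).
  by rewrite ler_nat.
rewrite !natrM ler_wpM2r ?ler0n // ler_wpM2l ?ler0n //; exact: hg.
Qed.

Arguments upd f i v x /.

(** * Tools for membership tests *)

(** Unlike [skip] it touches variable 7, since [test_ok] reserves the smaller ones for the
    driver. *)
Definition nop : cmd := Asn 7 (EV 7).
Definition no_init : cmd := Asn 7 (EC 0%R).

Section Generable.

Variables (R : realType) (g : nat -> R).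
Hypothesis g_ge : forall n, 0 < n -> (n%:R <= g n)%R.

Lemma none_generable (S : forall n, unit -> seq bool -> Prop) rv cp tst
    (Sb : nat -> pred (seq bool)) :
  test_ok tst ->
  (forall n w, 0 < n -> size w = n -> S n tt (word_map rv cp w) <-> Sb n w) ->
  (forall n, shift_closed n (Sb n)) ->
  (forall n, 0 < n -> test_spec tst n (Sb n) (fun _ _ _ => True)) ->
  generable g enc_none S.
Proof.
move=> tok hS hsh ht.
apply: (@tree_generable R g _ _ _ false rv cp no_init tst (fun _ _ _ _ _ => True)
         (fun n _ => Sb n)) => // n [] n0 _.
by split=> //; [move=> w sw; apply: hS | apply: ht].
Qed.

Lemma nat_generable (S : forall n, nat -> seq bool -> Prop) rv cp tst
    (Sb : nat -> nat -> pred (seq bool)) :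
  test_ok tst ->
  (forall n k w, 0 < n -> (exists s, size s = n /\ S n k s) -> size w = n ->
     S n k (word_map rv cp w) <-> Sb n k w) ->
  (forall n k, shift_closed n (Sb n k)) ->
  (forall n k, 0 < n -> test_spec tst n (Sb n k) (fun v _ _ => v = Posz k)) ->
  generable g enc_nat S.
Proof.
move=> tok hS hsh ht.
apply: (@tree_generable R g _ _ _ false rv cp (Rd 1) tst (fun _ k v _ _ => v = Posz k)
         Sb) => // n k n0 hex.
split=> //; [|by move=> w sw; apply: hS|exact: ht].
by move=> st hv ha hi hb; rewrite (run_rd 1 hi) /= hb.
Qed.

End Generable.

Section Loops.

Variables (c : cmd) (i : nat) (s : state) (w : seq bool).
Hypothesis wfc : wf (For i c).
Hypothesis pc0 : puts c = [::].
Hypothesis s0 : var s 0 = Posz (size w).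

Lemma loop_ind (Inv : nat -> (nat -> int) -> Prop) :
  Inv 0 (upd (var s) i 0%R) ->
  (forall k st, k < size w -> var st i = Posz k -> var st 0 = Posz (size w) ->
     arr st = arr s ->
     (forall x, x \notin writes (For i c) -> var st x = var s x) ->
     Inv k (var st) -> Inv k.+1 (upd (var (run c st)) i (Posz k.+1))) ->
  Inv (size w) (var (run (For i c) s)).
Proof.
move=> I0 IS.
pose Inv' k st := arr st = arr s /\ Inv k (var st).
have [] : Inv' (size w) (run (For i c) s); last by [].
apply: for_ind => // k st kn hi h0 hx [ha hI]; split; last exact: IS.
by rewrite /= run_no_put.
Qed.

Hypothesis sw : holds_word (arr s false) w.

(** The invariant speaks of the prefix read so far instead of a counter, which suits quantities
    computed along [rcons]. *)
Lemma loop_left (Inv : seq bool -> (nat -> int) -> Prop) :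
  Inv [::] (upd (var s) i 0%R) ->
  (forall x u st, prefix (rcons u x) w -> var st i = Posz (size u) ->
     var st 0 = Posz (size w) -> arr st = arr s ->
     (forall y, y \notin writes (For i c) -> var st y = var s y) ->
     eval st (bit false i) = Posz (nat_of_bool x) ->
     Inv u (var st) ->
     Inv (rcons u x) (upd (var (run c st)) i (Posz (size u).+1))) ->
  Inv w (var (run (For i c) s)).
Proof.
move=> I0 IS; pose Inv' k := Inv (take k w).
suff : Inv' (size w) (var (run (For i c) s)) by rewrite /Inv' take_size.
apply: loop_ind; first by rewrite /Inv' take0.
move=> k st kn hi h0 ha hx hI; rewrite /Inv' (take_nth false) //.
have sk : size (take k w) = k by rewrite size_takel // ltnW.
rewrite -[in Posz _]sk; apply: IS; rewrite ?sk //.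
  by rewrite -take_nth // prefix_take.
by rewrite (@bitE false st w i k) ?ha.
Qed.

(** The mirror image: the part read is a suffix growing by [cons], which suits structural recursion
    on words. *)
Lemma loop_right (Inv : seq bool -> (nat -> int) -> Prop) :
  Inv [::] (upd (var s) i 0%R) ->
  (forall x u st, size u < size w -> drop (size w - (size u).+1) w = x :: u ->
     var st i = Posz (size u) ->
     var st 0 = Posz (size w) -> arr st = arr s ->
     (forall y, y \notin writes (For i c) -> var st y = var s y) ->
     eval st (bit true i) = Posz (nat_of_bool x) ->
     Inv u (var st) ->
     Inv (x :: u) (upd (var (run c st)) i (Posz (size u).+1))) ->
  Inv w (var (run (For i c) s)).
Proof.
move=> I0 IS; pose Inv' k := Inv (drop (size w - k) w).
suff : Inv' (size w) (var (run (For i c) s)) by rewrite /Inv' subnn drop0.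
apply: loop_ind; first by rewrite /Inv' subn0 drop_size.
move=> k st kn hi h0 ha hx hI; rewrite /Inv'.
have sk : size (drop (size w - k) w) = k by rewrite size_drop subKn // ltnW.
have E : drop (size w - k.+1) w =
    nth false w (size w - k.+1) :: drop (size w - k) w.
  rewrite (drop_nth false); last by lia.
  by congr (_ :: drop _ _); lia.
rewrite E -[in Posz _]sk; apply: IS; rewrite ?sk //.
by rewrite (@bitE true st w i k) ?ha // nth_rev.
Qed.

End Loops.

(** * All strings; bounded weight *)

Section Simple.

Variables (R : realType) (g : nat -> R).
Hypothesis g_ge : forall n, 0 < n -> (n%:R <= g n)%R.

Lemma all_generable : generable g enc_none (fun _ _ _ => True).
Proof.
by apply: (@none_generable R g g_ge _ false false (Asn 7 (EC 1%R)) (fun _ => predT)).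
Qed.

Definition weight_test (ge : bool) : cmd :=
  Seq (Asn 8 (EC 0%R))
  (Seq (For 9 (Asn 8 (EA (EV 8) (bit false 9))))
  (Asn 7 (ES (EA (if ge then ES (EV 0) (EV 1) else EV 1) (EC 1%R)) (EV 8)))).

(** For [ge] the tree consists of the complements, of weight at most [n - k]; the sum avoids
    truncated subtraction. *)
Definition weight_le (ge : bool) (n k : nat) (w : seq bool) : bool :=
  if ge then weight w + k <= n else weight w <= k.

Lemma weight_test_spec ge n k :
  test_spec (weight_test ge) n (weight_le ge n k) (fun v _ _ => v = Posz k).
Proof.
move=> st w sz h0 h1 hw _; rewrite /weight_test run_seq.
set s1 := run (Asn _ _) _; rewrite run_seq run_asn /=.
have h8 : var (run (For 9 (Asn 8 (EA (EV 8) (bit false 9)))) s1) 8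
    = Posz (weight w).
  apply: (@loop_left _ 9 s1 w _ _ _ _ (fun u f => f 8 = Posz (weight u))) => //.
    by rewrite sz.
  move=> x u st' _ _ _ _ _ hb; rewrite run_asn /= in hb * => ->.
  by rewrite hb /weight -cats1 count_cat /=; case: x {hb}; lia.
rewrite /weight_le; case: ge; rewrite /= h8 !run_var //= ?h0 h1; apply/idP/idP; lia.
Qed.

Lemma weight_shift ge n k : shift_closed n (weight_le ge n k).
Proof.
move=> a b v _; rewrite /weight_le /weight !count_cat /=.
by case: ge; lia.
Qed.

Lemma weight_le_generable :
  generable g enc_nat (fun _ k s => (weight s <= k)%N).
Proof.
apply: (@nat_generable R g g_ge _ false false (weight_test false)
  (weight_le false)) => //.
- exact: weight_shift.
- by move=> n k _; apply: weight_test_spec.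
Qed.

Lemma count_compl (w : seq bool) b : count_mem b (compl w) = count_mem (~~ b) w.
Proof. by rewrite count_map; apply: eq_count => x; case: x; case: b. Qed.

Lemma weight_compl (w : seq bool) : weight (compl w) = size w - weight w.
Proof.
rewrite /weight count_compl -(count_predC (pred1 true) w) addKn.
by apply: eq_count => -[].
Qed.

Lemma weight_size (w : seq bool) : weight w <= size w.
Proof. exact: count_size. Qed.

Lemma weight_ge_generable :
  generable g enc_nat (fun _ k s => (k <= weight s)%N).
Proof.
apply: (@nat_generable R g g_ge _ false true (weight_test true)
  (weight_le true)) => //.
- move=> n k w n0 _ sw; rewrite /weight_le /word_map weight_compl.
  by have := weight_size w; rewrite sw; split; lia.
- exact: weight_shift.
- by move=> n k _; apply: weight_test_spec.
Qed.

(** * Forbidden substrings *)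

(** Variable 8 counts the 0s at the front of the suffix read so far; a 1 in front of at least [k] of
    them completes a forbidden factor. *)
Definition run_test : cmd :=
  Seq (Asn 7 (EC 1%R)) (Seq (Asn 8 (EC 0%R))
  (For 9 (Seq (Asn 10 (bit true 9))
    (If (EV 10)
      (Seq (If (ES (EA (EV 8) (EC 1%R)) (EV 1)) (Asn 7 (EC 0%R)) nop)
        (Asn 8 (EC 0%R)))
      (Asn 8 (EA (EV 8) (EC 1%R))))))).

Lemma prefix_nseq t (u : seq bool) : prefix (nseq t false) u = (t <= index true u).
Proof. by elim: t u => [|t IH] [|[] u] //=; rewrite prefix_cons IH. Qed.

Lemma run_test_spec n k :
  test_spec run_test n (fun w => ~~ infix (true :: nseq k false) w)
    (fun v _ _ => v = Posz k).
Proof.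
move=> st w sz h0 h1 hw _; rewrite /run_test run_seq run_seq.
set s1 := run (Asn _ _) _; set c := Seq _ _.
pose Inv u (f : nat -> int) := f 8 = Posz (index true u) /\
  (0 < f 7)%R = ~~ infix (true :: nseq k false) u.
have [] : Inv w (var (run (For 9 c) s1)); last by [].
apply: loop_right => //; first by rewrite sz.
move=> x u st' _ _ hi h0' ha hx hb [i8 i7]; rewrite /Inv infix_consl.
have e1 : var st' 1 = Posz k by rewrite hx.
rewrite /c !runE hb; case: x {hb} => /=; last by rewrite i8; split=> //; lia.
rewrite prefix_nseq i8 e1.
have -> : (0 < Posz (index true u) + 1 - Posz k)%R = (k <= index true u).
  by apply/idP/idP; lia.
by case: leqP => /= _; split=> //; rewrite i7.
Qed.

(** A new occurrence would start at the moved 1. If [b] is 1, the same run of 0s followed [b]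
    before; if [b] is 0, the run behind the leading 1 was even longer by one. *)
Lemma run_shift n k : shift_closed n (fun w => ~~ infix (true :: nseq k false) w).
Proof.
move=> a b v _; apply: contra.
have strip u : infix (true :: nseq k false) (nseq a false ++ u) =
    infix (true :: nseq k false) u.
  by elim: a => //= a <-; rewrite infix_consl.
rewrite !strip !infix_consl !prefix_cons !prefix_nseq.
by case: b => /=; case/orP => [h|->]; rewrite ?orbT // ?h ?orbT // (leqW h).
Qed.

Lemma infix_compl (u v : seq bool) : infix (compl u) (compl v) = infix u v.
Proof.
suff h u' v' : infix u' v' -> infix (compl u') (compl v').
  by apply/idP/idP => /h //; rewrite !complK.
by case/infixP => p [q ->]; rewrite /compl !map_cat; apply/infixP; eexists; eexists.
Qed.

Lemma no_10t_generable :
  generable g enc_nat (fun _ t s => ~~ infix (true :: nseq t false) s).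
Proof.
apply: (@nat_generable R g g_ge _ false false run_test
  (fun _ k w => ~~ infix (true :: nseq k false) w)) => //.
- exact: run_shift.
- by move=> n k _; apply: run_test_spec.
Qed.

Lemma no_01t_generable :
  generable g enc_nat (fun _ t s => ~~ infix (false :: nseq t true) s).
Proof.
apply: (@nat_generable R g g_ge _ false true run_test
  (fun _ k w => ~~ infix (true :: nseq k false) w)) => //.
- move=> n k w n0 _ sw; rewrite /word_map.
  have -> : false :: nseq k true = compl (true :: nseq k false).
    by rewrite /compl /= map_nseq.
  by rewrite infix_compl.
- exact: run_shift.
- by move=> n k _; apply: run_test_spec.
Qed.

End Simple.

(** * Languages with array parameters *)

(** Variable 2 holds the length of the parameter, which may exceed [n]; then only [n] letters are
    stored and the rest stays unread. *)
Definition read_loop (cp : bool) : cmd :=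
  For 9 (If (ES (EV 2) (EV 9))
    (Seq (Rd 8) (Put true (EV 9) (if cp then ES (EC 1%R) (EV 8) else EV 8)))
    nop).

Definition flip_bit (cp : bool) (x : int) : int := if cp then (1 - x)%R else x.

Lemma read_loopP cp st n m (l : seq int) : var st 0 = Posz n -> var st 2 = Posz m ->
  inp st = l -> minn m n <= size l -> arr st true = (fun=> 0%R) -> bad st = false ->
  let st' := run (read_loop cp) st in
  [/\ bad st' = false, var st' 1 = var st 1, var st' 2 = Posz m &
    forall i, arr st' true i =
      if i < minn m n then flip_bit cp (nth 0%R l i) else 0%R].
Proof.
move=> h0 h2 hi sl ha hb.
pose Inv k (t : state) := [/\ bad t = false, inp t = drop (minn m k) l,
  var t 1 = var st 1, var t 2 = Posz m & forall i, arr t true i =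
      if i < minn m k then flip_bit cp (nth 0%R l i) else 0%R].
rewrite /=; have [h1 h3 h4 h5 h6] : Inv n (run (read_loop cp) st); last by split.
apply: for_ind => //.
  by split=> //=; rewrite ?minn0 ?drop0 ?hb ?h2 // => i; rewrite ?ltn0 ha.
move=> k t kn ti t0 tx [b1 i1 v1 v2 a1]; rewrite /Inv !run_if /= ti v2.
have [mk|km] : m <= k \/ k < m by lia.
  have -> : (0 < Posz m - Posz k)%R = false by lia.
  have e : minn m k.+1 = minn m k by lia.
  by rewrite e; split.
have -> : (0 < Posz m - Posz k)%R by lia.
have ks : k < size l by apply: leq_trans sl; lia.
have e : minn m k.+1 = k.+1 by apply/minn_idPr.
have e' : minn m k = k by apply/minn_idPr/ltnW.
have i1' : inp t = nth 0%R l k :: drop k.+1 l.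
  by rewrite i1 e'; apply: drop_nth.
rewrite !runE (run_rd 8 i1') /= ti e; split=> // i.
have := a1 i; rewrite e' /= /puti => a1i.
have -> : eqn i k = (i == k) by [].
case: (i =P k) => [->|ik]; first by rewrite ltnSn /flip_bit; case: (cp).
by rewrite a1i ltnS; congr (if _ then _ else _); lia.
Qed.

Section Params.

Variables (R : realType) (g : nat -> R).
Hypothesis g_ge : forall n, 0 < n -> (n%:R <= g n)%R.

Definition flip_word (cp : bool) (w : seq bool) := if cp then compl w else w.

Lemma flip_bits cp (w : seq bool) i : i < size w ->
  flip_bit cp (nth 0%R (bits w) i) = Posz (nth false (flip_word cp w) i).
Proof.
move=> iw; rewrite (nth_map false) //; case: cp => //=.
by rewrite (nth_map false) //; case: nth.
Qed.

Definition tuple_par (cp : bool) (n : nat) (gamma : n.-tuple bool)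
    (_ v : int) (f : nat -> int) : Prop :=
  holds_word f (flip_word cp gamma).

Definition tuple_init (cp : bool) : cmd := Seq (Asn 2 (EV 0)) (read_loop cp).

Lemma size_flip cp w : size (flip_word cp w) = size w.
Proof. by case: cp; rewrite //= size_map. Qed.

Lemma tuple_init_spec cp n (gamma : n.-tuple bool) :
  init_spec (tuple_init cp) n (enc_tuple gamma) (tuple_par cp gamma).
Proof.
move=> st hv ha hi hb; rewrite run_seq run_asn.
set s1 := setv _ _.
have sz : size (bits gamma) = n by rewrite size_map size_tuple.
have [||||||h1 _ _ h4] := @read_loopP cp s1 n n (bits gamma).
- by rewrite /= hv.
- by rewrite /= hv.
- by rewrite /= hi.
- by rewrite sz minnn.
- by rewrite /= ha.
- by rewrite /= hb.
split=> // i; rewrite h4 minnn; case: ltnP => hn.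
  by rewrite flip_bits // size_tuple.
by rewrite nth_default // size_flip size_tuple.
Qed.

(** * Lexicographic comparisons *)

Definition lex (strict : bool) (s t : seq bool) : bool :=
  if strict then lexlt s t else lexle s t.

Lemma lex_cons strict x y s t :
  lex strict (x :: s) (y :: t) = (~~ x && y) || ((x == y) && lex strict s t).
Proof.
by rewrite /lex /lexlt /lexle lexi_cons ltxi_cons; case: strict; case: x; case: y.
Qed.

Lemma lex_nil strict : lex strict [::] [::] = ~~ strict.
Proof. by case: strict. Qed.

Lemma lex_compl strict s t : size s = size t ->
  lex strict (compl s) (compl t) = lex strict t s.
Proof.
elim: s t => [|x s IH] [|y t] //= [st].
by rewrite !lex_cons IH //; case: x; case: y.
Qed.

(* [e2] is evaluated at [var 9 = k], and compared with the bit [n - 1 - k] of the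
   word. *)
Definition lex_test (strict : bool) (e2 : exp) : cmd :=
  Seq (Asn 7 (EC (Posz (~~ strict))))
  (For 9 (Seq (Asn 10 (bit true 9)) (Seq (Asn 11 e2)
    (If (ES (EV 11) (EV 10)) (Asn 7 (EC 1%R))
      (If (ES (EV 10) (EV 11)) (Asn 7 (EC 0%R)) nop))))).

(** From right to left every difference overrides the previous verdict, so the leftmost one decides;
    equal words keep the initial value [~~ strict]. *)
Lemma lex_testP strict e2 st w (u : seq bool) :
  size u = size w -> var st 0 = Posz (size w) -> holds_word (arr st false) w ->
  (forall st' k, k < size w -> arr st' = arr st -> var st' 0 = Posz (size w) ->
     var st' 9 = Posz k -> eval st' e2 = Posz (nth false u (size w - k.+1))) ->
  (0 < var (run (lex_test strict e2) st) 7)%R = lex strict w u.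
Proof.
move=> su h0 hw he; rewrite /lex_test run_seq.
set s1 := run (Asn _ _) _; set c := Seq _ _.
pose Inv v (f : nat -> int) :=
  (0 < f 7)%R = lex strict v (drop (size w - size v) u).
have : Inv w (var (run (For 9 c) s1)); last by rewrite /Inv subnn drop0.
apply: loop_right => //.
  by rewrite /Inv subn0 -su drop_size lex_nil /=; case: (strict).
move=> x v st' vw _ hi h0' ha hx hb hI; rewrite /Inv /c !runE hb.
rewrite (he _ (size v)) //= (drop_nth false); last by rewrite su; lia.
rewrite lex_cons; have -> : (size w - (size v).+1).+1 = size w - size v by lia.
by rewrite -hI; case: x {hb}; case: nth => //=; case: (0 < _)%R.
Qed.

(** The shift lowers the letter at position [a], the first one that it changes. *)
Lemma lex_shift strict a b v (gamma : seq bool) :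
  a + (size v).+2 = size gamma ->
  lex strict (nseq a false ++ true :: b :: v) gamma ->
  lex strict (nseq a false ++ false :: true :: v) gamma.
Proof.
elim: a gamma => [|a IH] [|y gamma] //=.
  by case: gamma => [|z gamma] //= _; rewrite !lex_cons; case: y; case: b; case: z.
by move=> [sz]; rewrite !lex_cons; case: y => //=; apply: IH.
Qed.

Lemma tuple_lex_generable cp (S : forall n, n.-tuple bool -> seq bool -> Prop) :
  (forall n (gamma : n.-tuple bool) w, size w = n ->
     S n gamma (flip_word cp w) <-> lexle w (flip_word cp gamma)) ->
  generable g enc_tuple S.
Proof.
move=> hS.
apply: (@tree_generable R g _ _ _ false false cp (tuple_init cp)
   (lex_test false (EG true (rev_idx 9))) (fun n gamma => tuple_par cp gamma)
   (fun n gamma w => lexle w (flip_word cp gamma))) => //.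
move=> n gamma n0 _; split.
- exact: tuple_init_spec.
- by move=> w sw; rewrite -hS // /flip_word; case: (cp).
- by move=> a b v sz; apply: (@lex_shift false); rewrite size_flip size_tuple.
- move=> st w sw h0 hp hw _.
  apply: lex_testP => //; rewrite ?sw ?size_flip ?size_tuple // => st' k kn ha h0' h9.
  by rewrite /= h0' h9 rev_idxE //= ha hp.
Qed.

Lemma lexle_generable :
  generable g enc_tuple (fun _ gamma s => lexle s gamma).
Proof. exact: (@tuple_lex_generable false). Qed.

Lemma lexge_generable :
  generable g enc_tuple (fun _ gamma s => lexle gamma s).
Proof.
apply: (@tuple_lex_generable true) => n gamma w sw.
by rewrite -{1}[tval gamma]complK [lexle _ _](@lex_compl false) // size_map size_tuple.
Qed.

(** * Forbidden prefix *)

(** A pattern [1 gamma] longer than [n] cannot be a prefix and is sorted out by the first test;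
    otherwise all of [gamma] has been stored. *)
Definition prefix_test : cmd :=
  Seq (Asn 7 (EC 1%R)) (If (ES (EV 0) (EV 2))
  (Seq (Asn 8 (EG false (EC 0%R)))
  (Seq (For 9 (If (ES (EV 2) (EV 9))
     (Seq (Asn 10 (EG true (EV 9)))
     (Seq (Asn 11 (EG false (EA (EV 9) (EC 1%R))))
     (If (ES (EV 10) (EV 11)) (Asn 8 (EC 0%R))
       (If (ES (EV 11) (EV 10)) (Asn 8 (EC 0%R)) nop)))) nop))
  (Asn 7 (ES (EC 1%R) (EV 8))))) nop).

Lemma prefix_rcons (u w : seq bool) x :
  prefix (rcons u x) w = [&& prefix u w, size u < size w & nth false w (size u) == x].
Proof.
elim: u w => [|y u IH] [|z w]; rewrite ?rcons_cons ?prefix_cons //.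
  by rewrite !prefix0s andbT eq_sym.
by rewrite IH -andbA.
Qed.

Definition string_par (cp : bool) (n : nat) (gamma : seq bool) (_ v : int)
    (f : nat -> int) : Prop :=
  v = Posz (size gamma) /\
  forall i, i < minn (size gamma) n -> f i = Posz (nth false (flip_word cp gamma) i).

Definition string_init (cp : bool) : cmd := Seq (Rd 2) (read_loop cp).

Lemma string_init_spec cp n gamma :
  init_spec (string_init cp) n (@enc_string n gamma) (string_par cp n gamma).
Proof.
move=> st hv ha hi hb; rewrite run_seq (run_rd 2 hi).
set s1 := State _ _ _ _ _.
have [||||||h1 _ h3 h4] := @read_loopP cp s1 n (size gamma) (bits gamma).
- by rewrite /= hv.
- by [].
- by [].
- by rewrite size_map geq_minl.
- by rewrite /= ha.
- by rewrite /= hb.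
split=> //; split=> // i hi'; rewrite h4 hi' flip_bits //.
by apply: leq_trans hi' (geq_minl _ _).
Qed.

Lemma prefix_test_spec cp n gamma :
  test_spec prefix_test n (fun w => ~~ prefix (true :: flip_word cp gamma) w)
    (string_par cp n gamma).
Proof.
move=> st w sw h0 [h2 hg] hw _; rewrite /prefix_test run_seq run_asn run_if.
set m := size gamma in h2 hg.
rewrite /= h0 h2; case: ifP => mn; last first.
  rewrite run_asn /=; case hp : (prefix _ _) => //.
  by have := size_prefix hp; rewrite /= size_flip sw -/m; lia.
rewrite run_seq; set s1 := run (Asn _ _) _; rewrite run_seq; set c := If _ _ _.
have m_n : m < n by lia.
set gam := flip_word cp gamma.
have sg : size gam = m by rewrite size_flip.
pose Inv k (f : nat -> int) := f 8 = Posz (prefix (true :: take k gam) w).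
have : Inv (size w) (var (run (For 9 c) s1)); last first.
  rewrite /Inv take_oversize; last by rewrite sg sw ltnW.
  by move=> h8; rewrite run_asn /= h8; case: prefix.
apply: loop_ind; rewrite ?sw //.
  rewrite /Inv take0 /s1 run_asn /= hw.
  by case: (w) => [|[] w'] //; rewrite prefix_cons prefix0s.
move=> k st' kn hk h0' ha hx hI; rewrite /Inv /c run_if /= hk hx //.
have -> : var s1 2 = Posz m by [].
have [mk|km] : m <= k \/ k < m by lia.
  have -> : (0 < Posz m - Posz k)%R = false by lia.
  rewrite /= hI !take_oversize ?sg //; exact: leqW.
have -> : (0 < Posz m - Posz k)%R by lia.
rewrite !runE /= hk (_ : (Posz k + 1)%R = Posz k.+1) /=; last by lia.
rewrite ha /= hg; last by rewrite leq_min km.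
rewrite hw (take_nth false) ?sg // -rcons_cons prefix_rcons /= size_takel ?sg ?(ltnW km) //.
have -> : k.+1 < size w by rewrite sw; lia.
rewrite -/gam; move: hI; rewrite /Inv.
by case: (nth false w k.+1); case: (nth false gam k) => /= h8;
  rewrite ?andbT ?andbF ?h8.
Qed.

(** A shifted word always begins with 0. *)
Lemma prefix_shift n gamma : shift_closed n (fun w => ~~ prefix (true :: gamma) w).
Proof. by move=> a b v _ _; case: a. Qed.

Lemma prefix_compl (u v : seq bool) : prefix (compl u) (compl v) = prefix u v.
Proof.
elim: u v => [|x u IH] [|y v] //.
by rewrite [compl _]/= [compl (y :: v)]/= !prefix_cons IH; case: x; case: y.
Qed.

Lemma string_prefix_generable cp (S : forall n, seq bool -> seq bool -> Prop) :
  (forall n gamma w, size w = n ->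
     S n gamma (flip_word cp w) <-> ~~ prefix (true :: flip_word cp gamma) w) ->
  generable g enc_string S.
Proof.
move=> hS.
apply: (@tree_generable R g _ _ _ false false cp (string_init cp) prefix_test
   (fun n gamma => string_par cp n gamma)
   (fun n gamma w => ~~ prefix (true :: flip_word cp gamma) w)) => //.
move=> n gamma n0 _; split.
- exact: string_init_spec.
- by move=> w sw; have := hS n gamma w sw; rewrite /flip_word; case: (cp).
- exact: prefix_shift.
- exact: prefix_test_spec.
Qed.

Lemma no_prefix_1_generable :
  generable g enc_string (fun _ gamma s => ~~ prefix (true :: gamma) s).
Proof. exact: (@string_prefix_generable false). Qed.

Lemma no_prefix_0_generable :
  generable g enc_string (fun _ gamma s => ~~ prefix (false :: gamma) s).
Proof.
apply: (@string_prefix_generable true) => n gamma w sw.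
have -> : false :: gamma = compl (true :: compl gamma) by rewrite /= complK.
by rewrite /= -[false :: _]/(compl (true :: compl gamma)) prefix_compl.
Qed.

(** * Knapsack *)

Fixpoint dot (w : seq bool) (l : seq int) : int :=
  match w, l with
  | x :: w', y :: l' => ((if x then y else 0) + dot w' l')%R
  | _, _ => 0%R
  end.

Definition knapsack_par (n : nat) (K : knapsack n) (v _ : int) (f : nat -> int) : Prop :=
  v = capacity K /\ forall i, i < n -> f i = nth 0%R (weights K) i.

Definition knapsack_init : cmd := Seq (Rd 1) (Seq (Asn 2 (EV 0)) (read_loop false)).

Definition knapsack_test : cmd :=
  Seq (Asn 8 (EC 0%R))
  (Seq (For 9 (If (bit false 9) (Asn 8 (EA (EV 8) (EG true (EV 9)))) nop))
  (Asn 7 (ES (EA (EV 1) (EC 1%R)) (EV 8)))).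

Lemma dot_rcons u x l : size u < size l ->
  dot (rcons u x) l = (dot u l + if x then nth 0 l (size u) else 0)%R.
Proof.
elim: u l => [|z u IH] [|y l] //= sl; last by rewrite IH // addrA.
by rewrite addr0 add0r; case: l {sl}.
Qed.

Lemma dot_sum n (K : knapsack n) w : size w = n ->
  (\sum_(i < n | nth false w i) tnth (weights K) i)%R = dot w (weights K).
Proof.
move=> sw; have -> : (\sum_(i < n | nth false w i) tnth (weights K) i)%R =
    (\sum_(i < n) if nth false w i then nth 0 (weights K) i else 0)%R.
  by rewrite big_mkcond; apply: eq_bigr => i _; rewrite (tnth_nth 0%R).
have := size_tuple (weights K); move: (tval (weights K)) => l.
rewrite -{}sw; elim: w l => [|x w IH] [|y l] //=; first by rewrite big_ord0.
by move=> [sl]; rewrite big_ord_recl /= -IH.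
Qed.

Lemma knapsack_generable :
  generable g enc_knapsack (fun n (K : knapsack n) s => feasible K s).
Proof.
apply: (@tree_generable R g _ _ _ false false false knapsack_init knapsack_test
   knapsack_par (fun n (K : knapsack n) w => (dot w (weights K) <= capacity K)%R)) => //.
move=> n K n0 _; have sK := size_tuple (weights K); split.
- move=> st hv ha hi hb; rewrite run_seq (run_rd 1 hi) run_seq run_asn.
  set s1 := setv _ _.
  have [||||||h1 h2 _ h4] := @read_loopP false s1 n n (weights K ++ values K).
  + by rewrite /= hv.
  + by rewrite /= hv.
  + by [].
  + by rewrite minnn size_cat sK leq_addr.
  + by rewrite /= ha.
  + by rewrite /= hb.
  split=> //; split=> [|i hn]; first by rewrite h2.
  by rewrite h4 minnn hn /= nth_cat sK hn.
- by move=> w sw; rewrite /feasible /= dot_sum.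
- move=> a b v sz'; have sz := etrans sz' (esym sK); apply: le_trans.
  have := weights_noninc K; have := weights_ge0 K.
  elim: a {sz'} (tval (weights K)) sz => [|a IH] [|y l] //=.
    case: l => [|z l] //= _ /and3P [y0 z0 _] /andP [zy _].
    by rewrite add0r addrA lerD2r; case: b; rewrite ?addr0 // lerDr.
  by move=> [sz] /andP [_ l0] ls; rewrite !add0r IH //; apply: path_sorted ls.
move=> st w sw h0 [h1 hf] hw _; rewrite /knapsack_test run_seq.
set s1 := run (Asn _ _) _; rewrite run_seq; set c := If _ _ _.
have h8 : var (run (For 9 c) s1) 8 = dot w (weights K).
  apply: (@loop_left c 9 s1 w _ _ _ _ (fun u f => f 8 = dot u (weights K))) => //.
    by rewrite sw.
  move=> x u st' pu hk h0' ha hx hb h8; rewrite /c !runE hb.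
  have un : size u < n by rewrite -sw; have := size_prefix pu; rewrite size_rcons.
  rewrite dot_rcons ?sK //; case: x {pu hb} => /=; last by rewrite h8 addr0.
  by rewrite h8 hk /= ha hf.
by rewrite run_asn /= h8 run_var //= h1; apply/idP/idP; lia.
Qed.

End Params.

(** * Dyck words *)

Section Counting.

Variables (R : realType) (g : nat -> R).
Hypothesis g_ge : forall n, 0 < n -> (n%:R <= g n)%R.

(** Stated for the complement, where the 1s are the 0s of the Dyck word: moving 1s to the right then
    preserves the condition. *)
Definition dyck_at (k : nat) (w : seq bool) : bool :=
  weight w <= (k - 1) * (size w - weight w).

Definition dyck_prefixes (k : nat) (w : seq bool) : bool :=
  all (fun l => dyck_at k (take l w)) (iota 0 (size w).+1).

Lemma dyck_prefixesP k w :
  reflect (forall l, dyck_at k (take l w)) (dyck_prefixes k w).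
Proof.
apply: (iffP allP) => h l; last by [].
case: (ltnP l (size w).+1) => lw; first by apply: h; rewrite mem_iota add0n.
rewrite take_oversize ?(ltnW lw) // -[w]take_size; apply: h.
by rewrite mem_iota add0n /=.
Qed.

Lemma dyck_prefixes_rcons k u x :
  dyck_prefixes k (rcons u x) = dyck_prefixes k u && dyck_at k (rcons u x).
Proof.
have e : iota 0 (size u).+2 = rcons (iota 0 (size u).+1) (size u).+1.
  by rewrite -[(size u).+2]addn1 iotaD cats1.
rewrite /dyck_prefixes size_rcons e all_rcons andbC take_oversize ?size_rcons //.
congr (_ && _).
apply: eq_in_all => l; rewrite mem_iota add0n => /= lu.
by rewrite -cats1 takel_cat.
Qed.

Definition dyck_test : cmd :=
  Seq (Asn 7 (EC 1%R)) (Seq (Asn 8 (EC 0%R))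
  (Seq (If (EV 1) (Asn 10 (ES (EV 1) (EC 1%R))) (Asn 10 (EC 0%R)))
  (For 9 (Seq
    (If (bit false 9) (Asn 8 (ES (EV 8) (EC 1%R))) (Asn 8 (EA (EV 8) (EV 10))))
    (If (ES (EC 0%R) (EV 8)) (Asn 7 (EC 0%R)) nop))))).

Lemma weight_rcons u x : weight (rcons u x) = weight u + x.
Proof. by rewrite /weight -cats1 count_cat /=; case: x; lia. Qed.

Lemma dyck_test_spec n k :
  test_spec dyck_test n (dyck_prefixes k) (fun v _ _ => v = Posz k).
Proof.
move=> st w sz h0 h1 hw _; rewrite /dyck_test run_seq run_seq run_seq.
set s1 := run (If _ _ _) _; set c := Seq _ _.
have [e0 e7 e8 ea] : [/\ var s1 0 = Posz n, var s1 7 = 1%R, var s1 8 = 0%R &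
    arr s1 = arr st].
  by rewrite /s1 run_if; case: ifP.
have e10 : var s1 10 = Posz (k - 1).
  by rewrite /s1 run_if /= h1; case: ifP => /= hk; rewrite ?h1; lia.
pose Inv u (f : nat -> int) := [/\ (0 < f 7)%R = dyck_prefixes k u,
   f 8 = (Posz ((k - 1) * (size u - weight u)) - Posz (weight u))%R &
   f 10 = Posz (k - 1)].
have [] : Inv w (var (run (For 9 c) s1)); last by [].
apply: loop_left => //; rewrite ?sz ?ea //.
  by split; rewrite /= ?e7 // ?e8 /= ?muln0.
move=> x u st' _ _ _ _ _ hb [i7 i8 i10]; rewrite /c run_seq.
set s2 := run (If (bit _ _) _ _) _.
have [f7 f8 f10] : [/\ var s2 7 = var st' 7, var s2 8 =
    (Posz ((k - 1) * (size (rcons u x) - weight (rcons u x))) -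
       Posz (weight (rcons u x)))%R & var s2 10 = var st' 10].
  have wu := weight_size u; rewrite size_rcons weight_rcons.
  rewrite /s2 run_if hb; case: x {hb} => /=; rewrite i8; split=> //.
    by rewrite addn1 subSS; lia.
  by rewrite i10 addn0 subSn // mulnS; lia.
have d : (0 < 0 - var s2 8)%R = ~~ dyck_at k (rcons u x).
  by rewrite /dyck_at f8; move: ((k - 1) * _) => p; apply/idP/idP; lia.
rewrite /Inv dyck_prefixes_rcons -i7 run_if [eval _ _]/= d.
by case: (dyck_at k _) => /=; split; rewrite ?f7 ?f8 ?f10 ?i10 ?andbT ?andbF.
Qed.

(** No prefix gains a 1 by the shift. *)
Lemma dyck_shift n k : shift_closed n (dyck_prefixes k).
Proof.
move=> a b v _ /dyck_prefixesP h; apply/dyck_prefixesP => l.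
have {h} := h l; rewrite /dyck_at !size_take !size_cat /= !size_nseq.
set u := take l _; set u' := take l _.
suff : weight u' <= weight u.
  move=> le /(leq_trans le) h; apply: leq_trans h _.
  by rewrite leq_mul2l leq_sub2l ?orbT.
rewrite /u /u' !take_cat size_nseq; case: ltnP => // al.
rewrite /weight !count_cat leq_add2l.
by case: (l - a) => //= -[|m]; rewrite /= ?take0 //; case: (b).
Qed.

Lemma weight_nseq m b : weight (nseq m b) = b * m.
Proof. by rewrite /weight count_nseq; case: b. Qed.

Lemma weight_take_zeros m r : weight (take m (nseq r false)) = 0.
Proof. by elim: r m => [|r IH] [|m] //=; rewrite /weight /= -/(weight _) IH. Qed.

Lemma count_false (w : seq bool) : count_mem false w = size w - weight w.
Proof.
rewrite /weight -(count_predC (pred1 true) w) addKn.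
by apply: eq_count => -[].
Qed.

Lemma dyck_generable :
  generable g enc_nat (fun _ k s => dyck_left_factor k s).
Proof.
apply: (@nat_generable R g g_ge _ false true dyck_test (fun _ => dyck_prefixes)) => //.
- move=> n k w n0 [s0 [ss0 [d0 [[t0 [sd0 _ _ _]] pd0]]]] sw.
  (* For [k = 0] all Dyck words are empty, and so is the set of left factors of length [n > 0]. *)
  have k0 : 0 < k.
    have := size_prefix pd0; rewrite ss0 sd0; case: (k) => //.
    by rewrite muln0; lia.
  rewrite /word_map; split=> [[d [[t [sd _ _ hd]] pd]]|/dyck_prefixesP h].
    apply/dyck_prefixesP => l; have := hd (take l (compl w)).
    rewrite -(cat_take_drop l (compl w)) in pd.
    have -> : prefix (take l (compl w)) d.
      by apply: prefix_trans pd; rewrite prefix_prefix.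
    rewrite count_false -/(weight _) -map_take -/(compl _) weight_compl size_map.
    by rewrite subKn ?weight_size // mulnC => /(_ isT); rewrite mulnC.
  (* The left factor [compl w] has [c] letters 1; [r] is the number of 0s that completes it to a
     Dyck word of length [c * k]. *)
  set c := n - weight w; set r := (k - 1) * c - weight w.
  have hw := h n; rewrite take_oversize ?sw // /dyck_at sw -/c in hw.
  have wn := weight_size w; rewrite sw in wn.
  have wc : weight (compl w) = c by rewrite weight_compl sw.
  exists (compl w ++ nseq r false); split; last exact: prefix_prefix.
  have ek : (k - 1).+1 = k by lia.
  have wcr : weight (compl w ++ nseq r false) = c.
    by rewrite /weight count_cat -/(weight _) wc count_nseq addn0.
  have scr : size (compl w ++ nseq r false) = c * k.
    rewrite size_cat size_map size_nseq sw /r -{2}ek mulnS (mulnC c).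
    by rewrite /c in hw *; lia.
  exists c; split=> //.
    by rewrite count_false wcr scr -{1}ek mulnS addKn.
  move=> u /prefixP [u' E].
  rewrite count_false -/(weight _).
  have uE : u = take (size u) (compl w ++ nseq r false) by rewrite E take_size_cat.
  move: uE; rewrite take_cat size_map sw; case: ltnP => un uE.
    have := h (size u); rewrite /dyck_at size_takel ?sw; last exact: ltnW.
    have -> : weight u = size u - weight (take (size u) w).
      by rewrite {1}uE -map_take -/(compl _) weight_compl size_takel ?sw // ltnW.
    have := weight_size (take (size u) w); rewrite size_takel ?sw; last exact: ltnW.
    by move=> wle hh; rewrite subKn.
  have -> : weight u = c.
    rewrite uE /weight count_cat -/(weight _) wc.
    by rewrite -/(weight _) weight_take_zeros addn0.
  have : size u <= c * k by rewrite -scr E size_cat leq_addr.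
  have -> : c * k = c + (k - 1) * c by rewrite -[in LHS]ek mulnS (mulnC c).
  by rewrite leq_subLR.
- by move=> n k; apply: dyck_shift.
- by move=> n k _; apply: dyck_test_spec.
Qed.

End Counting.

(** * Inversions and transpositions *)

Section Sorting.

Variables (R : realType) (g : nat -> R).
Hypothesis g_ge : forall n, 0 < n -> (n%:R <= g n)%R.

Fixpoint inv_count (a : bool) (s : seq bool) : nat :=
  if s is x :: s' then (x == ~~ a) * count_mem a s' + inv_count a s' else 0.

Lemma inversionsE a s : inversions a s = inv_count a s.
Proof.
have -> : inversions a s = \sum_(i < size s) \sum_(j < size s)
    ((i < j) && (nth false s i == ~~ a) && (nth false s j == a)).
  rewrite /inversions -sum1_card big_mkcond pair_big /=.
  by apply: eq_bigr => p _; rewrite -topredE /= -andbA; case: ifP.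
elim: s => [|x s IH] /=; first by rewrite big_ord0.
rewrite big_ord_recl big_ord_recl /= add0n; congr (_ + _).
  have -> : count_mem a s = \sum_(j < size s) (nth false s j == a).
    elim: s {IH} => [|y s IH] /=; first by rewrite big_ord0.
    by rewrite big_ord_recl /= IH.
  by rewrite big_distrr; apply: eq_bigr => i _; rewrite /= -mulnb.
rewrite -IH; apply: eq_bigr => i _.
by rewrite big_ord_recl.
Qed.

Lemma inv_count_compl a s : inv_count a (compl s) = inv_count (~~ a) s.
Proof.
elim: s => //= x s ->; congr (_ * _ + _); first by case: x; case: a.
by rewrite count_map; apply: eq_count => y; case: y; case: a.
Qed.

Definition inv_test : cmd :=
  Seq (Asn 8 (EC 0%R)) (Seq (Asn 11 (EC 0%R))
  (Seq (For 9 (If (bit true 9) (Asn 11 (EA (EV 11) (EV 8)))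
                (Asn 8 (EA (EV 8) (EC 1%R)))))
  (Asn 7 (ES (EA (EV 1) (EC 1%R)) (EV 11))))).

Lemma inv_test_spec n k :
  test_spec inv_test n (fun w => inv_count false w <= k) (fun v _ _ => v = Posz k).
Proof.
move=> st w sz h0 h1 hw _; rewrite /inv_test run_seq run_seq.
set s1 := run (Asn _ _) _; rewrite run_seq; set c := If _ _ _.
pose Inv u (f : nat -> int) := f 8 = Posz (size u - weight u) /\
   f 11 = Posz (inv_count false u).
have [_ h11] : Inv w (var (run (For 9 c) s1)).
  apply: loop_right => //; rewrite ?sz //.
  move=> x u st' _ _ _ _ _ _ hb [i8 i11]; have wu := weight_size u.
  rewrite /c run_if hb; case: x {hb}; rewrite /Inv /= /weight /= -/(weight u).
    by rewrite i8 i11 mul1n count_false; split=> //; lia.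
  by rewrite i8 i11 mul0n; split=> //; lia.
by rewrite run_asn /= h11 run_var //= h1; apply/idP/idP; lia.
Qed.

(** The leading 1 passes a 0 or, if [b] is 1, turns into a 0 with no 1 before it; inversions can
    only be lost. *)
Lemma inv_shift n k : shift_closed n (fun w => inv_count false w <= k).
Proof.
move=> a b v _; elim: a => [|a IH] //=.
case: b; rewrite /= !mul1n ?mul0n; lia.
Qed.

Lemma inversions_generable a :
  generable g enc_nat (fun _ k s => (inversions a s <= k)%N).
Proof.
apply: (@nat_generable R g g_ge _ false a inv_test
  (fun _ k w => inv_count false w <= k)) => //.
- move=> n k w n0 _ sw; rewrite inversionsE /word_map.
  by case: a; rewrite ?inv_count_compl.
- by move=> n k; apply: inv_shift.
- by move=> n k _; apply: inv_test_spec.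
Qed.

(* A swap lowers this number by at most 1, and some swap does unless it is 0: it
   is the number of transpositions of [s]. *)
Definition misplaced (a : bool) (s : seq bool) : nat :=
  count_mem (~~ a) (take (count_mem a s) s).

Lemma count_take_set (P : pred bool) s i z x : i < size s ->
  count P (take z (set_nth false s i x)) + (i < z) * P (nth false s i) =
  count P (take z s) + (i < z) * P x.
Proof.
elim: s i z => [|y s IH] [|i] [|z] //= si; first by lia.
by rewrite ltnS -!addnA IH.
Qed.

Lemma swapE s p : p.1 < size s -> p.2 < size s ->
  swap s p = set_nth false (set_nth false s p.1 (nth false s p.2)) p.2
    (nth false s p.1).
Proof.
move=> h1 h2; have sz : size (set_nth false (set_nth false s p.1 (nth false s p.2))
    p.2 (nth false s p.1)) = size s.
  by rewrite !size_set_nth !(maxn_idPr _) // size_set_nth (maxn_idPr _).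
apply: (@eq_from_nth _ false) => [|m]; rewrite size_mkseq ?sz // => ms.
rewrite nth_mkseq // !nth_set_nth /= nth_set_nth /=.
by case: (m =P p.1) => [->|_]; case: eqP => // ->.
Qed.

Lemma size_swap s p : size (swap s p) = size s.
Proof. exact: size_mkseq. Qed.

Lemma count_take_swap (P : pred bool) s p z : p.1 < size s -> p.2 < size s ->
  let x := P (nth false s p.1) in let y := P (nth false s p.2) in
  count P (take z (swap s p)) + ((p.1 < z) * x + (p.2 < z) * y) =
  count P (take z s) + ((p.1 < z) * y + (p.2 < z) * x).
Proof.
move=> h1 h2 x y; rewrite swapE //.
have := @count_take_set P s p.1 z (nth false s p.2) h1.
have := @count_take_set P (set_nth false s p.1 (nth false s p.2)) p.2 z
  (nth false s p.1).
rewrite size_set_nth (maxn_idPr h1) => /(_ h2).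
rewrite nth_set_nth /= if_same -/x -/y; lia.
Qed.

Lemma count_swap (P : pred bool) s p : p.1 < size s -> p.2 < size s ->
  count P (swap s p) = count P s.
Proof.
move=> h1 h2; have := @count_take_swap P s p (size s) h1 h2.
rewrite /= take_oversize ?size_swap // take_size h1 h2; lia.
Qed.

Lemma misplaced_swap a s p : p.1 < size s -> p.2 < size s ->
  misplaced a s <= (misplaced a (swap s p)).+1.
Proof.
move=> h1 h2; have := @count_take_swap (pred1 (~~ a)) s p (count_mem a s) h1 h2.
rewrite /misplaced count_swap //=.
by case: (p.1 < _); case: (p.2 < _); case: (_ == _); case: (_ == _) => /=; lia.
Qed.

Lemma misplaced_sorted a s : sorted_form a s -> misplaced a s = 0.
Proof.
case=> x [y ->]; rewrite /misplaced count_cat !count_nseq /= eqxx mul1n.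
have -> : (~~ a == a) = false by case: a.
rewrite mul0n addn0 take_size_cat ?size_nseq // count_nseq /=.
by have -> : (a == ~~ a) = false by case: a.
Qed.

Lemma sortable_misplaced a s m : sortable_in a s m -> misplaced a s <= m.
Proof.
case=> ps [<- ]; elim: ps s => [|p ps IH] s /=; first by move=> _ /misplaced_sorted ->.
case/andP => /andP [h1 h2] hps hs.
apply: leq_trans (misplaced_swap a h1 h2) _; rewrite ltnS; apply: IH => //.
by rewrite size_swap.
Qed.

Lemma count_neg (a : bool) s : count_mem (~~ a) s + count_mem a s = size s.
Proof.
rewrite -(count_predC (pred1 a) s) addnC; congr (_ + _).
by apply: eq_count => x; case: x; case: a.
Qed.

Lemma misplaced0 a s : misplaced a s = 0 -> sorted_form a s.
Proof.
move=> h; set z := count_mem a s.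
have zs : z <= size s by apply: count_size.
have e1 : count_mem a (take z s) = z.
  have := count_neg a (take z s); rewrite -/(misplaced a s) h add0n.
  by rewrite size_takel.
have e2 : count_mem a (drop z s) = 0.
  have : count_mem a (take z s) + count_mem a (drop z s) = z.
    by rewrite -count_cat cat_take_drop.
  by rewrite e1; lia.
exists z, (size s - z); rewrite -[LHS](cat_take_drop z); congr (_ ++ _).
  rewrite -{2}e1; apply/esym; have /all_pred1P : all (pred1 a) (take z s).
    by rewrite all_count e1 size_takel.
  by rewrite size_takel // e1 => <-.
rewrite -size_drop; apply/all_pred1P; rewrite all_count.
by have := count_neg a (drop z s); rewrite e2 addn0 => ->.
Qed.

(** If one of the first [z] letters is not [a], then, as [a] occurs [z] times, some [a] lies beyond
    them; exchanging the two lowers the number by one. *)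
Lemma misplaced_sortable a s : sortable_in a s (misplaced a s).
Proof.
move: {2}(misplaced a s) (erefl (misplaced a s)) => h.
elim: h s => [|h IH] s hs; first by exists [::]; rewrite hs; split=> //; apply: misplaced0.
set z := count_mem a s.
have zs : z <= size s by apply: count_size.
have /hasP [x xt /eqP xa] : has (pred1 (~~ a)) (take z s).
  by rewrite has_count -/(misplaced a s) hs.
have h1 : count_mem a (take z s) + count_mem a (drop z s) = z.
  by rewrite -count_cat cat_take_drop.
have h2 := count_neg a (take z s).
have /hasP [y yt /eqP ya] : has (pred1 a) (drop z s).
  rewrite has_count; move: h2; rewrite -/(misplaced a s) hs size_takel // => h2.
  lia.
pose i := index x (take z s); pose j := z + index y (drop z s).
have iz : i < z by rewrite -index_mem size_takel // in xt.
have js : j < size s.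
  by rewrite -ltn_subRL -size_drop index_mem.
have si : nth false s i = ~~ a.
  by rewrite -xa -(nth_index false xt) nth_take.
have sj : nth false s j = a.
  by rewrite -[RHS]ya -(nth_index false yt) nth_drop.
have is_ : i < size s by apply: leq_trans zs.
have hsw : misplaced a (swap s (i, j)) = h.
  have := @count_take_swap (pred1 (~~ a)) s (i, j) z is_ js.
  rewrite /= si sj iz eqxx ltnNge leq_addr /= /misplaced count_swap //= -/z.
  rewrite -/(misplaced a s) hs.
  have -> : (a == ~~ a) = false by case: (a).
  by move: (count_mem _ _) => q /=; lia.
have [ps [sps aps fps]] := IH _ hsw.
exists ((i, j) :: ps); split=> //=; first by rewrite sps hsw hs.
by rewrite is_ js /=; rewrite size_swap in aps.
Qed.

Lemma transpositionsP a s k :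
  (exists m, transpositions a s m /\ m <= k) <-> misplaced a s <= k.
Proof.
split=> [[m [[h1 h2] mk]]|h].
  by apply: leq_trans mk; apply: sortable_misplaced.
exists (misplaced a s); split=> //; split; first exact: misplaced_sortable.
by move=> m; apply: sortable_misplaced.
Qed.

Lemma misplaced_compl a s : misplaced a (compl s) = misplaced (~~ a) s.
Proof.
have h b u : count_mem b (compl u) = count_mem (~~ b) u.
  by rewrite count_map; apply: eq_count => x; case: x; case: b.
by rewrite /misplaced h -map_take -/(compl _) h.
Qed.

Definition trans_test : cmd :=
  Seq (Asn 8 (EC 0%R))
  (Seq (For 9 (Asn 8 (EA (EV 8) (bit false 9))))
  (Seq (Asn 10 (ES (EV 0) (EV 8))) (Seq (Asn 11 (EC 0%R))
  (Seq (For 9 (If (ES (EV 10) (EV 9)) (Asn 11 (EA (EV 11) (bit false 9))) nop))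
  (Asn 7 (ES (EA (EV 1) (EC 1%R)) (EV 11))))))).

Lemma weight_loop st w : holds_word (arr st false) w -> var st 0 = Posz (size w) ->
  var st 8 = 0%R ->
  var (run (For 9 (Asn 8 (EA (EV 8) (bit false 9)))) st) 8 = Posz (weight w).
Proof.
move=> hw h0 h8.
apply: (@loop_left _ 9 st w _ _ _ _ (fun u f => f 8 = Posz (weight u))) => //.
move=> x u st' _ _ _ _ _ hb; rewrite run_asn /= in hb * => ->.
by rewrite hb weight_rcons; lia.
Qed.

Lemma trans_test_spec n k :
  test_spec trans_test n (fun w => misplaced false w <= k) (fun v _ _ => v = Posz k).
Proof.
move=> st w sz h0 h1 hw _; rewrite /trans_test run_seq run_seq.
set s1 := run (For _ _) _.
have h8 : var s1 8 = Posz (weight w) by apply: weight_loop; rewrite //= h0 sz.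
have ha : arr s1 = arr st by apply: run_no_put.
have hv x : x \in [:: 0; 1] -> var s1 x = var st x.
  by rewrite !inE => /orP [] /eqP ->; rewrite /s1 run_var.
clearbody s1; rewrite run_seq run_seq; set s2 := run (Asn 11 _) _.
rewrite run_seq; set c := If _ _ _; set z := size w - weight w.
have wz : weight w <= size w by apply: weight_size.
have e10 : var s2 10 = Posz z by rewrite /s2 !runE /= h8 hv // h0 /z; lia.
have e0 : var s2 0 = Posz (size w) by rewrite /s2 !runE /= hv // h0 sz.
have [_ h11] : var (run (For 9 c) s2) 10 = Posz z /\
    var (run (For 9 c) s2) 11 = Posz (weight (take (minn (size w) z) w)).
  apply: (@loop_ind c 9 s2 w _ _ _ (fun k f => f 10 = Posz z /\
    f 11 = Posz (weight (take (minn k z) w)))) => //.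
    by rewrite /= min0n take0.
  move=> l st' lw hl h0' ha' hx [i10 i11].
  have hb : eval st' (bit false 9) = Posz (nth false w l).
    by rewrite (@bitE false st' w 9 l) ?ha' ?ha.
  rewrite /c run_if [eval _ (ES _ _)]/= i10 hl.
  have [zl|lz] : z <= l \/ l < z by lia.
    have -> : (0 < Posz z - Posz l)%R = false by lia.
    rewrite /= i10 i11 (minn_idPr zl).
    by have -> : minn l.+1 z = z by apply/minn_idPr/leqW.
  have -> : (0 < Posz z - Posz l)%R by lia.
  rewrite run_asn /= in hb *; rewrite hb i10 i11 (minn_idPl (ltnW lz)) (minn_idPl lz).
  by rewrite (take_nth false) // weight_rcons; split=> //; lia.
have -> : misplaced false w = weight (take (minn (size w) z) w).
  by rewrite /misplaced count_false -/z (minn_idPr (leq_subr _ _)).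
by rewrite run_asn /= h11 run_var //= hv // h1; apply/idP/idP; lia.
Qed.

(** The 1s are counted in a window as long as the number of 0s. For [b = 0] the window is unchanged
    and a 1 moves right. For [b = 1] the window grows by one letter, which is offset by the 1 that
    disappears ([mono]). *)
Lemma trans_shift n k : shift_closed n (fun w => misplaced false w <= k).
Proof.
move=> a b v _; apply: leq_trans; rewrite /misplaced !count_cat !count_nseq /= mul1n.
rewrite add0n !take_cat size_nseq !ltnNge !leq_addr /= !addKn !count_cat leq_add2l.
set zv := count_mem false v.
have mono m : count_mem true (take m.+1 v) <= (count_mem true (take m v)).+1.
  case: (ltnP m (size v)) => mv; last by rewrite !take_oversize // leqW.
  by rewrite (take_nth false) // -cats1 count_cat /=; case: nth; lia.
case: b => /=; rewrite ?add0n ?add1n /=.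
  have [z0|z0] : zv = 0 \/ 0 < zv by lia.
    by rewrite z0 /=.
  case: zv z0 => [//|m] _ /=.
  by case: m => [|m] /=; rewrite ?take0 //= !add1n ltnS mono.
by case: zv => [|m] //=; rewrite ?take0.
Qed.

Lemma transpositions_generable a :
  generable g enc_nat (fun _ k s => exists m, transpositions a s m /\ (m <= k)%N).
Proof.
apply: (@nat_generable R g g_ge _ false a trans_test
  (fun _ k w => misplaced false w <= k)) => //.
- move=> n k w n0 _ sw; rewrite transpositionsP /word_map.
  by case: a; rewrite ?misplaced_compl.
- by move=> n k; apply: trans_shift.
- by move=> n k _; apply: trans_test_spec.
Qed.

End Sorting.

(** * Comparison with the reversal *)

Lemma lexltP s t : size s = size t ->
  lexlt s t <-> exists k, [/\ k < size s, nth false s k = false,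
    nth false t k = true & forall i, i < k -> nth false s i = nth false t i].
Proof.
elim: s t => [|x s IH] [|y t] //= => [_|[st]]; first by split=> // -[k []].
have {}IH := IH t st; have -> : lexlt (x :: s) (y :: t) =
   (~~ x && y) || ((x == y) && lexlt s t) by apply: (@lex_cons true).
split=> [/orP [/andP [/negbTE hx hy]|/andP [/eqP xy /IH [k [ks h1 h2 h3]]]]|].
- by exists 0; rewrite hx hy.
- by exists k.+1; split=> // -[|i] //= ik; apply: h3.
case=> -[|k] /= [ks h1 h2 h3]; first by rewrite h1 h2.
have xy := h3 0 isT; rewrite /= in xy; rewrite xy eqxx /=.
have -> : lexlt s t by apply/IH; exists k; split=> // i ik; apply: (h3 i.+1).
by rewrite orbT.
Qed.

Lemma lexle_eqVlt s t : lexle s t = (s == t) || lexlt s t.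
Proof. exact: le_eqVlt. Qed.

Lemma lexltNge s t : lexlt s t = ~~ lexle t s.
Proof. exact: ltNge. Qed.

Lemma lexltW s t : lexlt s t -> lexle s t.
Proof. exact: ltW. Qed.

Section Shift.

Variables (a : nat) (b : bool) (v : seq bool).
Let n := a + (size v).+2.
Let w := nseq a false ++ true :: b :: v.
Let w' := nseq a false ++ false :: true :: v.

Lemma size_shift : size w = n /\ size w' = n.
Proof. by rewrite /w /w' !size_cat !size_nseq. Qed.

Lemma shift_nth i : nth false w' i = (i == a.+1) || ((a < i) && nth false w i).
Proof.
rewrite /w /w' !nth_cat size_nseq; case: (ltngtP i a) => [ia|ai|->].
- by rewrite nth_nseq ia; case: eqP => // h; lia.
- have -> : i - a = (i - a.+1).+1 by lia.
  case: (i =P a.+1) => [->|h]; first by rewrite subnn.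
  by have -> : i - a.+1 = (i - a.+2).+1 by lia.
- by rewrite subnn ltn_eqF.
Qed.

Lemma shift_low i : i < a -> nth false w i = false.
Proof. by move=> ia; rewrite /w nth_cat size_nseq ia nth_nseq ia. Qed.

Lemma shift_at : nth false w a = true.
Proof. by rewrite /w nth_cat size_nseq ltnn subnn. Qed.

Lemma shift_low' i : i <= a -> nth false w' i = false.
Proof. by move=> ia; rewrite shift_nth ltnNge ia; case: eqP => // h; lia. Qed.

Lemma shift_high i : a.+1 < i -> nth false w' i = nth false w i.
Proof. by move=> ia; rewrite shift_nth (ltnW ia) gtn_eqF. Qed.

(** [w <= rev w] forces at most [a] trailing 0s. After the shift there are [a + 1] leading 0s and
    still at most [a] at the end, so the comparison is strict in any case. *)
Lemma rev_shift : lexle w (rev w) -> lexlt w' (rev w').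
Proof.
have [sw sw'] := size_shift.
have nr u i : size u = n -> i < n -> nth false (rev u) i = nth false u (n - i.+1).
  by move=> su iu; rewrite nth_rev su.
move=> h; have [k [kn hk hi]] : exists k, [/\ k <= n,
    k < n -> nth false w k = false /\ nth false w (n - k.+1) = true
    & forall i, i < k -> nth false w i = nth false w (n - i.+1)].
  move: h; rewrite lexle_eqVlt => /orP [/eqP e|].
    exists n; split=> [|/negPn|i ni]; rewrite ?ltnn //.
    by rewrite {1}e nr.
  case/lexltP => [|k [ks h1 h2 h3]]; first by rewrite size_rev.
  rewrite sw in ks; exists k; split=> [|_|i ik]; first exact: ltnW.
    by rewrite -nr.
  by rewrite h3 // nr //; apply: ltn_trans ks.
(* [c] turns out to be the number of trailing 0s of [w]. *)
pose c := minn k a.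
have ca : c <= a by apply: geq_minr.
have an : a.+1 < n by rewrite /n; lia.
have hc : nth false w (n - c.+1) = true.
  rewrite /c; case: (ltngtP k a) => ka.
  - by case: hk => //; apply: ltn_trans ka _; apply: ltnW.
  - by rewrite -hi // shift_at.
  - by case: hk => [|]; rewrite ka ?shift_at //; apply: ltnW.
have low i : i < c -> nth false w (n - i.+1) = false.
  move=> ic; rewrite -hi; first by rewrite shift_low // (leq_trans ic).
  by apply: leq_trans ic _; apply: geq_minl.
have hac : a <= n - c.+1.
  by rewrite leqNgt; apply/negP => /shift_low; rewrite hc.
apply/lexltP; first by rewrite size_rev.
(* In the first case the only 1 of [w] is the one that moves, and [c - 1] trailing 0s are left. *)
rewrite sw'; have [e|ne] := eqVneq (n - c.+1) a.
  have c0 : 0 < c by lia.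
  exists c.-1; split; first by lia.
  - by rewrite shift_low' //; lia.
  - by rewrite nr ?shift_nth //; [apply/orP; left; apply/eqP; lia | lia].
  move=> i ic; rewrite shift_low' ?nr ?shift_high ?low //; lia.
have hac' : a < n - c.+1 by rewrite ltn_neqAle eq_sym ne.
exists c; split; first by lia.
- by rewrite shift_low'.
- by rewrite nr ?shift_nth ?hac' ?hc ?orbT //; lia.
move=> i ic; rewrite shift_low' ?nr ?shift_high ?low //; lia.
Qed.

Lemma nth_crev u i : size u = n -> i < n ->
  nth false (crev u) i = ~~ nth false u (n - i.+1).
Proof.
by move=> su iu; rewrite (nth_map false) ?size_rev ?su // nth_rev su.
Qed.

Lemma size_crev u : size (crev u) = size u.
Proof. by rewrite size_map size_rev. Qed.

(** If one of the last [a + 1] letters of [w'] is 0, the last such letter decides strictly.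
    Otherwise the hypothesis at position [a] forces [w' = 0^(a+1) 1^(a+1)], which is its own
    complemented reversal; a strict hypothesis rules this out. *)
Lemma crev_shift strict : lex strict w (crev w) -> lex strict w' (crev w').
Proof.
have [sw sw'] := size_shift.
have an : a.+1 < n by rewrite /n; lia.
move=> h; have [k [kn ks hk hi]] : exists k, [/\ k <= n, strict -> k < n,
    k < n -> nth false w k = false /\ nth false w (n - k.+1) = false
    & forall i, i < k -> nth false w i = ~~ nth false w (n - i.+1)].
  have : w = crev w /\ ~~ strict \/ lexlt w (crev w).
    move: h; rewrite /lex; case: (strict) => [->|]; first by right.
    by rewrite lexle_eqVlt => /orP [/eqP e|e]; [left|right].
  case=> [[e ns]|].
    exists n; split=> [|hs|/negPn|i ni]; rewrite ?ltnn //.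
      by rewrite hs in ns.
    by rewrite {1}e nth_crev.
  case/lexltP => [|k [ks h1 h2 h3]]; first by rewrite size_crev.
  rewrite sw in ks; exists k; split=> [|_|_|i ik] //; first exact: ltnW.
    by rewrite nth_crev // in h2; split=> //; apply/negbTE.
  by rewrite h3 // nth_crev //; apply: ltn_trans ks.
have [/hasP [j0 j0a hj0]|/hasPn hall] :=
    boolP (has (fun i => ~~ nth false w' (n - i.+1)) (iota 0 a.+1)).
  have ex : exists j, ~~ nth false w' (n - j.+1) by exists j0.
  have [j hj hmin] := ex_minnP ex.
  have ja : j <= a.
    by apply: leq_trans (hmin _ hj0) _; rewrite mem_iota in j0a.
  have lt : lexlt w' (crev w').
    apply/lexltP; rewrite ?size_crev // sw'.
    exists j; split; first by lia.
    - by rewrite shift_low'.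
    - by rewrite nth_crev //; lia.
    move=> i ij; rewrite shift_low' ?nth_crev //; try lia.
    apply/esym/negbF/negPn/negP => /hmin; lia.
  by rewrite /lex; case: (strict); rewrite ?lexltW.
have one i : i <= a -> nth false w' (n - i.+1) = true.
  by move=> ia; apply/negPn/hall; rewrite mem_iota.
have na : a.*2.+2 <= n.
  have := one a (leqnn a); case: (leqP (n - a.+1) a) => [/shift_low' ->//|]; lia.
(* [w] and [crev w] differ at [k] exactly when they differ at [n - 1 - k], so the first difference
   lies in the first half. *)
have nk : k < n -> k <= n - k.+1.
  move=> kn'; rewrite leqNgt; apply/negP => hh.
  have [h1 h2] := hk kn'; have := hi _ hh; rewrite h2.
  by rewrite (_ : n - (n - k.+1).+1 = k) ?h1 //; lia.
have ka : a < k.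
  case: (ltngtP k a) => // [ka|e].
    have kn' : k < n by lia.
    have [_] := hk kn'; rewrite -shift_high ?one //; lia.
  have kn' : k < n by lia.
  by have [] := hk kn'; rewrite e shift_at.
have [en|gn] : n = a.*2.+2 \/ a.*2.+2 < n by lia.
  have ns : ~~ strict.
    by apply/negP => /ks kn'; have := nk kn'; lia.
  have e : w' = crev w'.
    apply: (@eq_from_nth _ false); first by rewrite size_crev.
    move=> i; rewrite sw' => iN; rewrite nth_crev //.
    case: (leqP i a) => ia; first by rewrite shift_low' // one.
    rewrite (shift_low' (i := n - i.+1)); last by lia.
    have -> : nth false w' i = nth false w' (n - (n - i.+1).+1).
      by congr nth; lia.
    by rewrite one //; lia.
  by rewrite /lex (negbTE ns) lexle_eqVlt -e eqxx.
have := hi _ ka; rewrite shift_at -shift_high ?one //; lia.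
Qed.

End Shift.

Section Reversal.

Variables (R : realType) (g : nat -> R).
Hypothesis g_ge : forall n, 0 < n -> (n%:R <= g n)%R.

Definition mirror (c : bool) (s : seq bool) : seq bool :=
  if c then crev s else rev s.

Definition mirror_test (strict c : bool) : cmd :=
  lex_test strict (if c then ES (EC 1%R) (bit false 9) else bit false 9).

Lemma size_mirror c s : size (mirror c s) = size s.
Proof. by case: c; rewrite ?size_crev ?size_rev. Qed.

Lemma mirror_test_spec n strict c :
  test_spec (mirror_test strict c) n (fun w => lex strict w (mirror c w))
    (fun _ _ _ => True).
Proof.
move=> st w sz h0 _ hw _; apply: lex_testP; rewrite ?size_mirror ?sz //.
move=> st' k kn ha h0' h9.
have hb : eval st' (bit false 9) = Posz (nth false w k).
  by rewrite (@bitE false st' w 9 k) ?ha ?sz.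
have nk : n - (n - k.+1).+1 = k by lia.
rewrite /mirror; case: c; last by rewrite hb nth_rev ?sz ?nk //; lia.
rewrite (nth_map false) ?size_rev ?nth_rev ?sz ?nk; try lia.
have -> : eval st' (ES (EC 1%R) (bit false 9)) = (1 - eval st' (bit false 9))%R.
  by [].
by rewrite hb; case: nth.
Qed.

Lemma mirror_shift n strict c :
  shift_closed n (fun w => lex strict w (mirror c w)).
Proof.
move=> a b v _; rewrite /mirror; case: c; first exact: crev_shift.
move=> h; have lt : lexlt (nseq a false ++ false :: true :: v)
    (rev (nseq a false ++ false :: true :: v)).
  apply: (@rev_shift a b); move: h; rewrite /lex; case: (strict) => //.
  exact: lexltW.
by rewrite /lex; case: (strict); rewrite ?lexltW.
Qed.

Lemma mirror_generable strict c (cp : bool)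
    (S : forall n, unit -> seq bool -> Prop) :
  (forall n s, S n tt s <->
     if cp then lex strict (mirror c s) s else lex strict s (mirror c s)) ->
  generable g enc_none S.
Proof.
move=> hS; apply: (@none_generable R g g_ge _ false cp (mirror_test strict c)
  (fun _ w => lex strict w (mirror c w))) => //.
- move=> n w _ sw; rewrite hS /word_map; case: cp {hS} => //.
  have -> : mirror c (compl w) = compl (mirror c w).
    by rewrite /mirror /crev; case: c; rewrite /compl -?map_rev.
  by rewrite lex_compl // size_mirror.
- by move=> n; apply: mirror_shift.
- by move=> n _; apply: mirror_test_spec.
Qed.

End Reversal.

(** * Prefix normal words *)

(* The array holds the word from right to left. *)
Definition suffix_normal (w : seq bool) : bool :=
  all (fun i => all (fun l =>
      weight (take l (drop i w)) <= weight (drop (size w - l) w))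
    (iota 0 (size w).+1)) (iota 0 (size w).+1).

(** A window overhanging the right end is shorter than [l]; as suffix weights increase with the
    length, the Boolean version may admit it. *)
Lemma suffix_normalP w :
  reflect (forall i l, i + l <= size w ->
    weight (take l (drop i w)) <= weight (drop (size w - l) w)) (suffix_normal w).
Proof.
have mono k l : k <= l -> weight (drop (size w - k) w) <= weight (drop (size w - l) w).
  move=> kl; have -> : size w - k = (l - k - (l - size w)) + (size w - l) by lia.
  rewrite -drop_drop; set x := drop _ w.
  by rewrite -{2}(cat_take_drop (l - k - (l - size w)) x) /weight count_cat leq_addl.
apply: (iffP allP) => h i.
  move=> l il.
  have /allP hi : all (fun l => weight (take l (drop i w)) <=
      weight (drop (size w - l) w)) (iota 0 (size w).+1).
    by apply: h; rewrite mem_iota /= add0n ltnS (leq_trans _ il) ?leq_addr.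
  by apply: hi; rewrite mem_iota /= add0n ltnS (leq_trans _ il) ?leq_addl.
rewrite mem_iota add0n ltnS => /andP [_ ile]; apply/allP => l.
rewrite mem_iota add0n ltnS => /andP [_ le].
pose m := minn l (size w - i).
have -> : take l (drop i w) = take m (drop i w).
  rewrite /m; case: (leqP l (size w - i)) => // hl.
  by rewrite !take_oversize ?size_drop // ltnW.
apply: leq_trans (h i m _) (mono _ _ (geq_minl _ _)).
by rewrite /m; lia.
Qed.

Lemma prefix_normalE w : prefix_normal true (rev w) <-> suffix_normal w.
Proof.
have rw u : count_mem true (rev u) = weight u by rewrite count_rev.
split=> [h|/suffix_normalP h u].
  apply/suffix_normalP => i l il.
  have iw : infix (take l (drop i w)) w.
    by apply/infixP; exists (take i w), (drop l (drop i w)); rewrite !cat_take_drop.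
  have := h (rev (take l (drop i w))); rewrite infix_rev => /(_ iw).
  rewrite size_rev size_takel; last first.
    by rewrite size_drop leq_subRL // (leq_trans (leq_addr l i)).
  by rewrite take_rev !rw.
rewrite -[u]revK infix_rev => /infixP [p [q E]].
have e : take (size u) (drop (size p) w) = rev u.
  by rewrite E drop_size_cat // take_size_cat ?size_rev.
have := h (size p) (size u); rewrite e !size_rev take_rev !rw; apply.
by rewrite E !size_cat size_rev leq_add2l leq_addr.
Qed.

(** Variable 10 locates the new 1. The second loop keeps the weights of the window starting there
    and of the suffix of the same length; letters read beyond the word are 0. *)
Definition pn_test : cmd :=
  Seq (Asn 10 (EV 0))
  (Seq (For 9 (If (bit true 9) (Asn 10 (rev_idx 9)) nop))
  (Seq (Asn 7 (EC 1%R)) (Seq (Asn 11 (EC 0%R)) (Seq (Asn 12 (EC 0%R))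
  (For 9 (Seq (Asn 11 (EA (EV 11) (EG false (EA (EV 10) (EV 9)))))
    (Seq (Asn 12 (EA (EV 12) (bit true 9)))
    (If (ES (EV 11) (EV 12)) (Asn 7 (EC 0%R)) nop)))))))).

Lemma weight_takeS k (x : seq bool) :
  weight (take k.+1 x) = weight (take k x) + nth false x k.
Proof.
case: (ltnP k (size x)) => kx; first by rewrite (take_nth false) // weight_rcons.
by rewrite !take_oversize ?leqW // nth_default // addn0.
Qed.

Lemma weight_cons b (x : seq bool) : weight (b :: x) = b + weight x.
Proof. by rewrite /weight /=; case: b. Qed.

Definition last_one_normal (w : seq bool) : bool :=
  all (fun l => weight (take l (drop (index true w) w)) <= weight (drop (size w - l) w))
    (iota 0 (size w).+1).

Lemma pn_test_run st w : var st 0 = Posz (size w) -> holds_word (arr st false) w ->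
  (0 < var (run pn_test st) 7)%R = last_one_normal w.
Proof.
move=> h0 hw; rewrite /pn_test run_seq run_seq.
set s0 := run (Asn _ _) _; set c := If _ _ _; set s1 := run (For _ _) _.
have h10 : var s1 10 = Posz (index true w).
  pose Inv0 u (f : nat -> int) := f 10 = Posz (size w - size u + index true u).
  suff : Inv0 w (var s1) by rewrite /Inv0 subnn.
  apply: loop_right => //; rewrite /Inv0; first by rewrite /= subn0 addn0 h0.
  move=> x u st' uw _ hi h0' ha hx hb i10; rewrite /c run_if hb.
  case: x {hb} => /=; last by rewrite i10 addnS -addSn -subSn // subSS.
  by rewrite h0' hi rev_idxE // addn0.
have ha : arr s1 = arr st by rewrite /s1 run_no_put.
have h01 : var s1 0 = Posz (size w) by rewrite /s1 run_var.
clearbody s1; do 3 rewrite run_seq; set s2 := run (Asn 12 _) _; set c2 := Seq _ _.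
set x := drop (index true w) w.
pose Inv k (f : nat -> int) := [/\ f 11 = Posz (weight (take k x)),
  f 12 = Posz (weight (drop (size w - k) w)), f 10 = Posz (index true w) &
  (0 < f 7)%R = all (fun l => weight (take l x) <= weight (drop (size w - l) w))
    (iota 0 k.+1)].
have [] : Inv (size w) (var (run (For 9 c2) s2)); last by [].
apply: loop_ind => //.
  by rewrite /Inv subn0 drop_size take0; split; rewrite /= ?h10 ?take0.
move=> k st' kw hk h0' ha' hx [i11 i12 i10 i7].
have hb : eval st' (bit true 9) = Posz (nth false w (size w - k.+1)).
  by rewrite (@bitE true st' w 9 k) ?ha' ?ha // nth_rev.
have hg : geti (arr st' false) (var st' 10 + var st' 9)%R = Posz (nth false x k).
  by rewrite i10 hk /= ha' [arr s2]/= ha hw nth_drop.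
have e12 : weight (drop (size w - k.+1) w) =
    weight (drop (size w - k) w) + nth false w (size w - k.+1).
  rewrite (drop_nth false); last by lia.
  by rewrite weight_cons addnC; congr (weight (drop _ w) + _); lia.
have e : iota 0 k.+2 = rcons (iota 0 k.+1) k.+1 by rewrite -[k.+2]addn1 iotaD cats1.
rewrite /Inv e all_rcons weight_takeS e12 /c2 !run_seq !run_asn run_if.
rewrite [eval st' (EA _ _)]/= hg i11.
rewrite [eval _ (EA (EV 12) _)]/= in hb *; rewrite /= in hb *; rewrite hb i12.
have -> : (0 < Posz (weight (take k x)) + Posz (nth false x k) -
    (Posz (weight (drop (size w - k) w)) + Posz (nth false w (size w - k.+1))))%R =
   ~~ (weight (take k x) + nth false x k <=
       weight (drop (size w - k) w) + nth false w (size w - k.+1)).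
  by apply/idP/idP; lia.
case: leqP => _ /=; rewrite i10; split=> //; rewrite ?i7 //.
Qed.

Lemma weight_cat u v : weight (u ++ v) = weight u + weight v.
Proof. exact: count_cat. Qed.

Lemma weight_drop_mono (w : seq bool) m m' : m' <= m ->
  weight (drop m w) <= weight (drop m' w).
Proof.
move=> h; rewrite -(subnK h) -drop_drop.
by rewrite -{2}(cat_take_drop (m - m') (drop m' w)) weight_cat leq_addl.
Qed.

Lemma weight_window (w : seq bool) i l : weight (take l (drop i w)) <= weight w.
Proof.
rewrite -{2}(cat_take_drop i w) weight_cat -{2}(cat_take_drop l (drop i w)) weight_cat.
by rewrite addnCA leq_addr.
Qed.

Lemma weight_take_mono (w : seq bool) l l' : l <= l' ->
  weight (take l w) <= weight (take l' w).
Proof.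
by move=> h; rewrite -(subnKC h) takeD weight_cat leq_addr.
Qed.

Lemma suffix_normal0 m : suffix_normal (nseq m false).
Proof.
apply/suffix_normalP => i l _; apply: leq_trans (weight_window _ _ _) _.
by rewrite weight_nseq.
Qed.

Lemma drop_zeros a b k (v : seq bool) :
  drop (a + k.+1) (nseq a false ++ b :: v) = drop k v.
Proof. by rewrite drop_cat size_nseq ltnNge leq_addr /= addKn. Qed.

(** A window starting right of the new 1 is a window of the parent, whose suffixes are no heavier
    than those of [w]. A window starting left of it begins with 0s and reduces to a shorter one
    starting at the new 1. *)
Lemma last_one_normalE w :
  (forall j v, w = nseq j false ++ true :: v ->
     suffix_normal (nseq j false ++ false :: v)) ->
  last_one_normal w = suffix_normal w.
Proof.
move=> hpar; apply/idP/suffix_normalP => [/allP h i l il|h].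
  have {}h m : m <= size w -> weight (take m (drop (index true w) w)) <=
      weight (drop (size w - m) w).
    by move=> mw; apply: h; rewrite mem_iota /= add0n ltnS.
  case tw : (true \in w); last first.
    have -> : w = nseq (size w) false.
      by apply/all_pred1P/allP => -[] // xw; rewrite xw in tw.
    apply: leq_trans (weight_window _ _ _) _; by rewrite weight_nseq.
  have [j [v wE]] := split_first_true tw.
  have ej : index true w = j by rewrite wE index_nseq.
  rewrite ej in h.
  have sv : size w = j + (size v).+1 by rewrite wE size_cat size_nseq.
  have dj : drop j w = true :: v by rewrite wE drop_size_cat // size_nseq.
  have [ij|ji] := leqP i j; last first.
    have /suffix_normalP hp := hpar _ _ wE.
    have sp : size (nseq j false ++ false :: v) = size w by rewrite sv size_cat size_nseq.
    have ei : i = j + (i - j).-1.+1 by lia.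
    have := hp i l; rewrite sp => /(_ il).
    have -> : take l (drop i (nseq j false ++ false :: v)) = take l (drop i w).
      by rewrite wE ei !drop_zeros.
    move=> /leq_trans; apply; move: (size w - l) => m; rewrite wE.
    have [hl|hl] := leqP m j.
      rewrite !drop_cat !size_nseq; case: ltnP => hh.
        by rewrite !weight_cat leq_add2l !weight_cons.
      have -> : m - j = 0 by lia.
      by rewrite !drop0 !weight_cons.
    have -> : m = j + (m - j).-1.+1 by lia.
    by rewrite !drop_zeros.
  have e : drop i w = nseq (j - i) false ++ drop j w.
    rewrite dj {1}wE drop_cat size_nseq; case: ltnP => hh; first by rewrite drop_nseq.
    have -> : i = j by lia.
    by rewrite subnn drop0.
  rewrite e take_cat size_nseq; case: ltnP => hl.
    by rewrite take_nseq ?weight_nseq ?mul0n // ltnW.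
  rewrite weight_cat weight_nseq mul0n add0n.
  apply: leq_trans (h _ _) _; first by lia.
  by apply: weight_drop_mono; lia.
apply/allP => l; rewrite mem_iota add0n ltnS => /andP [_ lw].
have [hl|hl] := leqP (index true w + l) (size w); first exact: h.
rewrite take_oversize; last by rewrite size_drop; lia.
by apply: weight_drop_mono; lia.
Qed.

Lemma weight_window_zeros a b i l (v : seq bool) : i <= a ->
  weight (take l (drop i (nseq a false ++ b :: v))) =
  weight (take (l - (a - i)) (b :: v)).
Proof.
move=> ia; rewrite drop_cat size_nseq; case: ltnP => hi.
  rewrite drop_nseq take_cat size_nseq; case: ltnP => hl.
    by rewrite take_nseq ?weight_nseq ?(ltnW hl) // (eqP (ltnW hl)) take0.
  by rewrite weight_cat weight_nseq.
have -> : i = a by lia.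
by rewrite subnn drop0 subn0.
Qed.

Lemma suffix_normal_closed n : left_closed n suffix_normal.
Proof.
split; [|split].
- move=> a y sz /suffix_normalP h; apply/suffix_normalP => i l.
  have s1 b : size (nseq a false ++ b :: y) = n by rewrite size_cat size_nseq.
  rewrite s1 => il; have := h i l; rewrite s1 => /(_ il) {}h.
  have [ly|yl] := leqP l (size y).
    have e : n - l = a + (size y - l).+1 by lia.
    move: h; rewrite e !drop_zeros; apply: leq_trans.
    have [ia|ai] := leqP i a.
      by rewrite !weight_window_zeros //; case: (l - _) => // m; rewrite !weight_cons.
    have -> : i = a + (i - a).-1.+1 by lia.
    by rewrite !drop_zeros.
  (* A suffix longer than [y] contains all 1s that are left. *)
  apply: leq_trans (weight_window _ _ _) _.
  rewrite drop_cat size_nseq; case: ltnP => hh.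
    by rewrite drop_nseq !weight_cat !weight_nseq.
  have -> : n - l - a = 0 by lia.
  by rewrite drop0 weight_cat weight_nseq.
- move=> a y sz y0 /suffix_normalP h; apply/suffix_normalP => i l.
  have s1 b c : size (nseq a false ++ b :: c :: y) = n by rewrite size_cat size_nseq.
  rewrite s1 => il.
  (* The 1 at [a + 1] is a window of length 1, so [y] ends with 1. *)
  have yl : 0 < weight (drop (size y - 1) y).
    have hn : a.+1 + 1 <= n by lia.
    have := h a.+1 1; rewrite s1 nseq_shift => /(_ hn).
    rewrite drop_size_cat ?size_nseq //= take0 => /leq_trans; apply.
    have -> : n - 1 = a.+1 + (size y - 1).+1 by lia.
    by rewrite drop_zeros.
  have hw j m : j + m <= n -> m <= size y ->
      weight (take m (drop j (nseq a false ++ false :: true :: y))) <=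
      weight (drop (size y - m) y).
    move=> jm my; have := h j m; rewrite s1 => /(_ jm) /leq_trans; apply.
    have -> : n - m = a.+1 + (size y - m).+1 by lia.
    by rewrite nseq_shift drop_zeros.
  have win m : m <= size y -> i + m <= n ->
      weight (take m (drop i (nseq a false ++ true :: false :: y))) <=
      weight (drop (size y - m) y) .
    move=> my im'.
    (* For [i <= a] the comparison is with the window of the old word that starts one position
       further right. *)
    have [ia|ai] := leqP i a.
      have [->|m0] := posnP m; first by rewrite take0.
      have im : i.+1 + m <= n by lia.
      apply: (leq_trans _ (hw _ _ im my)).
      rewrite nseq_shift !weight_window_zeros ?ltnS // subSS.
      case: (m - _) => [|k]; first by rewrite !take0.
      rewrite -[take k.+1 _]/(true :: take k (false :: y)).
      rewrite -[take k.+1 (true :: y)]/(true :: take k y) !weight_cons leq_add2l.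
      case: k => [|k]; first by rewrite !take0.
      rewrite -[take k.+1 _]/(false :: take k y) weight_cons add0n.
      exact: weight_take_mono.
    have [e|ne] := eqVneq i a.+1; last first.
      have im : i + m <= n by lia.
      apply: (leq_trans _ (hw _ _ im my)).
      have -> : i = a + (i - a).-1.+1 by lia.
      rewrite !drop_zeros; have -> : (i - a).-1 = (i - a).-2.+1 by lia.
      by [].
    have im : i + m <= n by lia.
      apply: (leq_trans _ (hw _ _ im my)).
    rewrite e -addn1 !drop_zeros !drop0.
    case: (m) => [|k]; first by rewrite !take0.
    rewrite -[take k.+1 _]/(false :: take k y).
    by rewrite -[take k.+1 (true :: y)]/(true :: take k y) !weight_cons.
  have [ly|ly] := leqP l (size y).
    have -> : n - l = a + (size y - l).+2 by lia.
    by rewrite drop_zeros; apply: win.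
  have [la|al] := leqP (n - l) a.
    apply: leq_trans (weight_window _ _ _) _.
    rewrite drop_cat size_nseq; case: ltnP => hh.
      by rewrite drop_nseq !weight_cat !weight_nseq.
    have -> : n - l - a = 0 by lia.
    by rewrite drop0 weight_cat weight_nseq.
  (* The critical length is [size y + 1]: the suffix no longer contains the moved 1, but a window of
     this length containing it misses the last letter of [y], which is a 1. *)
  have el : n - l = a + 1 by lia.
  rewrite el drop_zeros drop0 weight_cons add0n.
  have [ai|ia] := ltnP a i.
    have -> : i = a + (i - a).-1.+1 by lia.
    rewrite drop_zeros; apply: leq_trans (weight_window _ _ _) _.
    by rewrite weight_cons.
  rewrite weight_window_zeros //.
  have {}ly : l = (size y).+1 by lia.
  have le : l - (a - i) <= (size y).+1 by lia.
  apply: leq_trans (weight_take_mono _ le) _.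
  rewrite -[take _.+1 _]/(true :: take (size y) (false :: y)) weight_cons.
  have -> : take (size y) (false :: y) = false :: take (size y - 1) y.
    by case: (size y) y0 => // m _; rewrite subn1.
  rewrite weight_cons add0n -[X in _ <= weight X](cat_take_drop (size y - 1)).
  rewrite weight_cat.
  by rewrite addnC leq_add2l.
- move=> s sz /suffix_normalP h ts.
  have is_ : index true s < size s by rewrite index_mem.
  have := h (index true s) 1; rewrite addn1 => /(_ is_).
  rewrite (drop_nth false is_) nth_index // /= take0 subn1 sz => ht.
  by rewrite -has_pred1 has_count; apply: ht.
Qed.

Lemma pn_test_spec n :
  test_spec pn_test n suffix_normal (fun _ _ _ => True).
Proof.
move=> st w sw h0 _ hw hpar; rewrite (@pn_test_run st w) ?sw //.
apply: last_one_normalE => j v /hpar [] // ->; exact: suffix_normal0.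
Qed.

Lemma prefix_normal_compl s : prefix_normal false (compl s) <-> prefix_normal true s.
Proof.
have cc b u : count_mem b (compl u) = count_mem (~~ b) u.
  by rewrite count_map; apply: eq_count => x; case: x; case: b.
split=> h u.
  rewrite -(infix_compl u) => /h; rewrite size_map cc -map_take -/(compl _) cc.
  by [].
move=> hu; have := h (compl u); rewrite -infix_compl complK => /(_ hu).
by rewrite cc size_map -map_take -/(compl _) cc.
Qed.

Lemma prefix_normal_generable (R : realType) (g : nat -> R) (a : bool) :
  (forall n, 0 < n -> (n%:R <= g n)%R) ->
  generable g enc_none (fun _ _ s => prefix_normal a s).
Proof.
move=> hg.
apply: (@tree_generable R g _ _ _ true true (~~ a) no_init pn_test
  (fun _ _ _ _ _ => True) (fun _ _ => suffix_normal)) => // n [] n0 _.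
split=> //; last exact: pn_test_spec.
  move=> w sw; rewrite -prefix_normalE /word_map.
  by case: a; rewrite //= prefix_normal_compl.
exact: suffix_normal_closed.
Qed.

(** * Necklaces *)

(* Duval's scan: [(duval w k).2] is the period [p] of the prefix of length [k],
   whose first [p] letters form a Lyndon word. *)
Fixpoint duval (w : seq bool) (k : nat) : bool * nat :=
  if k is k'.+1 then
    let: (ok, p) := duval w k' in
    let x := nth false w k' in
    let y := if p <= k' then nth false w (k' - p) else false in
    if y && ~~ x then (false, p) else if x && ~~ y then (ok, k) else (ok, p)
  else (true, 1).

(** The Lyndon condition in suffix form: within the first [i] letters, the suffix from [m] exceeds
    the word at a position before its end. *)
Definition beats (w : seq bool) (i m : nat) : Prop :=
  exists k, [/\ m + k < i, nth false w k = false, nth false w (m + k) = true &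
    forall k', k' < k -> nth false w k' = nth false w (m + k')].

Definition lyndon_period (w : seq bool) (i p : nat) : Prop :=
  [/\ 0 < p <= i, forall k, k + p < i -> nth false w k = nth false w (k + p) &
    forall m, 0 < m < p -> beats w p m].

Lemma periodic_mod w i p k : lyndon_period w i p -> k < i ->
  nth false w k = nth false w (k %% p).
Proof.
case=> /andP [p0 _] hp _; elim/ltn_ind: k => k IH ki.
have [kp|pk] := ltnP k p; first by rewrite modn_small.
rewrite -(subnK pk) -hp; last by rewrite subnK.
rewrite modnDr; apply: IH; last exact: leq_ltn_trans (leq_subr _ _) ki.
by rewrite ltn_subrL p0 (leq_trans p0).
Qed.

(** A suffix starting at a multiple of [p] agrees with the word up to the new letter and wins there.
    Any other suffix wins inside a period, or at the new letter if that comes first. *)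
Lemma lyndon_period_restart w i p : lyndon_period w i p ->
  nth false w (i - p) = false -> nth false w i = true ->
  lyndon_period w i.+1 i.+1.
Proof.
move=> hI y0 x1; have [/andP [p0 pi] hp hb] := hI.
split; [by rewrite ltnS leqnn | by move=> k; rewrite ltnS; lia |].
move=> m /andP [m0 mi]; rewrite ltnS in mi.
have pm k : k < i -> nth false w k = nth false w (k %% p) by apply: periodic_mod hI.
have im_lt : i - m < i by lia.
have ip_lt : i - p < i by lia.
have [r0|r0] := posnP (m %% p).
  have mk k : (m + k) %% p = k %% p by rewrite -modnDml r0.
  exists (i - m); rewrite subnKC //; split=> // [|k' hk].
    rewrite pm // -(mk (i - m)) subnKC // -[in RHS]y0 [RHS]pm //.
    by rewrite -[in RHS](modnDr (i - p)) subnK.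
  by rewrite [RHS]pm ?mk -?pm //; lia.
have rp : m %% p < p by rewrite ltn_mod.
have [|k [krp hk0 hk1 hkk]] := hb (m %% p); first by rewrite r0.
have mE k' : m %% p + k' < p -> (m + k') %% p = m %% p + k'.
  by move=> h; rewrite -modnDml modn_small.
have [hki|hki] := ltnP (m + k) i.
  exists k; split=> [|//||k' hk'].
  - exact: leqW.
  - by rewrite pm // mE.
  - by rewrite hkk // [RHS]pm ?mE //; lia.
exists (i - m); rewrite subnKC //; split=> // [|k' hk'].
  have h1 : m %% p + (i - m) < p by apply: leq_ltn_trans krp; rewrite leq_add2l leq_subLR.
  have h2 : nth false w (m %% p + (i - m)) = false.
    rewrite -(mE _ h1) subnKC // -[RHS]y0 [RHS]pm //.
    by rewrite -[in RHS](modnDr (i - p)) subnK.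
  have [hh|hh] := ltnP (i - m) k; first by rewrite hkk.
  by have <- : k = i - m by lia.
have kk : k' < k by lia.
by rewrite hkk // [RHS]pm ?mE //; lia.
Qed.

(* A witness that [w] is not a prenecklace. *)
Definition descent (w : seq bool) (n : nat) : Prop :=
  exists p i, [/\ 0 < p <= i, i < n,
    forall k, k + p < i -> nth false w k = nth false w (k + p),
    nth false w (i - p) = true & nth false w i = false].

Lemma duvalP w k : 0 < k ->
  if (duval w k).1 then lyndon_period w k (duval w k).2 else descent w k.
Proof.
case: k => // k _; elim: k => [|k IH].
  rewrite /=; have h : lyndon_period w 1 1.
    by split=> // m; rewrite ?addn1 // => /andP [m0]; rewrite ltnS leqNgt m0.
  by case: (nth false w 0).
rewrite [duval w k.+2]/= -/(duval w k.+1).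
case E : (duval w k.+1) IH => [ok p] /=; case: ok {E} => [hI|[p' [i [h1 h2 h3 h4 h5]]]].
  have [/andP [p0 pk] hp hb] := hI; rewrite pk.
  case ey : (nth false w (k.+1 - p)); case ex : (nth false w k.+1) => /=.
  - split=> //; first by rewrite p0 leqW.
    move=> j; rewrite ltnS leq_eqVlt => /orP [/eqP jp|]; last exact: hp.
    by rewrite jp ex -ey; congr nth; lia.
  - by exists p, k.+1; rewrite p0 pk.
  - exact: lyndon_period_restart hI ey ex.
  - split=> //; first by rewrite p0 leqW.
    move=> j; rewrite ltnS leq_eqVlt => /orP [/eqP jp|]; last exact: hp.
    by rewrite jp ex -ey; congr nth; lia.
have hd : descent w k.+2 by exists p', i; split=> //; apply: leqW.
by case: (_ && _) => //; case: (_ && _).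
Qed.

Lemma nth_rot_ltn (s : seq bool) m k : m < size s -> k < size s ->
  nth false (rot m s) k =
  if m + k < size s then nth false s (m + k) else nth false s (m + k - size s).
Proof.
move=> ms ks; rewrite nth_cat size_drop ltn_subRL; case: ifP => h; first by rewrite nth_drop.
rewrite nth_take; last by lia.
by congr nth; lia.
Qed.

(** Rotating by [p] brings the letter at [i] to [i - p], where it gives the first difference: the
    rotation is smaller. *)
Lemma not_descent (w : seq bool) n (z : seq bool) : descent w n -> n <= size w -> prefix w z -> ~ necklace_min z.
Proof.
move=> [p [i [/andP [p0 pi] i_n hp h1 h0]]] nw pz hz.
have zw k : k < size w -> nth false z k = nth false w k.
  by case/prefixP: pz => z' ->; rewrite nth_cat => ->.
have wz : size w <= size z := size_prefix pz.
have := hz p; have -> : lexle z (rot p z) = ~~ lexlt (rot p z) z.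
  by rewrite lexltNge negbK.
move/negP; apply; apply/lexltP; rewrite size_rot //.
exists (i - p); rewrite nth_rot_ltn; try lia.
rewrite subnKC // ifT; last by lia.
split; [by lia | by rewrite zw ?h0 //; lia | by rewrite zw ?h1 //; lia |].
move=> k hk; rewrite nth_rot_ltn; try lia.
rewrite ifT; last by lia.
by rewrite !zw; try lia; rewrite addnC -hp //; lia.
Qed.

Lemma periodic_necklace w i p z : lyndon_period w i p -> p %| size z ->
  (forall k, k < size z -> nth false z k = nth false w (k %% p)) ->
  necklace_min z.
Proof.
move=> hI pz hz m; have [/andP [p0 pi] _ hb] := hI.
have [ms|sm] := ltnP m (size z); last by rewrite rot_oversize // lexle_eqVlt eqxx.
have hr k : k < size z -> nth false (rot m z) k = nth false w ((m + k) %% p).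
  move=> ks; rewrite nth_rot_ltn //; case: ifP => h; first by rewrite hz.
  rewrite hz; last by lia.
  have h' : size z <= m + k by rewrite leqNgt h.
  by rewrite -[in RHS](subnK h') -modnDmr (eqP pz) addn0.
rewrite lexle_eqVlt; have [r0|r0] := posnP (m %% p).
  apply/orP; left; apply/eqP/(@eq_from_nth _ false); first by rewrite size_rot.
  by move=> k ks; rewrite hr // hz // -modnDml r0.
apply/orP; right; apply/lexltP; first by rewrite size_rot.
have [|k [krp hk0 hk1 hkk]] := hb (m %% p); first by rewrite r0 ltn_mod.
have psz : p <= size z by rewrite dvdn_leq // (leq_trans _ ms).
have mE k' : m %% p + k' < p -> (m + k') %% p = m %% p + k'.
  by move=> h; rewrite -modnDml modn_small.
have rk k' : k' <= k -> m %% p + k' < p.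
  by move=> h; apply: leq_ltn_trans krp; rewrite leq_add2l.
have kp k' : k' <= k -> k' < p.
  by move=> /rk; apply: leq_ltn_trans; apply: leq_addl.
have kz k' : k' <= k -> k' < size z by move=> /kp h; apply: leq_trans psz.
exists k; split; first exact: kz.
- by rewrite hz ?modn_small ?kz ?kp.
- by rewrite hr ?mE ?rk ?kz.
- by move=> k' lk; have hk := ltnW lk; rewrite hz ?hr ?mE ?rk ?kz // (modn_small (kp _ hk)); apply: hkk.
Qed.

Lemma necklace_prefix w : necklace_min w -> prenecklace_min w.
Proof. by exists w; rewrite prefix_refl. Qed.

Lemma lyndon_period_prenecklace w p : lyndon_period w (size w) p -> prenecklace_min w.
Proof.
move=> hI; have [/andP [p0 pi] _ _] := hI.
(* Since [p > 0], the exponent [size w] makes the power of the first [p] letters long enough to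
   cover [w]. *)
pose z := mkseq (fun k => nth false w (k %% p)) (p * size w).
have sz : size z = p * size w by rewrite size_mkseq.
exists z; split.
  apply: periodic_necklace hI _ _; rewrite sz ?dvdn_mulr // => k kz.
  by rewrite nth_mkseq.
have wz : size w <= size z by rewrite sz leq_pmull.
apply/prefixP; exists (drop (size w) z); rewrite -[LHS](cat_take_drop (size w)).
congr (_ ++ _); apply: (@eq_from_nth _ false); rewrite size_takel // => k kw.
rewrite nth_take // nth_mkseq; last by rewrite (leq_trans kw) // -sz.
by rewrite -(periodic_mod hI).
Qed.

(** An incomplete last period of length [r] can be rotated to the front. The word then restarts at
    position [r], where [w] itself continues with a larger suffix of its Lyndon factor. *)
Lemma lyndon_period_necklace w p : lyndon_period w (size w) p ->
  necklace_min w <-> p %| size w.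
Proof.
move=> hI; have [/andP [p0 pi] hp hb] := hI; split=> [hn|pw]; last first.
  by apply: (periodic_necklace hI pw) => k; apply: (periodic_mod hI).
apply: contraT; rewrite /dvdn -lt0n => r0.
set r := size w %% p in r0; pose m := size w - r.
have rp : r < p by rewrite ltn_mod.
have mE : m = size w %/ p * p by rewrite /m {1}(divn_eq (size w) p) addnK.
have [|k [krp hk0 hk1 hkk]] := hb r; first by rewrite r0.
have ms : m < size w by rewrite /m; lia.
have hm : size w = m + r by rewrite /m; lia.
have hr i : i < size w -> nth false (rot m w) i =
    if i < r then nth false w i else nth false w (i - r).
  move=> iw; rewrite nth_rot_ltn //.
  have -> : (m + i < size w) = (i < r) by rewrite {1}hm ltn_add2l.
  case: ifP => h; last by rewrite {1}hm subnDl.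
  have mi : m + i < size w by rewrite hm ltn_add2l.
  by rewrite (periodic_mod hI mi) (periodic_mod hI iw) mE modnMDl.
have := hn m; have -> : lexle w (rot m w) = ~~ lexlt (rot m w) w.
  by rewrite lexltNge negbK.
case/negP; apply/lexltP; first by rewrite size_rot.
rewrite size_rot; exists (r + k); split; [by lia | | by [] |].
  by rewrite hr ?ltnNge ?leq_addr ?addKn //; lia.
move=> i ik; rewrite hr; last by lia.
case: ltnP => // ri; rewrite hkk; first by congr nth; lia.
by lia.
Qed.

Lemma nth_flatten_nseq (u : seq bool) j k : k < j * size u ->
  nth false (flatten (nseq j u)) k = nth false u (k %% size u).
Proof.
elim: j k => [|j IH] k //=; rewrite mulSn nth_cat => h.
case: ltnP => ku; first by rewrite modn_small.
rewrite IH; last by lia.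
by rewrite -[in RHS](subnK ku) modnDr.
Qed.

Lemma size_flatten_nseq (u : seq bool) j : size (flatten (nseq j u)) = j * size u.
Proof. by elim: j => //= j IH; rewrite size_cat IH mulSn. Qed.

Lemma lyndon_period_lyndon w p : lyndon_period w (size w) p ->
  lyndon w <-> p = size w.
Proof.
move=> hI; have [/andP [p0 pi] hp hb] := hI; split=> [[ha hn]|e].
  have /dvdnP [q qE] : p %| size w by apply/(lyndon_period_necklace hI).
  have q1 : q < 2.
    rewrite ltnNge; apply/negP => q2; apply: ha; exists (take p w), q; split=> //.
    have st : size (take p w) = p by rewrite size_takel.
    apply: (@eq_from_nth _ false); first by rewrite size_flatten_nseq st.
    move=> k kw; rewrite nth_flatten_nseq st -?qE // nth_take ?ltn_mod //.
    exact: periodic_mod hI kw.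
  by move: qE pi p0 q1; case: q => [|[|q]] //; lia.
split; last by apply/(lyndon_period_necklace hI); rewrite e.
(* In a power of [u] the suffix from [size u] agrees with the beginning of the word, so it cannot
   beat it. *)
case=> u [j [j2 wE]]; have sw : size w = j * size u by rewrite wE size_flatten_nseq.
have u0 : 0 < size u by rewrite lt0n; apply/eqP => h; move: p0; rewrite e sw h; lia.
have [|k [krp hk0 hk1 _]] := hb (size u); first by rewrite u0 e sw; nia.
rewrite e in krp.
have : nth false w (size u + k) = nth false w k.
  rewrite wE !nth_flatten_nseq -?sw //; last by lia.
  by rewrite modnDl.
by rewrite hk0 hk1.
Qed.

Definition prenecklaceb (w : seq bool) : bool := (duval w (size w)).1.
Definition necklaceb (w : seq bool) : bool :=
  (duval w (size w)).1 && ((duval w (size w)).2 %| size w).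
Definition lyndonb (w : seq bool) : bool :=
  (duval w (size w)).1 && ((duval w (size w)).2 == size w).

Lemma prenecklaceP w : 0 < size w -> prenecklace_min w <-> prenecklaceb w.
Proof.
move=> w0; rewrite /prenecklaceb; have := duvalP w w0.
case: (duval _ _).1 => h; first by split=> // _; apply: lyndon_period_prenecklace h.
by split=> // -[z [hz pz]]; case: (not_descent h (leqnn _) pz hz).
Qed.

Lemma necklaceP w : 0 < size w -> necklace_min w <-> necklaceb w.
Proof.
move=> w0; rewrite /necklaceb; have := duvalP w w0.
case: (duval _ _).1 => h; first exact: lyndon_period_necklace.
by split=> // hz; case: (not_descent h (leqnn _) (prefix_refl w) hz).
Qed.

Lemma lyndonP w : 0 < size w -> lyndon w <-> lyndonb w.
Proof.
move=> w0; rewrite /lyndonb; have := duvalP w w0.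
case: (duval _ _).1 => h.
  by rewrite (lyndon_period_lyndon h); split=> [->|/eqP]; rewrite ?eqxx.
by split=> // -[_ hz]; case: (not_descent h (leqnn _) (prefix_refl w) hz).
Qed.

(** * Closure of the necklace classes under the shift *)

Lemma first_one (z : seq bool) m N : m < N -> nth false z N.-1 = true ->
  exists k, [/\ m + k < N, nth false z (m + k) = true &
    forall k', k' < k -> nth false z (m + k') = false].
Proof.
move=> mN z1; have ex : exists k, nth false z (m + k).
  by exists (N.-1 - m); rewrite subnKC ?z1 //; lia.
have [k hk hmin] := ex_minnP ex; exists k; split=> //.
  by have := hmin (N.-1 - m); rewrite subnKC ?z1 => [/(_ isT)|]; lia.
by move=> k' kk; apply/negbTE/negP => /hmin; lia.
Qed.

(** The leading run of [a + 1] zeros is the unique longest one and the word ends with 1, so every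
    proper suffix reaches a 1 after at most [a] zeros and is larger. *)
Lemma leading_run_lyndon (z : seq bool) a : let N := size z in a.+1 < N ->
  (forall i, i <= a -> nth false z i = false) -> nth false z a.+1 = true ->
  nth false z N.-1 = true ->
  (forall m, a.+1 < m -> m + a < N -> exists2 k, k <= a & nth false z (m + k) = true) ->
  lyndon_period z N N.
Proof.
move=> N aN z0 z1 zN hw; split; first by rewrite leqnn andbT; lia.
  by move=> k; lia.
move=> m /andP [m0 mN].
have [k [mk h1 hlt]] := first_one mN zN.
have ka : k <= a.
  rewrite leqNgt; apply/negP => ak.
  have [ma|am] := leqP m a.+1.
    by have := hlt (a.+1 - m); rewrite subnKC // z1 => h; have := h _; lia.
  have [|k' k'a] := hw m am; first by lia.
  by rewrite hlt //; lia.
exists k; split=> //; first exact: z0.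
by move=> k' kk; rewrite hlt // z0 //; lia.
Qed.

Section Shifted.

Variables (a : nat) (b : bool) (v : seq bool).
Let n := a + (size v).+2.
Let w := nseq a false ++ true :: b :: v.
Let w' := nseq a false ++ false :: true :: v.

(** A later run of [a + 1] zeros would start a smaller rotation of every word extending [w]. *)
Lemma prenecklace_window : prenecklace_min w ->
  forall m, a.+1 < m -> m + a < n -> exists2 k, k <= a & nth false w (m + k) = true.
Proof.
case=> z [hz pz] m am mn; have [sw _] := size_shift a b v.
have zw k : k < n -> nth false z k = nth false w k.
  by case/prefixP: pz => z' ->; rewrite nth_cat sw => ->.
have wz : size w <= size z := size_prefix pz.
rewrite sw -/n in wz.
have [/hasP [k]|/hasPn h] := boolP (has (fun k => nth false w (m + k)) (iota 0 a.+1)).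
  by rewrite mem_iota add0n ltnS => /andP [_ ka] wk; exists k.
have h' k : k <= a -> nth false w (m + k) = false.
  by move=> ka; apply/negbTE/h; rewrite mem_iota add0n ltnS ka.
have := hz m; have -> : lexle z (rot m z) = ~~ lexlt (rot m z) z.
  by rewrite lexltNge negbK.
case/negP; apply/lexltP; rewrite size_rot //.
have an : a < n by rewrite /n; lia.
exists a; split; first by lia.
- by rewrite nth_rot_ltn ?ifT ?zw ?h' //; lia.
- by rewrite zw // /w shift_at.
- by move=> i ia; rewrite nth_rot_ltn ?ifT ?zw ?h' /w ?shift_low //; lia.
Qed.

(** The shift makes the leading run longer than all others. The appended 1 closes a possible final
    run of 0s, which makes the whole a Lyndon word with prefix [w']. *)
Lemma prenecklace_shift_ones : prenecklace_min w ->
  lyndon_period (w' ++ [:: true]) n.+1 n.+1.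
Proof.
move=> hw; have [sw sw'] := size_shift a b v.
have sz : size (w' ++ [:: true]) = n.+1 by rewrite size_cat sw' addn1.
have nz i : i < n -> nth false (w' ++ [:: true]) i = nth false w' i.
  by move=> iN; rewrite nth_cat sw' -/n iN.
have an : a.+1 < n by rewrite /n; lia.
rewrite -{1}sz -sz; apply: (@leading_run_lyndon _ a); rewrite ?sz.
- exact: ltnW.
- by move=> i ia; rewrite nz ?shift_low' //; lia.
- by rewrite nz // (shift_nth a b) eqxx.
- by rewrite nth_cat sw' -/n ltnn subnn.
move=> m am; rewrite ltnS leq_eqVlt => /orP [/eqP e|mn].
  by exists a; rewrite // e nth_cat sw' -/n ltnn subnn.
have [k ka wk] := prenecklace_window hw am mn.
by exists k => //; rewrite nz ?(shift_high b) //; lia.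
Qed.

Lemma prenecklace_shift : prenecklace_min w -> prenecklace_min w'.
Proof.
move=> hw; have [sw sw'] := size_shift a b v.
have := prenecklace_shift_ones hw.
have sz : size (w' ++ [:: true]) = n.+1 by rewrite size_cat sw' addn1.
rewrite -sz => h; exists (w' ++ [:: true]); split; last exact: prefix_prefix.
by apply/(lyndon_period_necklace h).
Qed.

(** A necklace containing a 1 ends with 1: a final 0 could be rotated to the front. So [w'] is a
    Lyndon word, which settles necklaces and Lyndon words at once. *)
Lemma necklace_shift : necklace_min w -> lyndon_period w' n n.
Proof.
move=> hw; have [sw sw'] := size_shift a b v.
have an : a.+1 < n by rewrite /n; lia.
have w1 : nth false w n.-1 = true.
  apply/negP => w0; have := hw n.-1.
  have -> : lexle w (rot n.-1 w) = ~~ lexlt (rot n.-1 w) w by rewrite lexltNge negbK.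
  case/negP; apply/lexltP; rewrite size_rot // sw -/n.
  have hr k : k <= a -> nth false (rot n.-1 w) k = false.
    move=> ka; rewrite nth_rot_ltn ?sw -/n; try lia.
    case: k ka => [|k] ka; first by rewrite addn0 ifT; [exact/negP|lia].
    rewrite ifF; last by lia.
    by rewrite (_ : n.-1 + k.+1 - n = k) ?shift_low //; lia.
  exists a; split; first by lia.
  - exact: hr.
  - exact: shift_at.
  - by move=> i ia; rewrite hr ?shift_low // ltnW.
rewrite -/n in sw'; rewrite -sw'; apply: (@leading_run_lyndon _ a); rewrite ?sw' //.
- by move=> i ia; rewrite shift_low'.
- by rewrite (shift_nth a b) eqxx.
- rewrite (shift_nth a b) w1 andbT; apply/orP.
  by have [e|ne] := eqVneq n.-1 a.+1; [left | right; rewrite /n in an *; lia].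
move=> m am mn; have [k ka wk] := prenecklace_window (necklace_prefix hw) am mn.
by exists k => //; rewrite (shift_high b) //; lia.
Qed.

End Shifted.

Section NecklaceGen.

Lemma prenecklaceb_shift n : shift_closed n prenecklaceb.
Proof.
move=> a b v sz; have [sw sw'] := size_shift a b v.
move/prenecklaceP => h; apply/prenecklaceP; rewrite ?sw'; first by lia.
by apply: (prenecklace_shift (b := b)); apply: h; rewrite sw; lia.
Qed.

Lemma necklaceb_shift n : shift_closed n necklaceb.
Proof.
move=> a b v sz; have [sw sw'] := size_shift a b v.
move/necklaceP => h; apply/necklaceP; rewrite ?sw'; first by lia.
have hw := necklace_shift (h _); rewrite -sw' in hw.
by apply/(lyndon_period_necklace (hw _)); rewrite ?sw ?dvdnn //; lia.
Qed.

Lemma lyndonb_shift n : shift_closed n lyndonb.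
Proof.
move=> a b v sz; have [sw sw'] := size_shift a b v.
move/lyndonP => h; apply/lyndonP; rewrite ?sw'; first by lia.
have hn : necklace_min (nseq a false ++ [:: true, b & v]).
  by case: h => //; rewrite sw; lia.
have hw := necklace_shift hn; rewrite -sw' in hw.
exact/(lyndon_period_lyndon hw).
Qed.

(** For a period exceeding the position the index is negative and the access yields 0, the default
    in [duval]. *)
Definition duval_scan : cmd :=
  Seq (Asn 7 (EC 1%R)) (Seq (Asn 10 (EC 1%R))
  (For 9 (Seq (Asn 11 (bit false 9))
    (Seq (Asn 12 (EG false (ES (EV 9) (EV 10))))
    (If (ES (EV 12) (EV 11)) (Asn 7 (EC 0%R))
    (If (ES (EV 11) (EV 12)) (Asn 10 (EA (EV 9) (EC 1%R))) nop)))))).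

Lemma duval_scanP st w : var st 0 = Posz (size w) -> holds_word (arr st false) w ->
  (0 < var (run duval_scan st) 7)%R = (duval w (size w)).1 /\
  var (run duval_scan st) 10 = Posz (duval w (size w)).2.
Proof.
move=> h0 hw; rewrite /duval_scan run_seq run_seq.
set s1 := run (Asn _ _) _; set c := Seq _ _.
pose Inv k (f : nat -> int) := (0 < f 7)%R = (duval w k).1 /\
  f 10 = Posz (duval w k).2.
suff : Inv (size w) (var (run (For 9 c) s1)) by [].
apply: loop_ind => // k st' kw hk h0' ha hx [i7 i10].
have hb : eval st' (bit false 9) = Posz (nth false w k).
  by rewrite (@bitE false st' w 9 k) ?ha.
have hg : geti (arr st' false) (var st' 9 - var st' 10)%R =
    Posz (if (duval w k).2 <= k then nth false w (k - (duval w k).2) else false).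
  rewrite hk i10; case: leqP => pk; first by rewrite subzn //= ha hw.
  by have -> : (Posz k - Posz (duval w k).2)%R = Negz ((duval w k).2 - k.+1) by lia.
rewrite /Inv [duval w k.+1]/=.
case: (duval w k) i7 i10 hg => ok p; rewrite [fst _]/= [snd _]/= => i7 i10.
move: (if p <= k then _ else _) => y hg.
rewrite /c !run_seq !run_asn hb run_if /= hg.
case: y hg => hg; case: (nth false w k) => /=; rewrite ?run_if /= ?hg /=;
  rewrite ?i7 ?i10 ?hk; split=> //; lia.
Qed.

(** Divisibility without division: variable 11 counts the rounds modulo the period. *)
Definition necklace_test : cmd :=
  Seq duval_scan
  (Seq (Asn 11 (EC 0%R))
  (Seq (For 9 (Seq (Asn 11 (EA (EV 11) (EC 1%R)))
    (If (ES (EV 10) (EV 11)) nop (Asn 11 (EC 0%R)))))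
  (If (EV 11) (Asn 7 (EC 0%R)) nop))).

Definition lyndon_test : cmd :=
  Seq duval_scan (If (ES (EV 0) (EV 10)) (Asn 7 (EC 0%R)) nop).

(** Since the period is at most [n], the test [n - p > 0] decides whether it differs from [n]. The
    maximum covers the initial period 1 at [k = 0]. *)
Lemma duval_period w k : (duval w k).2 <= maxn 1 k /\ 0 < (duval w k).2.
Proof.
elim: k => [|k [IH1 IH2]] //=; case: (duval w k) IH1 IH2 => ok p /= IH1 IH2.
by case: (_ && _); [|case: (_ && _)]; split=> //=; lia.
Qed.

Lemma prenecklace_test_spec n :
  test_spec duval_scan n prenecklaceb (fun _ _ _ => True).
Proof.
move=> st w sw h0 _ hw _; rewrite -sw in h0.
by have [-> _] := duval_scanP h0 hw.
Qed.

Lemma necklace_test_spec n :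
  test_spec necklace_test n necklaceb (fun _ _ _ => True).
Proof.
move=> st w sw h0 _ hw _; rewrite -sw in h0.
have [h7 h10] := duval_scanP h0 hw.
rewrite /necklace_test run_seq; set s1 := run duval_scan st in h7 h10 *.
have h01 : var s1 0 = Posz (size w) by rewrite /s1 run_var.
clearbody s1; rewrite run_seq; set s2 := run (Asn _ _) _; rewrite run_seq.
set c := Seq _ _; set p := (duval w (size w)).2 in h10.
have p0 : 0 < p := proj2 (duval_period w _).
pose Inv k (f : nat -> int) := [/\ f 11 = Posz (k %% p), f 10 = Posz p & f 7 = var s1 7].
have [h11 _ h7'] : Inv (size w) (var (run (For 9 c) s2)).
  apply: loop_ind => //; first by split=> //=; rewrite mod0n.
  move=> k st' kw hk h0' ha hx [i11 i10 i7].
  rewrite /Inv /c run_seq run_asn run_if /= i10 i11.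
  have rp : k %% p < p by rewrite ltn_mod.
  have e : k.+1 %% p = if (k %% p).+1 == p then 0 else (k %% p).+1.
    rewrite -addn1 -modnDml addn1; case: eqP => [->|ne]; first by rewrite modnn.
    by rewrite modn_small // ltn_neqAle rp andbT; apply/eqP.
  move: (k %% p) rp e => r rp ->.
  have -> : (0 < Posz p - (Posz r + 1))%R = (r.+1 != p) by apply/idP/idP; lia.
  by case: eqP => _ /=; split=> //; lia.
rewrite run_if [eval _ _]/= h11 /necklaceb -/p -h7 /dvdn.
case: (_ %% p) => [|r] /=; first by rewrite h7' andbT.
by rewrite andbF.
Qed.

Lemma lyndon_test_spec n : 0 < n ->
  test_spec lyndon_test n lyndonb (fun _ _ _ => True).
Proof.
move=> n0 st w sw h0 _ hw _; rewrite -sw in h0 n0.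
have [h7 h10] := duval_scanP h0 hw.
rewrite /lyndon_test run_seq; set s1 := run duval_scan st in h7 h10 *.
have h01 : var s1 0 = Posz (size w) by rewrite /s1 run_var.
rewrite run_if /= h10 h01 /lyndonb -h7.
have [pn _] := duval_period w (size w); move: (duval _ _).2 pn => p pn.
case: ifP => h /=.
  by rewrite (_ : (p == size w) = false) ?andbF //; apply/eqP; lia.
by rewrite (_ : (p == size w)) ?andbT //; apply/eqP; lia.
Qed.

Variables (R : realType) (g : nat -> R).
Hypothesis g_ge : forall n, 0 < n -> (n%:R <= g n)%R.

Lemma necklace_max_compl w : necklace_max (compl w) <-> necklace_min w.
Proof.
have h i : lexle (rot i (compl w)) (compl w) = lexle w (rot i w).
  by rewrite -map_rot [lexle _ _](@lex_compl false) // size_rot.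
by split=> H i; have := H i; rewrite h.
Qed.

Lemma prenecklace_max_compl w : prenecklace_max (compl w) <-> prenecklace_min w.
Proof.
split=> -[z [hz pz]]; exists (compl z); split.
- by apply/necklace_max_compl; rewrite complK.
- by rewrite -prefix_compl complK.
- exact/necklace_max_compl.
- by rewrite prefix_compl.
Qed.

Lemma aperiodic_compl w : aperiodic (compl w) <-> aperiodic w.
Proof.
have h u : aperiodic (compl u) -> aperiodic u.
  move=> ha [x [j [j2 uE]]]; apply: ha; exists (compl x), j; split=> //.
  by rewrite uE /compl map_flatten map_nseq.
by split=> [/h//|hw]; apply: h; rewrite complK.
Qed.

Lemma necklace_min_generable :
  generable g enc_none (fun _ _ s => necklace_min s).
Proof.
apply: (@none_generable R g g_ge _ false false necklace_test (fun _ => necklaceb)) => //.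
- by move=> n w n0 sw; apply: necklaceP; rewrite sw.
- exact: necklaceb_shift.
- by move=> n _; apply: necklace_test_spec.
Qed.

Lemma necklace_max_generable :
  generable g enc_none (fun _ _ s => necklace_max s).
Proof.
apply: (@none_generable R g g_ge _ false true necklace_test (fun _ => necklaceb)) => //.
- by move=> n w n0 sw; rewrite necklace_max_compl; apply: necklaceP; rewrite sw.
- exact: necklaceb_shift.
- by move=> n _; apply: necklace_test_spec.
Qed.

Lemma lyndon_generable :
  generable g enc_none (fun _ _ s => lyndon s).
Proof.
apply: (@none_generable R g g_ge _ false false lyndon_test (fun _ => lyndonb)) => //.
- by move=> n w n0 sw; apply: lyndonP; rewrite sw.
- exact: lyndonb_shift.
- by move=> n n0; apply: lyndon_test_spec.
Qed.

Lemma aperiodic_necklace_max_generable :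
  generable g enc_none (fun _ _ s => aperiodic s /\ necklace_max s).
Proof.
apply: (@none_generable R g g_ge _ false true lyndon_test (fun _ => lyndonb)) => //.
- move=> n w n0 sw; rewrite aperiodic_compl necklace_max_compl.
  by apply: lyndonP; rewrite sw.
- exact: lyndonb_shift.
- by move=> n n0; apply: lyndon_test_spec.
Qed.

Lemma prenecklace_min_generable :
  generable g enc_none (fun _ _ s => prenecklace_min s).
Proof.
apply: (@none_generable R g g_ge _ false false duval_scan (fun _ => prenecklaceb)) => //.
- by move=> n w n0 sw; apply: prenecklaceP; rewrite sw.
- exact: prenecklaceb_shift.
- by move=> n _; apply: prenecklace_test_spec.
Qed.

Lemma prenecklace_max_generable :
  generable g enc_none (fun _ _ s => prenecklace_max s).
Proof.
apply: (@none_generable R g g_ge _ false true duval_scan (fun _ => prenecklaceb)) => //.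
- by move=> n w n0 sw; rewrite prenecklace_max_compl; apply: prenecklaceP; rewrite sw.
- exact: prenecklaceb_shift.
- by move=> n _; apply: prenecklace_test_spec.
Qed.

End NecklaceGen.

(** * Pseudo-necklaces *)

Definition blk (b : nat * nat) : seq bool := nseq b.1 false ++ nseq b.2 true.

Fixpoint blocks (w : seq bool) : seq (nat * nat) :=
  match w with
  | [::] => [::]
  | false :: w' =>
      if blocks w' is (s, t) :: r then (s.+1, t) :: r else [:: (1, 0)]
  | true :: w' =>
      match blocks w' with
      | (0, t) :: r => (0, t.+1) :: r
      | bs => (0, 1) :: bs
      end
  end.

(** This is maximality: only the first block may lack 0s, and only the last may lack 1s. *)
Fixpoint valid (bs : seq (nat * nat)) : bool :=
  if bs is b :: r then
    [&& 0 < b.1 + b.2,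
        (if r is b' :: _ then (0 < b.2) && (0 < b'.1) else true) & valid r]
  else true.

Lemma blocks_flatten w : flatten (map blk (blocks w)) = w.
Proof.
elim: w => //= -[] w; case: (blocks w) => [|[[|s] t] r] /= <- //.
Qed.

Lemma blocks_valid w : valid (blocks w).
Proof.
elim: w => //= -[] w; case: (blocks w) => [|[[|s] t] r] //=.
- by case: r => [|[s' t'] r] //= /and3P [_ /andP [_ ->] ->].
- by case/and3P => _ -> ->.
Qed.

Lemma blocks_zeros s t r w : blocks w = (0, t) :: r ->
  blocks (nseq s false ++ w) = (s, t) :: r.
Proof. by move=> h; elim: s => //= s ->. Qed.

Lemma blocks_ones t w : (if blocks w is b :: _ then 0 < b.1 else true) ->
  blocks (nseq t.+1 true ++ w) = (0, t.+1) :: blocks w.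
Proof.
by move=> h; elim: t => [|t IH] /=; [case: (blocks w) h => [|[[|s] t] r] | rewrite /= in IH; rewrite IH].
Qed.

Lemma valid_blocks bs : valid bs -> blocks (flatten (map blk bs)) = bs.
Proof.
elim: bs => //= -[s t] r IH /= /and3P [h0 h1 /IH {}IH].
rewrite /blk /= -catA; case: t h0 h1 => [|t] h0 h1.
  case: r h1 IH => //= _ _; rewrite cats0.
  by case: s h0 => // s _; elim: s => //= s ->.
rewrite -[flatten _]/(flatten (map blk r)).
by rewrite (@blocks_zeros s t.+1 r) // blocks_ones IH //; case: r h1 {IH} => //= b r /andP [].
Qed.

Lemma blk_count b : count_mem false (blk b) = b.1 /\ count_mem true (blk b) = b.2.
Proof. by rewrite /blk !count_cat !count_nseq /= !mul1n !mul0n addn0. Qed.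

Definition ble (b b' : nat * nat) : bool := (b'.1 < b.1) || ((b.1 == b'.1) && (b.2 <= b'.2)).

Lemma block_leE b b' : block_le (blk b) (blk b') = ble b b'.
Proof.
have [e1 e2] := blk_count b; have [e3 e4] := blk_count b'.
rewrite /block_le /block_lt e1 e2 e3 e4 /ble.
have -> : (blk b == blk b') = (b.1 == b'.1) && (b.2 == b'.2).
  apply/eqP/andP => [h|[/eqP h1 /eqP h2]]; last by rewrite /blk h1 h2.
  by rewrite -e1 -e2 h e3 e4 !eqxx.
by rewrite [b.2 <= _]leq_eqVlt; case: ltngtP => //= _; case: (b.2 == _).
Qed.

Lemma sorted_no_10 z : sorted_form false z -> ~~ infix [:: true; false] z.
Proof.
case=> x [y ->]; elim: x => [|x IH] //=.
by elim: y => //= y IH; rewrite negb_or IH andbT; case: (y).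
Qed.

Lemma sorted_blk b : sorted_form false (blk b).
Proof. by exists b.1, b.2. Qed.

Lemma sorted_single c : sorted_form false [:: c].
Proof. by case: c; [exists 0, 1|exists 1, 0]. Qed.

Lemma valid_last b l : valid (rcons l b) -> valid l /\ (l <> [::] -> 0 < b.1 /\
  exists w, flatten (map blk l) = rcons w true).
Proof.
elim: l => //= c [|c' l] IH /=.
  rewrite andbT => /and3P [-> /andP [h1 h2] _]; split=> // _; split=> //.
  exists (nseq c.1 false ++ nseq c.2.-1 true); rewrite cats0 /blk.
  by case: c.2 h1 => // t _; rewrite -cats1 -catA -[[:: true]]/(nseq 1 true) -nseqD addn1.
case/and3P => -> -> /IH [h1 h2]; split=> //= _.
have [|h3 [w hw]] := h2; first by [].
split=> //; exists (blk c ++ w); rewrite -cats1 -catA cats1 -hw //.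
Qed.

Lemma valid_cat l r : valid (l ++ r) -> valid l /\ valid r.
Proof.
elim: l => //= b l IH /and3P [-> h /IH [-> ->]]; split=> //.
by case: l h {IH} => //= ? ? ->.
Qed.

Lemma valid_head b r : valid (b :: r) -> r <> [::] -> 0 < b.2 /\
  exists w, flatten (map blk r) = false :: w.
Proof.
case: r => //= -[[|s] t] r /= /and3P [_ /andP [h1 h2] _] // _; split=> //.
by eexists.
Qed.

(** Extending a block to the left takes in the 1 that ends the previous block, extending it to the
    right the 0 that starts the next; either creates a factor 10. *)
Lemma valid_decomposition bs : valid bs ->
  block_decomposition (flatten (map blk bs)) (map blk bs).
Proof.
move=> hv; split=> // l B r E.
have [l' [b [r' [e1 [e2 [e3 e4]]]]]] : exists l' b r', bs = l' ++ b :: r' /\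
    l = map blk l' /\ B = blk b /\ r = map blk r'.
  elim: bs l E {hv} => [|c bs IH] [|B' l] //= [<- E]; first by exists [::], c, bs.
  by have [l' [b [r' [-> [-> [-> ->]]]]]] := IH _ E; exists (c :: l'), b, r'.
rewrite {}e2 {}e3 {}e4; split; first exact: sorted_blk.
move=> u' x y v' eu ev /sorted_no_10 hs.
rewrite e1 in hv.
have [hv1 hv2] := valid_cat hv.
have hv3 : valid (rcons l' b) by move: hv; rewrite -cat_rcons => /valid_cat [].
have infix_mid p q (z : seq bool) : infix [:: true; false] (p ++ [:: true; false] ++ q).
  by apply/infixP; exists p, q.
split.
  case/lastP: x eu hs => // x c eu hs.
  have l0 : l' <> [::] by move=> h; move: eu; rewrite h -rcons_cat; case: (u' ++ x).
  have [_ /(_ l0) [b1 [w hw]]] := valid_last hv3.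
  have ec : c = true.
    by move: eu; rewrite hw -rcons_cat => /eqP; rewrite eqseq_rcons => /andP [_ /eqP].
  move: hs; rewrite ec /blk; case: b.1 b1 => // s _.
  by rewrite -cats1 -!catA /= infix_mid.
case: y ev hs => // c y ev hs.
have r0 : r' <> [::] by move=> h; move: ev; rewrite h.
have [b2 [w hw]] := valid_head hv2 r0.
have ec : c = false by move: ev; rewrite hw => -[].
move: hs; rewrite ec /blk; case: b.2 b2 => // t _.
have -> : x ++ (nseq b.1 false ++ nseq t.+1 true) ++ false :: y =
  (x ++ nseq b.1 false ++ nseq t true) ++ [:: true; false] ++ y.
  by rewrite -addn1 nseqD -!catA.
by rewrite infix_mid.
Qed.

(** Maximality is used twice: an empty block could absorb a neighbouring letter ([ne]), which exists
    as [w] is nonempty, and the first letter of the next block does not fit onto a block ([nxt]). *)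
Lemma decomposition_valid w Bs : w != [::] -> block_decomposition w Bs ->
  Bs = map blk (blocks w).
Proof.
move=> w0 [wE hb].
have ne l B r : Bs = l ++ B :: r -> B <> [::].
  move=> E B0; have [_ h] := hb _ _ _ E; rewrite B0 in h E.
  have : flatten l ++ flatten r != [::].
    by move: w0; rewrite wE E flatten_cat.
  case/lastP: (flatten l) h => [|u c] h.
    case: (flatten r) h => // c v h _.
    by have [] := h [::] [::] [:: c] v erefl erefl (sorted_single c).
  move=> _.
  by have [] := h u [:: c] [::] (flatten r) (esym (cats1 u c)) erefl (sorted_single c).
have nxt l B B' r : Bs = l ++ B :: B' :: r ->
    forall c z, B' = c :: z -> ~ sorted_form false (B ++ [:: c]).
  move=> E c z e hs; have [_ h] := hb _ _ _ E.
  have ev : flatten (B' :: r) = [:: c] ++ (z ++ flatten r) by rewrite /= e.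
  by have [] := h (flatten l) [::] _ _ (esym (cats0 _)) ev hs.
suff [bs eb vb] : exists2 bs, Bs = map blk bs & valid bs.
  by rewrite wE eb valid_blocks.
have hs l B r : Bs = l ++ B :: r -> sorted_form false B.
  by move=> /hb [].
clear hb wE; elim: Bs ne nxt hs => [|B Bs IH] ne nxt hs; first by exists [::].
have [x [y eB]] := hs [::] B Bs erefl.
have [l B' r E|l B' B2 r E|l B' r E|bs eb vb] := IH.
- by apply: (ne (B :: l) B' r); rewrite E.
- by apply: (nxt (B :: l) B' B2 r); rewrite E.
- by apply: (hs (B :: l) B' r); rewrite E.
exists ((x, y) :: bs); first by rewrite /= eb eB.
rewrite /= vb andbT; apply/andP; split.
  have := ne [::] B Bs erefl; rewrite eB; case: x {eB} => //; case: y => //.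
case: bs eb vb => // -[x' y'] bs eb vb.
have E : B :: Bs = [::] ++ B :: blk (x', y') :: map blk bs by rewrite eb.
have hn := nxt _ _ _ _ E.
have := ne [:: B] (blk (x', y')) (map blk bs); rewrite eb => /(_ erefl) hne.
rewrite /=; case: x' hn hne {eb vb E} => [|x'] hn hne; last first.
  rewrite andbT lt0n; apply/eqP => y0; apply: (hn false (nseq x' false ++ nseq y' true)) => //.
  by exists x.+1, 0; rewrite eB y0 cats0 -[[:: false]]/(nseq 1 false) -nseqD addn1 cats0.
case: y' hn hne => // y' hn _; case: (hn true (nseq y' true)) => //.
by exists x, y.+1; rewrite eB -catA -[[:: true]]/(nseq 1 true) -nseqD addn1.
Qed.

Definition pseudob (w : seq bool) : bool :=
  all (ble (head (0, 0) (blocks w))) (behead (blocks w)).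

Lemma pseudo_necklaceP w : 0 < size w -> pseudo_necklace w <-> pseudob w.
Proof.
move=> w0; have wn : w != [::] by rewrite -size_eq0 -lt0n.
have bn : blocks w != [::].
  by apply/eqP => h; move: w0; rewrite -(blocks_flatten w) h.
rewrite /pseudob; case E : (blocks w) bn => [|b bs] //= _; split.
  case=> B [Bs [hd hle]]; have := decomposition_valid wn hd; rewrite E => -[eB eBs].
  apply/allP => b' hb'; rewrite -block_leE -eB; apply: hle.
  by rewrite eBs; apply: map_f.
move=> /allP h; exists (blk b), (map blk bs); split.
  rewrite -[blk b :: _]/(map blk (b :: bs)) -E -{1}(blocks_flatten w).
  exact: valid_decomposition (blocks_valid w).
by move=> B' /mapP [b' hb' ->]; rewrite block_leE; apply: h.
Qed.

Lemma blocks_true v : exists t r, blocks (true :: v) = (0, t) :: r.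
Proof. by rewrite /=; case: (blocks v) => [|[[|s] t] r]; do 2 eexists. Qed.

(** More 0s make a block smaller, and the first block gains one. The others stay as they are, except
    that for [b = 0] the second loses a 0 and, if this was its only one, merges into the first. *)
Lemma pseudob_shift n : shift_closed n pseudob.
Proof.
move=> a b v _; rewrite /pseudob nseq_shift.
have low c t t' r : all (ble (c, t)) r -> all (ble (c.+1, t')) r.
  by move=> /allP h; apply/allP => x /h; rewrite /ble /=; lia.
have [t [r e]] := blocks_true v; rewrite (blocks_zeros _ e) /=.
case: b.
  have e2 : blocks [:: true, true & v] = (0, t.+1) :: r by rewrite /= /= in e *; rewrite e.
  by rewrite (blocks_zeros _ e2) /=; apply: low.
have [s1 [t1 [r1 e1]]] : exists s t r, blocks (false :: v) = (s.+1, t) :: r.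
  by rewrite /=; case: (blocks v) => [|[s t'] r']; do 3 eexists.
have e2 : blocks [:: true, false & v] = (0, 1) :: (s1.+1, t1) :: r1.
  by rewrite -[blocks _]/(match blocks (false :: v) with
      | (0, t) :: r => (0, t.+1) :: r | bs => (0, 1) :: bs end) e1.
rewrite (blocks_zeros _ e2) /= => /andP [h1 h2].
move: e1 e; rewrite /=; case: (blocks v) => [_ [_ <-] //|[s t'] r' [-> -> ->]].
case: s1 h1 {e2} => [|s1] h1 [_ <-]; first exact: low h2.
by rewrite /= (low _ _ _ _ h2) andbT; move: h1; rewrite /ble /=; lia.
Qed.

Definition cmp_min (yes no : cmd) : cmd :=
  If (ES (EV 10) (EV 12)) yes
    (If (ES (EV 12) (EV 10)) no (If (ES (EV 11) (EV 13)) no yes)).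

(** Variables 10 and 11 describe the block being read from the right, 12 and 13 the least finished
    one. Initially the latter has -1 zeros, so that every block counts as smaller. *)
Definition pseudo_test : cmd :=
  Seq (Asn 10 (EC 0%R)) (Seq (Asn 11 (EC 0%R))
  (Seq (Asn 12 (EC (-1)%R)) (Seq (Asn 13 (EC 0%R))
  (Seq (For 9 (If (bit true 9)
     (If (EV 10)
       (Seq (cmp_min (Seq (Asn 12 (EV 10)) (Asn 13 (EV 11))) nop)
         (Seq (Asn 10 (EC 0%R)) (Asn 11 (EC 1%R))))
       (Asn 11 (EA (EV 11) (EC 1%R))))
     (Asn 10 (EA (EV 10) (EC 1%R)))))
  (cmp_min (Asn 7 (EC 1%R)) (Asn 7 (EC 0%R))))))).

Definition min_test (ms mt s t : int) : bool :=
  ((ms < s) || ((ms == s) && (t <= mt)))%R.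

Lemma cmp_minP yes no st :
  run (cmp_min yes no) st =
  if min_test (var st 12) (var st 13) (var st 10) (var st 11)
  then run yes st else run no st.
Proof.
rewrite /cmp_min !run_if /= /min_test.
have -> : (0 < var st 10 - var st 12)%R = (var st 12 < var st 10)%R by rewrite subr_gt0.
have -> : (0 < var st 12 - var st 10)%R = (var st 10 < var st 12)%R by rewrite subr_gt0.
have -> : (0 < var st 11 - var st 13)%R = ~~ (var st 11 <= var st 13)%R.
  by rewrite subr_gt0 ltNge.
by case: ltgtP => //= _; case: (_ <= _)%R.
Qed.

Lemma pseudo_test_spec n :
  test_spec pseudo_test n pseudob (fun _ _ _ => True).
Proof.
move=> st w sw h0 _ hw _; rewrite /pseudo_test; do 4 rewrite run_seq.
set s1 := run (Asn 13 _) _; rewrite run_seq; set c := If _ _ _.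
(* The stored minimum is described by the blocks below it, which also covers the case that no block
   is finished. *)
pose Inv u (f : nat -> int) := [/\ f 10 = Posz (head (0, 0) (blocks u)).1,
  f 11 = Posz (head (0, 0) (blocks u)).2 &
  forall b, all (ble b) (behead (blocks u)) = min_test (f 12) (f 13) (Posz b.1) (Posz b.2)].
have [h10 h11 hm] : Inv w (var (run (For 9 c) s1)).
  apply: loop_right => //; first by rewrite sw.
  move=> x u st' _ _ _ _ _ _ hb [i10 i11 im]; rewrite /Inv /c run_if hb.
  case: x {hb}; last first.
    rewrite /=; case: (blocks u) i10 i11 im => [|[s t] r] /= i10 i11 im;
    by split=> //; rewrite i10; lia.
  rewrite run_if [eval _ _]/= i10 /=.
  case: (blocks u) i10 i11 im => [|[[|s] t] r] /= i10 i11 im; rewrite ?run_asn /=.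
  - by rewrite i11.
  - by split=> //; rewrite i11; lia.
  rewrite cmp_minP i10 i11 -(im (s.+1, t)).
  case: ifP => hmin; rewrite !runE /=; split=> // b; rewrite im.
    rewrite i10 i11; move: hmin; rewrite (im (s.+1, t)) /ble /min_test /=.
    by move: (var st' 12) (var st' 13) => ms mt hmin; apply/idP/idP; lia.
  move: hmin; rewrite (im (s.+1, t)) /ble /min_test /=.
  by move: (var st' 12) (var st' 13) => ms mt hmin; apply/idP/idP; lia.
rewrite cmp_minP h10 h11 -hm /pseudob.
by case: (all _ _); rewrite run_asn.
Qed.

Lemma pseudo_necklace_generable (R : realType) (g : nat -> R) (c : bool) :
  (forall n, 0 < n -> (n%:R <= g n)%R) ->
  generable g enc_none (fun _ _ s => pseudo_necklace (if c then compl s else s)).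
Proof.
move=> hg.
apply: (@none_generable R g hg _ false c pseudo_test (fun _ => pseudob)) => //.
- move=> n w n0 sw; rewrite /word_map.
  have -> : (if c then compl (if c then compl w else w) else if c then compl w else w) = w.
    by case: c; rewrite // /compl (mapK negbK).
  by apply: pseudo_necklaceP; rewrite sw.
- exact: pseudob_shift.
- by move=> n _; apply: pseudo_test_spec.
Qed.

(** * The two growth bounds and the collected results *)

Lemma linear_bound_ge (R : realType) n : (0 < n)%N -> (n%:R <= linear_bound R n)%R.
Proof. by []. Qed.

Lemma pow1864_bound_ge (R : realType) n : (0 < n)%N -> (n%:R <= pow1864_bound R n)%R.
Proof.
move=> n0; rewrite /pow1864_bound -[leLHS]powRr1 ?ler0n // ler_powR ?ler1n //.
by rewrite ler_pdivlMr ?ltr0n // mul1r ler_nat.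
Qed.

Theorem theorem3 (R : realType) :
  (* (i) *)
  generable (linear_bound R) enc_none (fun _ _ _ => True) /\
  (* (ii) *)
  (generable (linear_bound R) enc_nat (fun _ k s => (weight s <= k)%N) /\
   generable (linear_bound R) enc_nat (fun _ k s => (k <= weight s)%N)) /\
  (* (iii) *)
  (generable (linear_bound R) enc_tuple (fun _ gamma s => lexle s gamma) /\
   generable (linear_bound R) enc_tuple (fun _ gamma s => lexle gamma s)) /\
  (* (iv) *)
  (generable (linear_bound R) enc_nat (fun _ k s => (inversions false s <= k)%N) /\
   generable (linear_bound R) enc_nat (fun _ k s => (inversions true s <= k)%N)) /\
  (* (v) *)
  (generable (linear_bound R) enc_nat
     (fun _ k s => exists m, transpositions false s m /\ (m <= k)%N) /\
   generable (linear_bound R) enc_nat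
     (fun _ k s => exists m, transpositions true s m /\ (m <= k)%N)) /\
  (* (vi) *)
  (generable (linear_bound R) enc_none (fun _ _ s => lexlt s (rev s)) /\
   generable (linear_bound R) enc_none (fun _ _ s => lexlt (rev s) s)) /\
  (* (vii) *)
  (generable (linear_bound R) enc_none (fun _ _ s => lexle s (rev s)) /\
   generable (linear_bound R) enc_none (fun _ _ s => lexle (rev s) s)) /\
  (* (viii) *)
  (generable (linear_bound R) enc_none (fun _ _ s => lexlt s (crev s)) /\
   generable (linear_bound R) enc_none (fun _ _ s => lexlt (crev s) s)) /\
  (* (ix) *)
  (generable (linear_bound R) enc_none (fun _ _ s => lexle s (crev s)) /\
   generable (linear_bound R) enc_none (fun _ _ s => lexle (crev s) s)) /\
  (* (x) *)
  (generable (linear_bound R) enc_nat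
     (fun _ t s => ~~ infix (true :: nseq t false) s) /\
   generable (linear_bound R) enc_nat
     (fun _ t s => ~~ infix (false :: nseq t true) s)) /\
  (* (xi) *)
  (generable (linear_bound R) enc_string
     (fun _ gamma s => ~~ prefix (true :: gamma) s) /\
   generable (linear_bound R) enc_string
     (fun _ gamma s => ~~ prefix (false :: gamma) s)) /\
  (* (xii) *)
  (generable (pow1864_bound R) enc_none (fun _ _ s => prefix_normal false s) /\
   generable (pow1864_bound R) enc_none (fun _ _ s => prefix_normal true s)) /\
  (* (xiii) *)
  (generable (linear_bound R) enc_none (fun _ _ s => necklace_min s) /\
   generable (linear_bound R) enc_none (fun _ _ s => necklace_max s)) /\
  (* (xiv) *)
  (generable (linear_bound R) enc_none (fun _ _ s => lyndon s) /\
   generable (linear_bound R) enc_none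
     (fun _ _ s => aperiodic s /\ necklace_max s)) /\
  (* (xv) *)
  (generable (linear_bound R) enc_none (fun _ _ s => prenecklace_min s) /\
   generable (linear_bound R) enc_none (fun _ _ s => prenecklace_max s)) /\
  (* (xvi) *)
  (generable (linear_bound R) enc_none (fun _ _ s => pseudo_necklace s) /\
   generable (linear_bound R) enc_none (fun _ _ s => pseudo_necklace (compl s))) /\
  (* (xvii) *)
  generable (linear_bound R) enc_nat (fun _ k s => dyck_left_factor k s) /\
  (* (xviii) *)
  generable (linear_bound R) enc_knapsack (fun n (K : knapsack n) s => feasible K s).
Proof.
have g1 := @linear_bound_ge R; have g2 := @pow1864_bound_ge R.
split; first exact: all_generable.
split; first by split; [exact: weight_le_generable|exact: weight_ge_generable].
split; first by split; [exact: lexle_generable|exact: lexge_generable].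
split; first by split; exact: inversions_generable.
split; first by split; exact: transpositions_generable.
split; first by split; [exact: (mirror_generable g1 (strict := true) (c := false) (cp := false))|
  exact: (mirror_generable g1 (strict := true) (c := false) (cp := true))].
split; first by split; [exact: (mirror_generable g1 (strict := false) (c := false) (cp := false))|
  exact: (mirror_generable g1 (strict := false) (c := false) (cp := true))].
split; first by split; [exact: (mirror_generable g1 (strict := true) (c := true) (cp := false))|
  exact: (mirror_generable g1 (strict := true) (c := true) (cp := true))].
split; first by split; [exact: (mirror_generable g1 (strict := false) (c := true) (cp := false))|
  exact: (mirror_generable g1 (strict := false) (c := true) (cp := true))].
split; first by split; [exact: no_10t_generable|exact: no_01t_generable].
split; first by split; [exact: no_prefix_1_generable|exact: no_prefix_0_generable].
split; first by split; exact: prefix_normal_generable.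
split; first by split; [exact: necklace_min_generable|exact: necklace_max_generable].
split; first by split; [exact: lyndon_generable|exact: aperiodic_necklace_max_generable].
split; first by split; [exact: prenecklace_min_generable|exact: prenecklace_max_generable].
split; first by split; [exact: (pseudo_necklace_generable false)|exact: (pseudo_necklace_generable true)].
split; first exact: dyck_generable.
exact: knapsack_generable.
Qed.
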